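(* Let $\mathcal P$ be a set of probability distributions on $\mathcal Z$ containing a hypercube of distributions characterized by its dimension $m$, its edge probability $w$ and its edge discrepancies $d_{\mathrm I}$ and $d_{\mathrm{II}}$. For any estimator $\hat g$ and training set size $n\ge1$, the following assertions hold (where $\min_g$ is over all prediction functions and $\mathbb ER(\hat g)=\mathbb E_{Z_1^n\sim P^{\otimes n}}R(\hat g_{Z_1^n})$). 1. We have $$\sup_{P\in\mathcal P}\big\{\mathbb ER(\hat g)-\min_gR(g)\big\}\ge mw\,d_{\mathrm I}\Big(1-\sqrt{1-[1-d_{\mathrm{II}}]^{nw}}\Big)\ge mw\,d_{\mathrm I}\big(1-\sqrt{nw\,d_{\mathrm{II}}}\big).$$ 2. When the hypercube is constant and symmetrical, for $N$ a centered Gaussian random variable with variance $1$, $$\sup_{P\in\mathcal P}\big\{\mathbb ER(\hat g)-\min_gR(g)\big\}\ge mw\,d_{\mathrm I}\Big\{\mathbb P\Big(|N|>\sqrt{\frac{nw\,d_{\mathrm{II}}}{1-d_{\mathrm{II}}}}\Big)-d_{\mathrm{II}}^{1/4}\Big\}.$$ 3. When the hypercube satisfies $p_+\equiv1\equiv1-p_-$, $$\sup_{P\in\mathcal P}\big\{\mathbb ER(\hat g)-\min_gR(g)\big\}\ge mw\,d_{\mathrm I}(1-w)^n.$$ 4. When the hypercube is constant and symmetrical and the differentiability assumption holds with constant $\zeta>0$, $$\sup_{P\in\mathcal P}\big\{\mathbb ER(\hat g)-\min_gR(g)\big\}\ge\frac{mw\zeta d_{\mathrm{II}}}8\Big\{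1+\tfrac12\big[1-\big(1-\sqrt{1-d_{\mathrm{II}}}\big)w\big]^n-\tfrac12\Big[1+\Big(\frac{1+d_{\mathrm{II}}}{\sqrt{1-d_{\mathrm{II}}}}-1\Big)w\Big]^n\Big\}.$$
   Context: Setting: $\mathcal Z=\mathcal X\times\mathcal Y$; a prediction function is a measurable map $\mathcal X\to\mathcal Y$; the loss is $\ell:\mathcal Y\times\mathcal Y\to\mathbb R$ and $R(g)=\mathbb E_{(X,Y)\sim P}\ell[Y,g(X)]$. An estimator maps a training set $Z_1^n\in\mathcal Z^n$ to a prediction function $\hat g_{Z_1^n}$. All quantities are implicitly assumed measurable and expectations and minima well defined. For $p,q_+,q_-,\alpha\in[0,1]$ and $y_1,y_2\in\mathcal Y$ let $\phi_{y_1,y_2}(p)=\inf_{y\in\mathcal Y}\{p\,\ell(y_1,y)+(1-p)\ell(y_2,y)\}$ and $$\psi_{q_+,q_-,y_1,y_2}(\alpha)=\phi_{y_1,y_2}[\alpha q_++(1-\alpha)q_-]-\alpha\phi_{y_1,y_2}(q_+)-(1-\alpha)\phi_{y_1,y_2}(q_-).$$ Hypercube. Let $m\ge1$ (the dimension). Consider $2^m$ probability distributions $P_{\bar\sigma}$ on $\mathcal Z$, $\bar\sigma=(\sigma_1,\dots,\sigma_m)\in\{-,+\}^m$, all with the same first marginal $\mu$ (on $\mathcal X$), such that there exist a partition $\mathcal X_0,\dots,\mathcal X_m$ of $\mathcal X$, functions $h_1,h_2:\mathcal X\setminus\mathcal X_0\to\mathcal Y$ (with $h_1(x)\ne h_2(x)$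 for every $x$) and functions $p_+,p_-:\mathcal X\setminus\mathcal X_0\to[0,1]$ such that for $j\in\{1,\dots,m\}$ and $x\in\mathcal X_j$, $$P_{\bar\sigma}(Y=h_1(x)|X=x)=p_{\sigma_j}(x)=1-P_{\bar\sigma}(Y=h_2(x)|X=x),$$ while for $x\in\mathcal X_0$ the law of $Y$ given $X=x$ does not depend on $\bar\sigma$. This family is a hypercube of distributions if $\mu(\mathcal X_j)$ is the same for all $j\in\{1,\dots,m\}$ and the law of $(p_+(X),p_-(X),h_1(X),h_2(X))$ when $X\sim\mu(\cdot\,|\,X\in\mathcal X_j)$ is the same for all $j\in\{1,\dots,m\}$. The edge probability is $w=\mu(\mathcal X_1)=\dots=\mu(\mathcal X_m)$. With $\mathbb E_{\mu(\cdot|\mathcal X_1)}$ the expectation over $X\sim\mu(\cdot\,|\,X\in\mathcal X_1)$ and all functions evaluated at $X$, the edge discrepancies are $$d_{\mathrm I}=\mathbb E_{\mu(\cdot|\mathcal X_1)}\,\psi_{p_+,p_-,h_1,h_2}(1/2),\qquad d_{\mathrm{II}}=\mathbb E_{\mu(\cdot|\mathcal X_1)}\big[\sqrt{p_+(1-p_-)}-\sqrt{(1-p_+)p_-}\,\big]^2.$$ The hypercube is constant if $p_+$ and $p_-$ are constant on $\mathcal X_1$, and symmetrical if $p_+=1-p_-$ on $\mathcal X\setminus\mathcal X_0$. Differentiability assumption (with constant $\zeta>0$): for every $x\in\mathcal X_1$, $\phi_{h_1(x),h_2(x)}$ is twice differentiable and $|\phi''_{h_1(x),h_2(x)}(t)|\ge\zeta$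 for all $t\in[p_-(x)\wedge p_+(x),\,p_-(x)\vee p_+(x)]$. When $d_{\mathrm{II}}=1$, the fractions with denominator $1-d_{\mathrm{II}}$ or $\sqrt{1-d_{\mathrm{II}}}$ are read as $+\infty$.
   Formalization: In 1, both lower bounds on the supremum are proved, but the second inequality of the chain only for nw ≥ 1 (it fails for 0 < nw < 1 when d_I, d_II > 0). ''Minima well defined'' is read as: prediction functions come within any ε of the pointwise minimal conditional risk on the blocks. *)

(* Defs.v *)
From HB Require Import structures.
From mathcomp Require Import all_boot all_order all_algebra.
From mathcomp Require Import all_classical all_reals all_analysis.
From mathcomp Require Import measurable_realfun.

Set Implicit Arguments.
Unset Strict Implicit.
Unset Printing Implicit Defensive.

Import Order.TTheory GRing.Theory Num.Theory.
Import numFieldTopology.Exports numFieldNormedType.Exports.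

Local Open Scope classical_set_scope.
Local Open Scope ring_scope.

(* Conventions: [X] is the input space, [Y] the output space, and a prediction
   function is an element of [{mfun X >-> Y}].  Risks and their suprema are
   extended real numbers. *)

Definition tuple_cons (T : Type) (n : nat) (u : T * n.-tuple T) :
  n.+1.-tuple T := [the n.+1.-tuple T of u.1 :: u.2].

Lemma measurable_tuple_cons (d : measure_display) (T : measurableType d)
  (n : nat) : measurable_fun [set: T * n.-tuple T] (@tuple_cons T n).
Proof. exact: (measurable_cons measurable_fst measurable_snd). Qed.

HB.instance Definition _ (d : measure_display) (T : measurableType d)
  (n : nat) := isMeasurableFun.Build _ _ _ _ (@tuple_cons T n)
    (@measurable_tuple_cons d T n).

(* The law of n independent draws from P. *)
Fixpoint iid (d : measure_display) (T : measurableType d) (R : realType)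
    (P : probability T R) (n : nat) : probability (n.-tuple T) R :=
  match n with
  | 0 => [the probability _ _ of \d_([tuple] : 0.-tuple T)]
  | k.+1 => [the probability _ _ of
      distribution [the probability _ _ of (P \x iid P k)%E]
        [the {mfun (T * k.-tuple T)%type >-> k.+1.-tuple T} of @tuple_cons T k]]
  end.

(* Conditional probability and expectation given the event A.  As 0^-1 = +oo
   and 0 * +oo = 0 in \bar R, both are 0 when mu A = 0. *)
Definition cond_prob (d : measure_display) (T : measurableType d)
    (R : realType) (mu : probability T R) (A B : set T) : \bar R :=
  (mu (A `&` B) / mu A)%E.

Definition cond_expect (d : measure_display) (T : measurableType d)
    (R : realType) (mu : probability T R) (A : set T) (f : T -> \bar R) :
    \bar R :=
  ((\int[mu]_(x in A) f x) / mu A)%E.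

Section risks.
Context {R : realType} {dX dY : measure_display}.
Context {X : measurableType dX} {Y : measurableType dY}.
Implicit Types (ell : Y -> Y -> R) (P : probability (X * Y)%type R).

Definition risk ell P (g : {mfun X >-> Y}) : \bar R :=
  (\int[P]_z (ell z.2 (g z.1))%:E)%E.

(* The minimal risk, equal to the minimum whenever a best prediction function
   exists. *)
Definition best_risk ell P : \bar R := ereal_inf (range (risk ell P)).

(* The integral in \bar R is a meaningful expectation unless both its positive
   and its negative parts are infinite. *)
Definition expectation_defined ell P (g : {mfun X >-> Y}) : Prop :=
  let f := fun z : X * Y => (ell z.2 (g z.1))%:E in
  ((\int[P]_z (f^\+ z) < +oo) \/ (\int[P]_z (f^\- z) < +oo))%E.

Definition well_posed ell P : Prop :=
  (forall g, expectation_defined ell P g) /\ best_risk ell P \is a fin_num.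

Definition expected_excess_risk ell n (ghat : n.-tuple (X * Y) -> {mfun X >-> Y})
    P : \bar R :=
  ((\int[iid P n]_z risk ell P (ghat z)) - best_risk ell P)%E.

Definition two_point_risk ell (y1 y2 : Y) (p : R) (y : Y) : R :=
  p * ell y1 y + (1 - p) * ell y2 y.

Definition phi ell (y1 y2 : Y) (p : R) : R :=
  inf (range (two_point_risk ell y1 y2 p)).

Definition psi ell (qp qm : R) (y1 y2 : Y) (a : R) : R :=
  phi ell y1 y2 (a * qp + (1 - a) * qm)
    - a * phi ell y1 y2 qp - (1 - a) * phi ell y1 y2 qm.

End risks.

(* A sign vector is encoded by booleans, [true] standing for +.  The parts are
   X_0 = hc_part ord0 and X_j = hc_part (lift ord0 j') with j' = j - 1 : 'I_m.
   The functions p_+, p_-, h_1, h_2 live on the complement of X_0; their values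
   on X_0 are junk. *)
Record hypercube (R : realType) (dX dY : measure_display)
    (X : measurableType dX) (Y : measurableType dY) (m : nat) := Hypercube {
  hc_P : {ffun 'I_m -> bool} -> probability (X * Y)%type R ;
  hc_mu : probability X R ;
  hc_part : 'I_m.+1 -> set X ;
  hc_h1 : X -> Y ;
  hc_h2 : X -> Y ;
  hc_pp : X -> R ;
  hc_pm : X -> R ;
  (* a version of the law of Y given X under each distribution *)
  hc_cond : {ffun 'I_m -> bool} -> R.-pker X ~> Y ;

  hc_part_measurable : forall i, measurable (hc_part i) ;
  hc_part_disjoint : trivIset [set: 'I_m.+1] hc_part ;
  hc_part_cover : \bigcup_i hc_part i = [set: X] ;

  hc_h1_measurable : measurable_fun (~` hc_part ord0) hc_h1 ;
  hc_h2_measurable : measurable_fun (~` hc_part ord0) hc_h2 ;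
  hc_pp_measurable : measurable_fun (~` hc_part ord0) hc_pp ;
  hc_pm_measurable : measurable_fun (~` hc_part ord0) hc_pm ;
  (* makes the events Y = h_1(x) and Y = h_2(x) measurable *)
  hc_set1_measurable : forall x, ~ hc_part ord0 x ->
    measurable [set hc_h1 x] /\ measurable [set hc_h2 x] ;
  hc_h_neq : forall x, ~ hc_part ord0 x -> hc_h1 x <> hc_h2 x ;
  hc_p_itv : forall x, ~ hc_part ord0 x ->
    0 <= hc_pp x <= 1 /\ 0 <= hc_pm x <= 1 ;

  hc_marginal : forall s A, measurable A -> hc_P s (A `*` [set: Y]) = hc_mu A ;
  hc_disintegration : forall s A B, measurable A -> measurable B ->
    hc_P s (A `*` B) = (\int[hc_mu]_(x in A) hc_cond s x B)%E ;
  hc_cond_block : forall (s : {ffun 'I_m -> bool}) (j : 'I_m) x, hc_part (lift ord0 j) x ->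
    let p := if s j then hc_pp x else hc_pm x in
    hc_cond s x [set hc_h1 x] = p%:E /\
    p%:E = (1 - hc_cond s x [set hc_h2 x])%E ;
  hc_cond_rest : forall s s' x B, hc_part ord0 x -> measurable B ->
    hc_cond s x B = hc_cond s' x B ;

  hc_same_mass : forall i j : 'I_m,
    hc_mu (hc_part (lift ord0 i)) = hc_mu (hc_part (lift ord0 j)) ;
  hc_same_law : forall (i j : 'I_m) (B : set (R * R * Y * Y)), measurable B ->
    let T := fun x => (hc_pp x, hc_pm x, hc_h1 x, hc_h2 x) in
    cond_prob hc_mu (hc_part (lift ord0 i)) (T @^-1` B) =
    cond_prob hc_mu (hc_part (lift ord0 j)) (T @^-1` B)
}.

Section hypercubes.
Context {R : realType} {dX dY : measure_display}.
Context {X : measurableType dX} {Y : measurableType dY} {m : nat}.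
Implicit Types (ell : Y -> Y -> R) (H : hypercube R X Y m).

Definition first_block H : set X := hc_part H (inord 1).

Definition edge_probability H : R := fine (hc_mu H (first_block H)).

Definition edge_discrepancy1 ell H : \bar R :=
  cond_expect (hc_mu H) (first_block H)
    (fun x => (psi ell (hc_pp H x) (hc_pm H x) (hc_h1 H x) (hc_h2 H x)
                 (1 / 2))%:E).

Definition edge_discrepancy2 H : R :=
  fine (cond_expect (hc_mu H) (first_block H) (fun x =>
    ((Num.sqrt (hc_pp H x * (1 - hc_pm H x))
      - Num.sqrt ((1 - hc_pp H x) * hc_pm H x)) ^+ 2)%:E)).

Definition constant_hypercube H : Prop :=
  (exists c, forall x, first_block H x -> hc_pp H x = c) /\
  (exists c, forall x, first_block H x -> hc_pm H x = c).

Definition symmetrical_hypercube H : Prop :=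
  forall x, ~ hc_part H ord0 x -> hc_pp H x = 1 - hc_pm H x.

(* The conditional risks on the blocks can be brought arbitrarily close to
   their pointwise infima by (measurable) prediction functions. *)
Definition has_measurable_near_minimizers ell H : Prop :=
  forall (s : {ffun 'I_m -> bool}) (eps : R), 0 < eps ->
  exists g : {mfun X >-> Y}, forall j : 'I_m,
  {ae hc_mu H, forall x, hc_part H (lift ord0 j) x ->
    let p := if s j then hc_pp H x else hc_pm H x in
    two_point_risk ell (hc_h1 H x) (hc_h2 H x) p (g x)
      <= phi ell (hc_h1 H x) (hc_h2 H x) p + eps}.

End hypercubes.

(* Derivative relative to D, so that it is one-sided at the end points when D
   is an interval. *)
Definition is_derivative_within (R : realType) (D : set R) (f : R -> R)
    (t l : R) : Prop :=
  (fun s => (f s - f t) / (s - t)) @ within D t^' --> l.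

Definition differentiability_assumption (R : realType)
    (dX dY : measure_display) (X : measurableType dX) (Y : measurableType dY)
    (m : nat) (ell : Y -> Y -> R) (H : hypercube R X Y m) (zeta : R) : Prop :=
  forall x, first_block H x ->
  let f := phi ell (hc_h1 H x) (hc_h2 H x) in
  exists f' f'' : R -> R,
    [/\ forall t, 0 <= t <= 1 -> is_derivative_within `[0, 1] f t (f' t),
        forall t, 0 <= t <= 1 -> is_derivative_within `[0, 1] f' t (f'' t) &
        forall t, Num.min (hc_pm H x) (hc_pp H x) <= t
                    <= Num.max (hc_pm H x) (hc_pp H x) ->
          zeta <= `|f'' t| ].

(* Main.v *)
(** The supremum dominates the mean over the 2^m vertices, which splits into pairs
    of vertices differing in a single coordinate j.  On X_j, whatever the
    prediction, weights a and b of the two vertices of a pair cost an excess risk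
    of at least (a + b) E psi(a / (a + b)); with a and b the two likelihoods of
    the sample, it remains to bound an affinity of the two product laws.
    Concavity of phi gives 2 min(a, b) E psi(1/2), hence assertions 1-3: the
    integral of min(a, b) is bounded through the Hellinger affinity, which is
    multiplicative, for 1, and through the event that no observation falls in
    X_j for 3.  For 2 it is a binomial mean of affinities of two oppositely
    biased sign sequences; such an affinity is one minus the distribution
    function of the absolute value of a Student variable, which is compared with
    the Gaussian one, and Jensen's inequality removes the binomial mean.
    For 4 strong concavity of phi gives a multiple of a b / (a + b), and
      2 a b / (a + b) >= (a + b) / 2 + sqrt(a b) / 2 - (a^2 + b^2) / (4 sqrt(a b)),
    all of whose terms have product form. *)

Require Import Defs.
From HB Require Import structures.
From mathcomp Require Import all_boot all_order all_algebra.
From mathcomp Require Import all_classical all_reals all_analysis.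
From mathcomp Require Import measurable_realfun.
From mathcomp Require Import ring lra zify.

Set Implicit Arguments.
Unset Strict Implicit.
Unset Printing Implicit Defensive.

Import Order.TTheory GRing.Theory Num.Theory.
Import numFieldTopology.Exports numFieldNormedType.Exports.
Local Open Scope classical_set_scope.
Local Open Scope ring_scope.

(** * Densities and independent samples *)

(** Both bounds of assertion 1 come from the sharper [1 - sqrt(1 - (1 - w d_II)^n)]. When p_+ and
    p_- vary with x, the affinity of the two product laws does not yield it: the affinity must be
    taken conditionally on the inputs, and Jensen's inequality applied to its square. This is the
    origin of the tilt of the likelihoods by conditional Hellinger affinities. Likelihoods are taken
    relative to a version [q] of (p_+, p_-) defined on all of [X]. The extension by zero serves
    assertions 1 and 3; a pair of constants serves 2 and 4, because constancy on X_1 reaches the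
    other blocks only almost everywhere, through the equality of laws. Risks and d_I may be
    infinite, so inequalities are integrated with nonnegative terms on both sides, and square roots
    are replaced by families of linear bounds with a free parameter. In assertion 2 the Student
    comparison produces [n w + 2] in place of [n w]; the term [d_II^(1/4)] pays for this shift. *)

Section density.
Local Open Scope ereal_scope.
Context d1 d2 (W : measurableType d1) (Z : measurableType d2) (R : realType).
Variables (lam : {measure set W -> \bar R}) (f : W -> R) (p : W -> Z).
Hypotheses (mf : measurable_fun setT f) (f0 : forall u, (0 <= f u)%R).
Hypothesis (mp : measurable_fun setT p).

(** The image under [p] of the measure with density [f] with respect to [lam]. Allowing an image
    lets a law on [X * Y] be described by a density on a larger space. *)
Definition pushdensity (S : set Z) : \bar R :=
  \int[lam]_(u in p @^-1` S) (f u)%:E.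

Let mpre S : measurable S -> measurable (p @^-1` S).
Proof. by move=> mS; rewrite -[X in measurable X]setTI; exact: mp. Qed.

Let pushdensity0 : pushdensity set0 = 0.
Proof. by rewrite /pushdensity preimage_set0 integral_set0. Qed.

Let pushdensity_ge0 S : 0 <= pushdensity S.
Proof. by apply: integral_ge0 => u _; rewrite lee_fin. Qed.

Let pushdensity_sigma_additive : semi_sigma_additive pushdensity.
Proof.
move=> F mF tF mUF; rewrite /pushdensity preimage_bigcup.
rewrite ge0_integral_bigcup//.
- apply: is_cvg_ereal_nneg_natsum_cond => n _ _.
  exact: pushdensity_ge0.
- by move=> k; exact: mpre.
- by apply/measurable_EFinP; exact: measurable_funTS.
- by move=> x _; rewrite lee_fin.
- apply/trivIsetP => /= i j _ _ ij; rewrite -preimage_setI.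
  by move/trivIsetP : tF => /(_ _ _ _ _ ij) ->//; rewrite preimage_set0.
Qed.

HB.instance Definition _ := isMeasure.Build _ _ _ pushdensity
  pushdensity0 pushdensity_ge0 pushdensity_sigma_additive.

Definition pushdensity_measure : {measure set Z -> \bar R} := pushdensity.

Import HBNNSimple.

Lemma ge0_integral_density (nu : {measure set Z -> \bar R}) (F : Z -> \bar R) :
  (forall S, measurable S -> nu S = pushdensity S) ->
  measurable_fun setT F -> (forall z, 0 <= F z) ->
  \int[nu]_z F z = \int[lam]_u (F (p u) * (f u)%:E).
Proof.
move=> nuE mF F0.
(* Monotone convergence along simple functions, then linearity, reduces [F] to an indicator. *)
pose F_ := nnsfun_approx measurableT mF.
have mFp n : measurable_fun [set: W] (fun u => (F_ n (p u))%:E).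
  by apply/measurable_EFinP; apply: measurableT_comp.
have mfE : measurable_fun [set: W] (fun u => (f u)%:E).
  exact/measurable_EFinP.
transitivity (limn (fun n => \int[nu]_x (F_ n x)%:E)).
  rewrite -monotone_convergence//.
  - apply: eq_integral => y _; apply/esym/cvg_lim => //.
    exact: cvg_nnsfun_approx.
  - by move=> n; exact/measurable_EFinP/measurable_funP.
  - by move=> n y _; rewrite lee_fin.
  - by move=> y _ m n mn; rewrite lee_fin; exact/lefP/nd_nnsfun_approx.
rewrite [X in limn X](_ : _ =
    (fun n => \int[lam]_u ((F_ n (p u))%:E * (f u)%:E))).
  rewrite -monotone_convergence//; last 3 first.
    - by move=> n; apply: emeasurable_funM.
    - by move=> n x _ /=; rewrite -EFinM lee_fin mulr_ge0.
    - move=> x _ m n mn; rewrite -!EFinM lee_fin ler_wpM2r//.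
      exact/lefP/nd_nnsfun_approx.
  apply: eq_integral => x _ /=; apply/cvg_lim => //.
  by apply: cvgeZr => //; apply: cvg_nnsfun_approx.
apply/funext => n.
transitivity (\sum_(k \in range (F_ n))
    \int[nu]_x (k * \1_(F_ n @^-1` [set k]) x)%:E).
  under eq_integral do rewrite fimfunE -fsumEFin//.
  rewrite ge0_integral_fsum//.
  - by move=> y; exact/measurable_EFinP/measurable_funM.
  - by move=> y x _; rewrite nnfun_muleindic_ge0.
transitivity (\sum_(k \in range (F_ n))
    \int[lam]_u (k * \1_(F_ n @^-1` [set k]) (p u) * f u)%:E); last first.
  rewrite -ge0_integral_fsum//.
  - apply: eq_integral => x _; rewrite -EFinM fimfunE.
    by rewrite mulr_fsuml ?fsumEFin.
  - move=> r; apply/measurable_EFinP/measurable_funM => //.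
    by apply/measurable_funM => //; apply: measurableT_comp.
  - move=> r x _; rewrite EFinM mule_ge0 ?lee_fin//.
    by have := nnfun_muleindic_ge0 (F_ n) r (p x); rewrite lee_fin.
apply: eq_fsbigr => r /set_mem [z _ <-].
have r0 : (0 <= F_ n z)%R by [].
under eq_integral do rewrite EFinM.
rewrite ge0_integralZl_EFin//; last exact/measurable_EFinP.
under [RHS]eq_integral do rewrite -mulrA EFinM.
rewrite ge0_integralZl_EFin//; last 2 first.
  by move=> x _; rewrite lee_fin mulr_ge0.
  apply/measurable_EFinP/measurable_funM => //.
  by apply: measurableT_comp.
congr (_ * _); rewrite integral_indic// setIT nuE//.
rewrite /pushdensity integral_mkcond; apply: eq_integral => u _.
rewrite patchE /= indicE.
have -> : (u \in p @^-1` (F_ n @^-1` [set F_ n z])) =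
  (p u \in F_ n @^-1` [set F_ n z]) by apply/idP/idP; rewrite !inE.
by case: ifPn => _; rewrite ?mul1r ?mul0r.
Qed.

Lemma ge0_integral_pushdensity (F : Z -> \bar R) :
  measurable_fun setT F -> (forall z, 0 <= F z) ->
  \int[pushdensity]_z F z = \int[lam]_u (F (p u) * (f u)%:E).
Proof. by move=> mF F0; exact: ge0_integral_density. Qed.

End density.

Section density_unique.
Local Open Scope ereal_scope.
Context d1 d2 d3 (W : measurableType d1) (X : measurableType d2)
  (Y : measurableType d3) (R : realType).
Variables (lam : {measure set W -> \bar R}) (f : W -> R) (p : W -> (X * Y)%type).
Hypotheses (mf : measurable_fun setT f) (f0 : forall u, (0 <= f u)%R).
Hypothesis (mp : measurable_fun setT p).

(** Rectangles generate the product and are stable under intersection; the disintegration of a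
    vertex describes its law on rectangles only. *)
Lemma density_rectangles (nu : {finite_measure set (X * Y)%type -> \bar R}) :
  (forall A B, measurable A -> measurable B ->
     nu (A `*` B) = pushdensity lam f p (A `*` B)) ->
  forall S, measurable S -> nu S = pushdensity lam f p S.
Proof.
move=> nuE S mS.
pose m' : {measure set (X * Y)%type -> \bar R} :=pushdensity_measure lam mf f0 mp.
apply: (measure_unique [set A `*` B | A in measurable & B in measurable]
  (fun=> setT) _ _ _ _ nu m' _ _ S mS).
- exact: measurable_prod_measurableType.
- move=> _ _ [A1 mA1 [B1 mB1 <-]] [A2 mA2 [B2 mB2 <-]].
  exists (A1 `&` A2); first exact: measurableI.
  by exists (B1 `&` B2); [exact: measurableI|rewrite setXI].
- by move=> _; exists setT => //; exists setT; rewrite // setXTT.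
- by rewrite bigcup_const.
- by move=> _ [A mA [B mB <-]]; exact: nuE.
- by move=> _; rewrite ltey_eq fin_num_measure.
Qed.
End density_unique.

Section iid_integral.
Local Open Scope ereal_scope.
Context d (T : measurableType d) (R : realType).
Implicit Types P : probability T R.

Lemma measurable_prod_tuple n (g : T -> R) : measurable_fun setT g ->
  measurable_fun [set: n.-tuple T] (fun u => \prod_(x <- u) g x)%R.
Proof.
move=> mg; rewrite (_ : (fun u => _) =
  fun u : n.-tuple T => (\prod_(i <- index_enum 'I_n) g (tnth u i))%R); last first.
  by apply/funext => u; rewrite big_tuple.
apply: measurable_prod => i _.
by apply: measurableT_comp => //; exact: measurable_tnth.
Qed.

Lemma emeasurable_prod_tuple n (g : T -> R) : measurable_fun setT g ->
  measurable_fun [set: n.-tuple T] (fun u => (\prod_(x <- u) g x)%R%:E).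
Proof. by move=> mg; apply/measurable_EFinP; exact: measurable_prod_tuple. Qed.

Lemma ge0_integral_iidS P n (F : n.+1.-tuple T -> \bar R) :
  measurable_fun setT F -> (forall z, 0 <= F z) ->
  \int[iid P n.+1]_z F z = \int[P]_x \int[iid P n]_t F (tuple_cons (x, t)).
Proof.
move=> mF F0; rewrite /= ge0_integral_pushforward//=.
rewrite preimage_setT fubini_tonelli1//=.
by apply: measurableT_comp => //; exact: measurable_tuple_cons.
Qed.

Lemma measurable_integral_iid P n (F : n.+1.-tuple T -> \bar R) :
  measurable_fun setT F -> (forall z, 0 <= F z) ->
  measurable_fun setT (fun x => \int[iid P n]_t F (tuple_cons (x, t))).
Proof.
move=> mF F0.
apply: (@measurable_fun_fubini_tonelli_F _ _ T (n.-tuple T) R (iid P n)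
  (F \o @tuple_cons T n)).
- by apply: measurableT_comp => //; exact: measurable_tuple_cons.
- by move=> x; exact: F0.
Qed.

Lemma ge0_integral_iid_prod P n (g : T -> R) : measurable_fun setT g ->
  (forall x, (0 <= g x)%R) ->
  \int[iid P n]_u (\prod_(x <- u) g x)%R%:E = (\int[P]_x (g x)%:E) ^+ n.
Proof.
move=> mg g0; elim: n => [|n IH].
  rewrite /= integral_dirac//.
    by rewrite diracT mul1e big_nil.
  exact: emeasurable_prod_tuple.
rewrite ge0_integral_iidS; last 2 first.
- exact: emeasurable_prod_tuple.
- by move=> z; rewrite lee_fin; exact: prodr_ge0.
under eq_integral => x _.
  under eq_integral do rewrite /= big_cons EFinM.
  rewrite ge0_integralZl_EFin//; do ?[exact: emeasurable_prod_tuple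
    |by move=> z _; rewrite lee_fin; exact: prodr_ge0].
  rewrite IH; over.
rewrite ge0_integralZr//; do ?[exact/measurable_EFinP
  |by move=> x _; rewrite lee_fin].
- by rewrite expeS muleC.
- by apply: expe_ge0; apply: integral_ge0 => x _; rewrite lee_fin.
Qed.

End iid_integral.

Section iid_density.
Local Open Scope ereal_scope.
Context d1 d2 (W : measurableType d1) (Z : measurableType d2) (R : realType).
Variables (lam : probability W R) (nu : probability Z R) (f : W -> R) (p : W -> Z).
Hypotheses (mf : measurable_fun setT f) (f0 : forall u, (0 <= f u)%R).
Hypothesis (mp : measurable_fun setT p).
Hypothesis nuE : forall S, measurable S -> nu S = pushdensity lam f p S.

Lemma measurable_map_tuple n :
  measurable_fun setT (map_tuple p : n.-tuple W -> n.-tuple Z).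
Proof.
apply/measurable_fun_tnthP => i.
rewrite (_ : _ \o _ = p \o (fun u => tnth u i)).
  by apply: measurableT_comp => //; exact: measurable_tnth.
by apply/funext => u; rewrite /= tnth_map.
Qed.

(** Change of measure, one observation at a time: it puts the samples of all vertices on one
    probability space, with the product of the densities as likelihood. *)
Lemma ge0_integral_iid_density n (F : n.-tuple Z -> \bar R) :
  measurable_fun setT F -> (forall z, 0 <= F z) ->
  \int[iid nu n]_z F z =
  \int[iid lam n]_u (F (map_tuple p u) * (\prod_(x <- u) f x)%R%:E).
Proof.
elim: n F => [|n IH] F mF F0.
  rewrite /= !integral_dirac//; last first.
    apply: emeasurable_funM.
      by apply: measurableT_comp => //; exact: measurable_map_tuple.
    exact: emeasurable_prod_tuple.
  rewrite !diracT !mul1e big_nil mule1; congr F.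
  exact: val_inj.
rewrite !ge0_integral_iidS//; last 2 first.
- apply: emeasurable_funM.
    by apply: measurableT_comp => //; exact: measurable_map_tuple.
  exact: emeasurable_prod_tuple.
- by move=> u; rewrite mule_ge0// lee_fin prodr_ge0.
rewrite (ge0_integral_density mf f0 mp nuE); last 2 first.
- exact: measurable_integral_iid.
- by move=> z; apply: integral_ge0.
apply: eq_integral => x _.
have mFx : measurable_fun setT (fun t : n.-tuple Z => F (tuple_cons (p x, t))).
  apply: (@measurableT_comp _ _ _ _ _ _ F) => //.
  apply: (measurableT_comp (@measurable_tuple_cons _ Z n)).
  exact: measurable_fun_pair.
rewrite IH// -ge0_integralZr//.
- apply: eq_integral => t _; rewrite -muleA -EFinM big_cons mulrC.
  by congr (F _ * _); exact: val_inj.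
- apply: emeasurable_funM.
    by apply: (measurableT_comp mFx); exact: measurable_map_tuple.
  exact: emeasurable_prod_tuple.
- by move=> u _; rewrite mule_ge0// lee_fin prodr_ge0.
- by rewrite lee_fin.
Qed.

End iid_density.

(** * Sums of minima of product likelihoods *)

Section sign_test.
Context {R : realType}.
Implicit Types p q x y r : R.

(* The affinity [sum of min] between k-fold products of the two laws (p, q) and
   (q, p) on two points, weighted by x and y: i is the number of successes. *)
Definition sign_affinity p q (k : nat) x y : R :=
  \sum_(i < k.+1) 'C(k, i)%:R *
    Num.min (x * p ^+ i * q ^+ (k - i)) (y * q ^+ i * p ^+ (k - i)).

Lemma sign_affinity0 p q x y : sign_affinity p q 0 x y = Num.min x y.
Proof. by rewrite /sign_affinity big_ord1 bin0 mul1r !expr0 !mulr1. Qed.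

(** Conditioning on one observation, by Pascal's rule. Integration over samples obeys the same
    recursion, which is how this sum enters [integral_min_likelihood]. *)
Lemma sign_affinityS p q k x y : sign_affinity p q k.+1 x y =
  sign_affinity p q k (p * x) (q * y) + sign_affinity p q k (q * x) (p * y).
Proof.
pose T i := Num.min (x * p ^+ i * q ^+ (k.+1 - i)) (y * q ^+ i * p ^+ (k.+1 - i)).
transitivity (\sum_(i < k.+1) 'C(k, i)%:R * T i.+1 +
              \sum_(i < k.+1) 'C(k, i)%:R * T i).
  rewrite /sign_affinity -/(T _) big_ord_recl /= bin0.
  under eq_bigr => i _ do rewrite /bump /= add1n binS natrD mulrDl -/(T _).
  rewrite big_split /= addrA [LHS]addrC; congr (_ + _).
  rewrite [RHS]big_ord_recl /= bin0; congr (_ + _).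
  rewrite big_ord_recr /= bin_small// mul0r addr0.
  by apply: eq_bigr => i _; rewrite /bump /= add1n.
congr (_ + _); apply: eq_bigr => i _; congr (_ * _); rewrite /T.
  by rewrite subSS !exprS; congr Num.min; ring.
by rewrite subSn -1?ltnS// !exprS; congr Num.min; ring.
Qed.

Lemma sign_affinity_ge0 p q k x y : 0 <= p -> 0 <= q -> 0 <= x -> 0 <= y ->
  0 <= sign_affinity p q k x y.
Proof.
move=> p0 q0 x0 y0; apply: sumr_ge0 => i _.
by rewrite mulr_ge0// le_min !mulr_ge0 ?exprn_ge0.
Qed.

Lemma sign_affinityZ p q k c x y : 0 <= c ->
  sign_affinity p q k (c * x) (c * y) = c * sign_affinity p q k x y.
Proof.
move=> c0; rewrite /sign_affinity mulr_sumr; apply: eq_bigr => i _.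
by rewrite -!mulrA -minr_pMr// mulrCA.
Qed.

Lemma sign_affinity_swap p q k x y :
  sign_affinity q p k x y = sign_affinity p q k x y.
Proof.
elim: k x y => [|k IH] x y; first by rewrite !sign_affinity0.
by rewrite !sign_affinityS !IH addrC.
Qed.

(** An extra observation improves the test only when the first [k] are tied: otherwise it cannot
    reverse the preference for one of the laws. A tie loses [p - q] times its probability. *)
Let next_term p q k i : (i <= k)%N -> 0 <= q <= p -> p + q = 1 ->
  Num.min (p * p ^+ i * q ^+ (k - i)) (q * q ^+ i * p ^+ (k - i)) +
  Num.min (q * p ^+ i * q ^+ (k - i)) (p * q ^+ i * p ^+ (k - i)) =
  Num.min (p ^+ i * q ^+ (k - i)) (q ^+ i * p ^+ (k - i)) -
    (p - q) * (p ^+ i * q ^+ (k - i)) *+ (i.*2 == k).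
Proof.
move=> lik /andP[q0 qp] pq1; have p0 : 0 <= p by lra.
(* A lead of [f + 1] followed by a contrary observation is still a lead of [f]. *)
have key e f : p ^+ e.+1 * q ^+ e * (p ^+ f * q) >= q ^+ e.+1 * p ^+ e * (q ^+ f * p).
  have -> : q ^+ e.+1 * p ^+ e * (q ^+ f * p) = (p * q) ^+ e.+1 * q ^+ f.
    by rewrite exprMn !exprS; ring.
  have -> : p ^+ e.+1 * q ^+ e * (p ^+ f * q) = (p * q) ^+ e.+1 * p ^+ f.
    by rewrite exprMn !exprS; ring.
  by rewrite ler_wpM2l ?exprn_ge0 ?mulr_ge0// lerXn2r.
have key' e f : q ^+ e * p ^+ e * q ^+ f <= p ^+ e * q ^+ e * p ^+ f.
  by rewrite [q ^+ e * _]mulrC ler_wpM2l ?mulr_ge0 ?exprn_ge0// lerXn2r.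
have [ik|ki|ik] := ltngtP i.*2 k.
- have -> : p ^+ (k - i) = p ^+ i * p ^+ (k - i.*2).-1.+1.
    by rewrite -exprD; congr (_ ^+ _); lia.
  have -> : q ^+ (k - i) = q ^+ i * q ^+ (k - i.*2).-1.+1.
    by rewrite -exprD; congr (_ ^+ _); lia.
  set f := (k - i.*2).-1; rewrite mulr0n subr0.
  have k1 := key i f; have k2 := key' i f.+1; have k3 := key' i f.+2.
  rewrite !min_l; [by rewrite -mulrDl -mulrDl pq1 mul1r| | |].
  + by move: k2; rewrite !exprS; lra.
  + by move: k3; rewrite !exprS; lra.
  + by move: k1; rewrite !exprS; lra.
- have -> : p ^+ i = p ^+ (k - i) * p ^+ (i.*2 - k).-1.+1.
    by rewrite -exprD; congr (_ ^+ _); lia.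
  have -> : q ^+ i = q ^+ (k - i) * q ^+ (i.*2 - k).-1.+1.
    by rewrite -exprD; congr (_ ^+ _); lia.
  set f := (i.*2 - k).-1; set e := (k - i)%N; rewrite mulr0n subr0.
  have k1 := key e f; have k2 := key' e f.+1; have k3 := key' e f.+2.
  rewrite !min_r; [by rewrite -mulrDl -mulrDl [q + p]addrC pq1 mul1r| | |].
  + by move: k2; rewrite !exprS; lra.
  + by move: k1; rewrite !exprS; lra.
  + by move: k3; rewrite !exprS; lra.
- have -> : (k - i = i)%N by rewrite -ik -addnn addnK.
  have := key' i 0; rewrite expr0 !mulr1 mulr1n => k1.
  have pi0 : 0 <= p ^+ i * q ^+ i by rewrite mulr_ge0 ?exprn_ge0.
  have -> : p * p ^+ i * q ^+ i = p * (p ^+ i * q ^+ i) by ring.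
  have -> : q * q ^+ i * p ^+ i = q * (p ^+ i * q ^+ i) by ring.
  have -> : q * p ^+ i * q ^+ i = q * (p ^+ i * q ^+ i) by ring.
  have -> : p * q ^+ i * p ^+ i = p * (p ^+ i * q ^+ i) by ring.
  have -> : q ^+ i * p ^+ i = p ^+ i * q ^+ i by ring.
  rewrite minxx min_r ?min_l ?ler_wpM2r//.
  have -> : p = 1 - q by lra.
  ring.
Qed.

Lemma sign_affinity_next p q k : 0 <= q <= p -> p + q = 1 ->
  sign_affinity p q k.+1 1 1 = sign_affinity p q k 1 1 -
    \sum_(i < k.+1 | i.*2 == k) 'C(k, i)%:R * ((p - q) * (p ^+ i * q ^+ (k - i))).
Proof.
move=> qp pq1; rewrite sign_affinityS !mulr1 /sign_affinity -big_split /=.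
rewrite [X in _ - X]big_mkcond -sumrB; apply: eq_bigr => i _.
rewrite -mulrDr next_term -1?ltnS// mulrBr !mul1r.
by case: eqP => _; rewrite ?mulr1n ?mulr0n ?mulr0.
Qed.

Lemma sign_affinity_odd p q k : 0 <= q <= p -> p + q = 1 -> odd k ->
  sign_affinity p q k.+1 1 1 = sign_affinity p q k 1 1.
Proof.
move=> qp pq1 ok; rewrite sign_affinity_next// big1 ?subr0// => i /eqP ik.
by have := congr1 odd ik; rewrite odd_double ok.
Qed.

Lemma sign_affinity_even p q k : 0 <= q <= p -> p + q = 1 ->
  sign_affinity p q k.*2.+1 1 1 = sign_affinity p q k.*2 1 1 -
    (p - q) * 'C(k.*2, k)%:R * (p * q) ^+ k.
Proof.
move=> qp pq1; rewrite sign_affinity_next//; congr (_ - _).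
have kk : (k < k.*2.+1)%N by lia.
rewrite (big_pred1 (Ordinal kk)) => [|i].
  by rewrite /= -addnn addnK exprMn; ring.
by apply/eqP/eqP => [ik|-> //]; apply: val_inj => /=; lia.
Qed.

End sign_test.

(** * Gaussian tails *)

Section gauss_mass.
Context {R : realType}.
Implicit Types x y : R.

Local Notation g := (@normal_pdf R 0 1).

(** The distribution function of [|N|]; for negative [x] the interval is empty and the value is
    0. *)
Definition gauss_mass x : R := fine (normal_prob 0 1 `[- x, x]%classic).

Let g_ge0 x : 0 <= g x. Proof. exact: normal_pdf_ge0. Qed.

Let gE x : g x = normal_peak 1 * expR (- (x ^+ 2 / 2)).
Proof.
by rewrite normal_pdfE ?oner_neq0// /normal_fun subr0 expr1n mulNr.
Qed.

Let g_anti x y : `|x| <= `|y| -> g y <= g x.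
Proof.
move=> xy; rewrite !gE ler_wpM2l ?normal_peak_ge0// ler_expR lerN2.
by rewrite ler_wpM2r// -[x ^+ 2]real_normK ?num_real// -[y ^+ 2]real_normK
  ?num_real// lerXn2r// nnegrE.
Qed.

Lemma normal_pdf0_le : 2 * g 0 <= 1.
Proof.
rewrite gE expr0n mul0r oppr0 expR0 mulr1 /normal_peak expr1n mul1r.
have pi2 : 2 <= pi :> R by exact: pi_ge2.
have : 2 <= Num.sqrt (pi *+ 2) :> R.
  rewrite -[leLHS](@ger0_norm R 2)// -sqrtr_sqr ler_wsqrtr//; lra.
by move=> h; rewrite ler_pdivrMr ?mul1r ?mulr1// (lt_le_trans _ h).
Qed.

Let mass_bounds (A : set R) (a b l : R) : measurable A -> 0 <= a ->
  lebesgue_measure A = l%:E -> (forall t, A t -> a <= g t <= b) ->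
  ((a * l)%:E <= normal_prob 0 1 A <= (b * l)%:E)%E.
Proof.
move=> mA a0 Al ab; have mg : measurable_fun A (fun t => (g t)%:E).
  by apply/measurable_EFinP; apply: measurable_funTS; exact: measurable_normal_pdf.
rewrite /normal_prob !EFinM -Al -!integral_cst//; apply/andP; split.
  apply: ge0_le_integral => //.
  by move=> t /ab /andP[+ _]; rewrite lee_fin.
apply: ge0_le_integral => //.
  by move=> t /ab /andP[h h']; rewrite lee_fin.
by move=> t /ab /andP[_ +]; rewrite lee_fin.
Qed.

Let mass_itv (b1 b2 : bool) (s t : R) : s <= t ->
  lebesgue_measure [set` Interval (BSide b1 s) (BSide b2 t)] = (t - s)%:E.
Proof.
rewrite le_eqVlt => /predU1P[->|st]; rewrite lebesgue_measure_itv/=.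
  by rewrite ltxx subrr.
by rewrite lte_fin st EFinB.
Qed.

(** The mass is gained on []x, y]] and [[-y, -x[], where the density lies between [g y] and [g x].
    The Lipschitz bound, the derivative and the concavity inequality below all come from these two
    estimates. *)
Lemma gauss_mass_bounds x y : 0 <= x <= y ->
  2 * g y * (y - x) <= gauss_mass y - gauss_mass x <= 2 * g x * (y - x).
Proof.
move=> /andP[x0 xy].
pose A1 := `[- y, - x[%classic; pose A2 := `[- x, x]%classic.
pose A3 := `]x, y]%classic.
have split_y : `[- y, y]%classic = A1 `|` (A2 `|` A3).
  rewrite /A1 /A2 /A3; apply/seteqP; split=> t /=; rewrite !in_itv/=.
    move=> /andP[yt ty]; have [tx|xt] := ltP t (- x); first by left; rewrite yt.
    by right; have [tx|xt'] := leP t x; [left|right].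
  by case=> [|[]] /andP[h1 h2]; apply/andP; split; lra.
have disj1 : A1 `&` (A2 `|` A3) = set0.
  apply/seteqP; split => // t /= []; rewrite /A1 /A2 /A3 /= !in_itv/= => /andP[h1 h2].
  by case=> /andP[h3 h4]; lra.
have disj2 : A2 `&` A3 = set0.
  apply/seteqP; split => // t /= []; rewrite /A2 /A3 /= !in_itv/= => /andP[h1 h2].
  by move=> /andP[h3 h4]; lra.
have mA1 : measurable A1 by exact: measurable_itv.
have mA2 : measurable A2 by exact: measurable_itv.
have mA3 : measurable A3 by exact: measurable_itv.
have E : (normal_prob 0 1 `[(- y)%R, y%R]%classic =
  normal_prob 0 1 A1 + (normal_prob 0 1 A2 + normal_prob 0 1 A3))%E.
  by rewrite split_y measureU ?measureU//; apply: measurableU.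
have fin (A : set R) : measurable A -> normal_prob 0 1 A \is a fin_num.
  by move=> mA; apply: fin_num_measure.
have bd (A : set R) : measurable A -> lebesgue_measure A = (y - x)%:E ->
    (forall t, A t -> x <= `|t| <= y) ->
    g y * (y - x) <= fine (normal_prob 0 1 A) <= g x * (y - x).
  move=> mA Al Axy; rewrite -!lee_fin fineK ?fin//; apply: mass_bounds => //.
  move=> t /Axy /andP[xt ty]; apply/andP; split; apply: g_anti.
    by rewrite (le_trans ty)// ler_norm.
  by rewrite (ger0_norm x0).
have /andP[b1 b2] : g y * (y - x) <= fine (normal_prob 0 1 A1) <= g x * (y - x).
  apply: bd => //; first by rewrite /A1 mass_itv ?lerN2// opprK addrC.
  by move=> t; rewrite /A1 /= in_itv/= => /andP[h1 h2];
    rewrite ler0_norm; [apply/andP; split|]; lra.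
have /andP[b3 b4] : g y * (y - x) <= fine (normal_prob 0 1 A3) <= g x * (y - x).
  apply: bd => //; first by rewrite /A3 mass_itv.
  by move=> t; rewrite /A3 /= in_itv/= => /andP[h1 h2];
    rewrite ger0_norm; [apply/andP; split|]; lra.
have [f1 f2 f3] := And3 (fin _ mA1) (fin _ mA2) (fin _ mA3).
have f23 : (normal_prob 0 1 A2 + normal_prob 0 1 A3)%E \is a fin_num.
  by rewrite fin_numD f2 f3.
rewrite /gauss_mass E -/A2 (fineD f1 f23) (fineD f2 f3).
by apply/andP; split; lra.
Qed.

Lemma gauss_mass_ge0 x : 0 <= gauss_mass x.
Proof. by rewrite fine_ge0. Qed.

Lemma gauss_mass_le1 x : gauss_mass x <= 1.
Proof. by rewrite -lee_fin fineK ?fin_num_measure// probability_le1. Qed.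

Lemma gauss_mass_le0 x : x <= 0 -> gauss_mass x = 0.
Proof.
rewrite le_eqVlt /gauss_mass => /predU1P[->|x0].
  by rewrite oppr0 set_itv1 /normal_prob integral_set1.
rewrite set_itv_ge ?measure0// -leNgt bnd_simp; lra.
Qed.

Lemma gauss_mass_lip x y : x <= y ->
  0 <= gauss_mass y - gauss_mass x <= 2 * g 0 * (y - x).
Proof.
move=> xy; have [y0|y0] := leP y 0.
  rewrite !gauss_mass_le0 ?(le_trans xy)// subrr lexx !mulr_ge0// subr_ge0//.
have [x0|x0] := leP x 0.
  have zy : (0 : R) <= 0 <= y by rewrite lexx ltW.
  have /andP[_ h2] := gauss_mass_bounds zy.
  move: h2; rewrite (gauss_mass_le0 x0) (gauss_mass_le0 (lexx 0)) !subr0.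
  rewrite gauss_mass_ge0 => /le_trans; apply.
  by rewrite ler_wpM2l ?mulr_ge0//; lra.
have xy0 : 0 <= x <= y by rewrite ltW.
have /andP[h1 h2] := gauss_mass_bounds xy0.
rewrite (le_trans _ h1) ?mulr_ge0 ?subr_ge0//=.
apply: (le_trans h2); rewrite ler_wpM2r ?subr_ge0// ler_wpM2l// g_anti//.
by rewrite normr0.
Qed.

Lemma continuous_gauss_mass : continuous gauss_mass.
Proof.
move=> x; apply/cvgrPdist_le => e e0; near=> y.
have : `|x - y| <= e by near: y; apply: cvgr_dist_le => //; exact: cvg_id.
have h s t : s <= t -> `|gauss_mass t - gauss_mass s| <= t - s.
  move=> st; have /andP[h1 h2] := gauss_mass_lip st; rewrite ger0_norm//.
  apply: (le_trans h2); rewrite ler_piMl ?subr_ge0//; exact: normal_pdf0_le.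
move=> xye; have [xy|yx] := leP x y.
  rewrite distrC; apply: (le_trans (h _ _ xy)); apply: le_trans xye.
  by rewrite distrC ler_norm.
by apply: (le_trans (h _ _ (ltW yx))); apply: le_trans xye; rewrite ler_norm.
Unshelve. all: by end_near. Qed.

Lemma gauss_mass_cvg : gauss_mass n%:R @[n --> \oo] --> (1 : R).
Proof.
have ndF : nondecreasing_seq (fun n => `[- n%:R : R, n%:R]%classic).
  move=> m n mn; apply/subsetPset => t /=; rewrite !in_itv/= => /andP[h1 h2].
  have : (m%:R <= n%:R :> R) by rewrite ler_nat.
  by move=> mn'; apply/andP; split; lra.
have UF : \bigcup_n `[- n%:R : R, n%:R]%classic = setT.
  apply/seteqP; split=> // t _; exists (Num.truncn `|t|).+1 => //=.
  by rewrite in_itv/= -ler_norml ltW// truncnS_gt.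
have mU : measurable (\bigcup_n `[- n%:R : R, n%:R]%classic) by rewrite UF.
have := @nondecreasing_cvg_mu _ _ R (normal_prob 0 1) _
  (fun n => @measurable_itv R _) mU ndF.
have T1 : normal_prob (0 : R) 1 [set: R] = 1%E by exact: integral_normal_pdf.
rewrite UF => nc; apply: fine_cvg; rewrite -[X in _ --> X]/(1%E) -[X in _ --> X]T1.
exact: nc.
Qed.

Lemma is_derive_gauss_mass x : 0 < x -> is_derive x 1 gauss_mass (2 * g x).
Proof.
move=> x0.
suff : (fun h => h^-1 *: (gauss_mass (h *: 1 + x) - gauss_mass x)) @ 0^' -->
    2 * g x.
  move=> h; apply: DeriveDef; first by apply/cvg_ex; exists (2 * g x).
  by apply: cvg_lim.
have cg : (fun h : R => 2 * g (h + x)) @ 0^' --> 2 * g x.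
  apply: cvg_within_filter; apply: cvgM; first exact: cvg_cst.
  rewrite -[in X in _ --> X](add0r x); apply: (cvg_comp (fun h => h + x) g).
    by apply: cvgD; [exact: cvg_id|exact: cvg_cst].
  by apply: continuous_normal_pdf; exact: oner_neq0.
apply/cvgrPdist_le => e e0; near=> h.
have h0 : h != 0 by near: h; exact: nbhs_dnbhs_neq.
have hx : - x < h.
  near: h; apply: (@cvgr_gt R _ (0 : R)^' _ (fun h => h) 0); last lra.
  by apply: cvg_within_filter; exact: cvg_id.
have : `|2 * g x - 2 * g (h + x)| <= e.
  by near: h; apply: cvgr_dist_le cg _ e0.
apply: le_trans.
rewrite -[h *: 1]/(h * 1) mulr1 -[_ *: _]/(h^-1 * (gauss_mass (h + x) - gauss_mass x)).
rewrite [h^-1 * _]mulrC; set q := (_ / h).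
have qh : gauss_mass (h + x) - gauss_mass x = q * h by rewrite divfK.
case: (ltgtP h 0) h0 => // hn _.
  have hxx : 0 <= h + x <= x by apply/andP; split; lra.
  have /andP[b1 b2] := gauss_mass_bounds hxx.
  have c1 : 2 * g x <= q by rewrite -(ler_nM2r hn); lra.
  have c2 : q <= 2 * g (h + x) by rewrite -(ler_nM2r hn); lra.
  by rewrite !ler0_norm; lra.
have xhx : 0 <= x <= h + x by apply/andP; split; lra.
have /andP[b1 b2] := gauss_mass_bounds xhx.
have c1 : 2 * g (h + x) <= q by rewrite -(ler_pM2r hn); lra.
have c2 : q <= 2 * g x by rewrite -(ler_pM2r hn); lra.
by rewrite !ger0_norm; lra.
Unshelve. all: by end_near. Qed.

End gauss_mass.

(** * Student distribution functions and their Gaussian bound *)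

Section student.
Context {R : realType}.
Implicit Types v w : R.

(** The cosine of the angle of tangent [v]; then [v * c v] is its sine, which will be the bias of a
    sign. *)
Definition inv_sqrt1 v : R := (Num.sqrt (1 + v ^+ 2))^-1.
Local Notation c := inv_sqrt1.

Let v2_gt0 v : 0 < 1 + v ^+ 2.
Proof. by rewrite ltr_wpDr ?sqr_ge0. Qed.

Lemma inv_sqrt1_gt0 v : 0 < c v.
Proof. by rewrite invr_gt0 sqrtr_gt0. Qed.

Lemma sqr_inv_sqrt1 v : c v ^+ 2 = (1 + v ^+ 2)^-1.
Proof. by rewrite exprVn sqr_sqrtr// ltW. Qed.

Lemma inv_sqrt1E v : v ^+ 2 * c v ^+ 2 = 1 - c v ^+ 2.
Proof. by rewrite sqr_inv_sqrt1; field; rewrite gt_eqF. Qed.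

(** The probability that [2 i] fair signs are balanced. *)
Definition central_binomial_ratio (i : nat) : R := 'C(i.*2, i)%:R / 4 ^+ i.
Local Notation beta := central_binomial_ratio.

Lemma central_binomial_ratioS i :
  i.+1.*2%:R * beta i.+1 = i.*2.+1%:R * beta i.
Proof.
rewrite /beta; have e : (i.+1 * 'C(i.+1.*2, i.+1) = 2 * i.*2.+1 * 'C(i.*2, i))%N.
  have h0 := mul_bin_diag i.*2.+2 i; have h1 := mul_bin_diag i.*2.+1 i.
  have h2 : 'C(i.*2.+1, i.+1) = 'C(i.*2.+1, i).
    by rewrite -bin_sub; [congr ('C(_, _)); lia|lia].
  rewrite /= h2 in h0 h1; rewrite doubleS -h0 -mulnA h1.
  by rewrite mulnA; congr (_ * _)%N; lia.
have := congr1 (fun n => n%:R : R) e; rewrite !natrM => e'.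
have -> : i.+1.*2%:R = 2 * i.+1%:R :> R by rewrite -mul2n natrM.
rewrite exprS invfM.
transitivity (2 * (i.+1%:R * 'C(i.+1.*2, i.+1)%:R) * (4^-1 * (4 ^+ i)^-1) : R).
  by ring.
by rewrite e'; field; rewrite expf_neq0.
Qed.

(* The distribution function, on the positive half line and up to the scaling
   by sqrt (2k), of the absolute value of a Student variable with 2k degrees of
   freedom. *)
Definition student_mass k v : R :=
  \sum_(i < k) beta i * (v * c v ^+ i.*2.+1).
Local Notation F := student_mass.

(** Of two further observations only the one following an even number matters. With [r = v * c v] it
    costs [r * beta k * (1 - r^2)^k], since four times the product of the two probabilities is
    [1 - r^2 = (c v)^2]. *)
Lemma sign_affinity_student k v : 0 <= v -> v * c v <= 1 ->
  sign_affinity ((1 + v * c v) / 2) ((1 - v * c v) / 2) k.*2 1 1 = 1 - F k v.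
Proof.
move=> v0 r1; set r := v * c v.
have r0 : 0 <= r by rewrite mulr_ge0// ltW// inv_sqrt1_gt0.
have qp : 0 <= (1 - r) / 2 <= (1 + r) / 2 by move: r1; rewrite -/r => r1; apply/andP; split; lra.
have pq1 : (1 + r) / 2 + (1 - r) / 2 = 1 by lra.
elim: k => [|k IH]; first by rewrite sign_affinity0 minxx /F big_ord0 subr0.
rewrite doubleS sign_affinity_odd//=; last by rewrite odd_double.
rewrite sign_affinity_even// IH /F big_ord_recr /= -/(F k v).
have -> : (1 + r) / 2 * ((1 - r) / 2) = c v ^+ 2 / 4.
  have := inv_sqrt1E v; rewrite -exprMn -/r => h.
  have -> : c v ^+ 2 = 1 - r ^+ 2 by lra.
  by field.
rewrite expr_div_n -exprM mul2n /beta exprSr.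
have -> : (1 + r) / 2 - (1 - r) / 2 = r by field.
rewrite /r; ring.
Qed.

Lemma is_derive_inv_sqrt1 v : is_derive v 1 c (- (v * c v ^+ 3)).
Proof.
have d1 : is_derive v 1 (fun v : R => 1 + v ^+ 2) (2 * v).
  apply: is_derive_eq; rewrite -[v%:A]/(v * 1); ring.
have d2 : is_derive v 1 (fun v : R => Num.sqrt (1 + v ^+ 2)) (v * c v).
  have := @is_derive1_comp _ Num.sqrt (fun v : R => 1 + v ^+ 2) v
    (2 * Num.sqrt (1 + v ^+ 2))^-1 (2 * v) (is_derive1_sqrt (v2_gt0 v)) d1.
  congr is_derive; rewrite /c invfM; field.
  by rewrite gt_eqF// sqrtr_gt0.
have := is_deriveV _ d2; rewrite gt_eqF ?sqrtr_gt0// => /(_ isT).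
congr is_derive; rewrite -[_ *: _]/(_ * _) /c -exprVn; ring.
Qed.

(** The derivatives of the summands telescope by the recursion on [beta], leaving one multiple of
    the Student density. *)
Lemma is_derive_student_mass k v :
  is_derive v 1 (F k) (k.*2%:R * beta k * c v ^+ k.*2.+1).
Proof.
elim: k => [|k IH].
  rewrite mul0r mul0r (_ : F 0 = cst 0); first exact: is_derive_cst.
  by apply/funext => x; rewrite /F big_ord0.
have dt : is_derive v 1 (fun v => v * c v ^+ k.*2.+1)
    (c v ^+ k.*2.+1 - k.*2.+1%:R * (v ^+ 2 * c v ^+ k.*2.+3)).
  have dc := is_derive_inv_sqrt1 v.
  rewrite (_ : (fun v => _) = (@id R) * (c ^+ k.*2.+1)); last first.
    by apply/funext => x; rewrite -[in RHS]/(x * (c ^+ k.*2.+1) x) exprfctE.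
  apply: is_derive_eq; rewrite exprfctE.
  rewrite -![_ *: _]/(_ * _) /= !exprS; ring.
have -> : F k.+1 = F k + beta k \*: (fun v => v * c v ^+ k.*2.+1).
  by apply/funext => x; rewrite /F big_ord_recr.
apply: (is_derive_eq (is_deriveD IH (is_deriveZ (beta k) dt))).
rewrite -![_ *: _]/(_ * _).
rewrite (central_binomial_ratioS k).
have -> : v ^+ 2 * c v ^+ k.*2.+3 = (1 - c v ^+ 2) * c v ^+ k.*2.+1.
  by rewrite -inv_sqrt1E !exprS; ring.
rewrite doubleS -natr1 !exprS; ring.
Qed.

Lemma student_mass_le1 k v : 0 <= v -> F k v <= 1.
Proof.
move=> v0; have r1 : v * c v <= 1.
  have h : (v * c v) ^+ 2 <= 1 by rewrite exprMn inv_sqrt1E gerBl sqr_ge0.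
  by rewrite -(@ler_pXn2r _ 2) ?nnegrE ?expr1n// mulr_ge0// ltW// inv_sqrt1_gt0.
have r0 : 0 <= v * c v by rewrite mulr_ge0// ltW// inv_sqrt1_gt0.
rewrite -subr_ge0 -sign_affinity_student// sign_affinity_ge0//; lra.
Qed.

Let Ex v : R := expR (- (v ^+ 2 / 2)).

(** The Student density over the Gaussian one, up to constants and the power [2 k + 1], is
    nondecreasing. After squaring, this rests on [1 + h <= exp h] with [h = w^2 - v^2]. *)
Let lr_mono v w : 0 <= v <= w -> c v * Ex w <= c w * Ex v.
Proof.
move=> /andP[v0 vw].
rewrite -(@ler_pXn2r _ 2) ?nnegrE ?mulr_ge0 ?expR_ge0 ?(ltW (inv_sqrt1_gt0 _))//.
rewrite !exprMn !sqr_inv_sqrt1 /Ex -!expRM_natl.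
have e x : 2 * - (x ^+ 2 / 2) = - x ^+ 2 :> R by field.
rewrite !e ler_pdivrMl// mulrCA ler_pdivlMl//.
have vw2 : v ^+ 2 <= w ^+ 2 by rewrite lerXn2r ?nnegrE// (le_trans v0).
have -> : expR (- v ^+ 2) = expR (w ^+ 2 - v ^+ 2) * expR (- w ^+ 2).
  by rewrite -expRD; congr expR; ring.
rewrite mulrA ler_wpM2r ?expR_ge0//.
apply: (@le_trans _ _ ((1 + v ^+ 2) * (1 + (w ^+ 2 - v ^+ 2)))).
  by have := sqr_ge0 v; nra.
by rewrite ler_wpM2l ?expR_ge1Dx// ltW.
Qed.

(* Both sides vanish at 0 and tend to 1, and the ratio of their derivatives is
   nondecreasing. *)
Lemma student_mass_le_gauss k v : 0 <= v ->
  F k v <= gauss_mass (Num.sqrt k.*2.+1%:R * v).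
Proof.
rewrite le_eqVlt => /predU1P[<-|v0].
  rewrite mulr0 /F big1 ?gauss_mass_ge0// => i _.
  by rewrite mul0r mulr0.
set a := Num.sqrt k.*2.+1%:R; have a0 : 0 < a by rewrite sqrtr_gt0 ltr0n.
pose D w := F k w - gauss_mass (a * w).
set n := k.*2.+1; set C := k.*2%:R * beta k.
have C0 : 0 <= C by rewrite mulr_ge0// divr_ge0// exprn_ge0.
pose K := a * (2 * normal_peak 1) : R.
pose dD w := C * c w ^+ n - K * Ex w ^+ n.
have dM w : 0 < w -> is_derive w 1 (fun w => gauss_mass (a * w)) (K * Ex w ^+ n).
  move=> w0; have aw0 : 0 < a * w by rewrite mulr_gt0.
  have da : is_derive w 1 (fun w => a * w) a.
    apply: (is_derive_eq (@is_deriveZ _ _ _ (@id R) a w 1 1 (is_derive_id _ _))).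
    by rewrite -[_ *: _]/(_ * _) mulr1.
  have := @is_derive1_comp _ gauss_mass (fun w => a * w) w _ _
    (is_derive_gauss_mass aw0) da.
  congr is_derive; rewrite normal_pdfE ?oner_neq0// /normal_fun subr0 expr1n.
  rewrite /K /Ex -expRM_natl; set e1 := expR _; set e2 := expR _.
  suff -> : e1 = e2 by ring.
  congr expR; rewrite exprMn sqr_sqrtr// -/n mulNr; by field.
have dDE w : 0 < w -> is_derive w 1 D (dD w).
  by move=> w0; exact: (is_deriveB (is_derive_student_mass k w) (dM _ w0)).
have cD : continuous D.
  move=> w; apply: cvgB.
    have [h _] := is_derive_student_mass k w.
    exact/differentiable_continuous/derivable1_diffP.
  apply: (cvg_comp (fun w => a * w) gauss_mass); last exact: continuous_gauss_mass.
  by apply: cvgM; [exact: cvg_cst|exact: cvg_id].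
have cDw (A : set R) : {within A, continuous D} by exact: continuous_subspaceT.
have mvt x y : 0 <= x < y -> exists2 z, x < z < y & D y - D x = dD z * (y - x).
  move=> /andP[x0 xy].
  have [z|z] := @MVT _ D dD x y xy _ (cDw _).
    by rewrite in_itv/= => /andP[xz _]; apply: dDE; exact: le_lt_trans xz.
  by rewrite in_itv/= => zxy ->; exists z.
have EX0 w : 0 < Ex w ^+ n by rewrite exprn_gt0// expR_gt0.
have mono x y : 0 <= x <= y -> c x ^+ n * Ex y ^+ n <= c y ^+ n * Ex x ^+ n.
  move=> xy; rewrite -!exprMn lerXn2r ?nnegrE ?mulr_ge0 ?expR_ge0 ?(ltW (inv_sqrt1_gt0 _))//.
  exact: lr_mono.
have D0 : D 0 = 0.
  rewrite /D mulr0 gauss_mass_le0// subr0 /F big1// => i _; by rewrite mul0r mulr0.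
(* By the monotone ratio, [dD] can only change sign from negative to positive. If [dD v <= 0], then
   [D] decreases from [D 0 = 0] up to [v]. Otherwise [D] increases beyond [v], and [D v > 0] would
   contradict [F <= 1] and the limit 1 of [gauss_mass]. *)
rewrite -subr_le0 -/(D v); have [dv|dv] := leP (dD v) 0.
  have v00 : (0 : R) <= 0 < v by rewrite lexx.
  have [z /andP[z0 zv]] := mvt _ _ v00; rewrite D0 !subr0 => ->.
  rewrite pmulr_lle0// /dD subr_le0 -(ler_pM2r (EX0 v)) -mulrA.
  have zv' : 0 <= z <= v by rewrite !ltW.
  apply: (le_trans (ler_wpM2l C0 (mono _ _ zv'))).
  by rewrite mulrA [leRHS]mulrAC ler_wpM2r ?(ltW (EX0 z))// -subr_le0.
rewrite leNgt; apply/negP => Dv.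
have incr y : v < y -> D v <= D y.
  move=> vy; have vy0 : 0 <= v < y by rewrite ltW.
  have [z /andP[vz zy]] := mvt _ _ vy0.
  move=> e; rewrite -subr_ge0 e pmulr_lge0 ?subr_gt0//.
  rewrite /dD subr_ge0 -(ler_pM2r (EX0 v)).
  have vz' : 0 <= v <= z by rewrite !ltW.
  apply: le_trans (_ : C * (c v ^+ n * Ex z ^+ n) <= _); last first.
    by rewrite -[leRHS]mulrA ler_wpM2l// mono.
  by rewrite mulrA [leLHS]mulrAC ler_wpM2r ?(ltW (EX0 z))// -subr_ge0 ltW.
have := @gauss_mass_cvg R; move=> /cvgrPdist_lt/(_ (D v) Dv)[N _ HN].
pose y := Num.max (v + 1) (N%:R / a).
have vy : v < y by rewrite lt_max ltrDl ltr01.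
have /incr h := vy.
have y0 : 0 <= y by rewrite (le_trans (ltW v0))// ltW.
have F1 := student_mass_le1 k y0.
have Ny : N%:R <= a * y by rewrite mulrC -ler_pdivrMr// le_max lexx orbT.
have /andP[mm _] := gauss_mass_lip Ny.
have := HN N (leqnn N); rewrite ger0_norm ?subr_ge0 ?gauss_mass_le1//.
move: h; rewrite /D; lra.
Qed.

End student.

(** * Sign tests with a binomial number of signs *)

Section binomial_mean.
Context {R : realType}.
Implicit Types (w k : R) (h : nat -> R).

(* The expectation of h K for a binomial variable K with parameters n and w. *)
Fixpoint binomial_mean w n h : R :=
  match n with
  | 0 => h 0%N
  | m.+1 => (1 - w) * binomial_mean w m h + w * binomial_mean w m (h \o S)
  end.

Lemma le_binomial_mean w n h1 h2 : 0 <= w <= 1 -> (forall i, h1 i <= h2 i) ->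
  binomial_mean w n h1 <= binomial_mean w n h2.
Proof.
move=> /andP[w0 w1]; elim: n h1 h2 => [|n IH] h1 h2 h12 /=; first exact: h12.
by rewrite lerD// ler_wpM2l ?subr_ge0// IH// => i; exact: h12.
Qed.

Lemma binomial_meanD w n h1 h2 :
  binomial_mean w n (fun i => h1 i + h2 i) =
  binomial_mean w n h1 + binomial_mean w n h2.
Proof.
elim: n h1 h2 => [//|n IH] h1 h2 /=.
rewrite [X in w * X](_ : _ = binomial_mean w n (fun i => (h1 \o S) i + (h2 \o S) i))//.
by rewrite !IH; ring.
Qed.

Lemma binomial_meanZ w n k h :
  binomial_mean w n (fun i => k * h i) = k * binomial_mean w n h.
Proof.
elim: n h => [//|n IH] h /=.
rewrite [X in w * X](_ : _ = binomial_mean w n (fun i => k * (h \o S) i))//.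
by rewrite !IH; ring.
Qed.

Lemma binomial_mean_affine w n a b :
  binomial_mean w n (fun i => a + b * i%:R) = a + b * (n%:R * w).
Proof.
elim: n a => [|n IH] a /=; first by rewrite mul0r.
rewrite IH [X in w * X](_ : _ = binomial_mean w n (fun i => (a + b) + b * i%:R)).
  by rewrite IH -natr1; ring.
by congr binomial_mean; apply/funext => i /=; rewrite -natr1; ring.
Qed.

End binomial_mean.

Section gauss_sign_test.
Context {R : realType}.
Implicit Types r d t : R.
Local Notation g := (@normal_pdf R 0 1).

(** The Student comparison has scale [2 k + 1] for [2 k] signs. An odd [K] is first raised to
    [K + 1] at no cost, giving [K + 2]; an even [K] gives [K + 1], and [K + 2] covers both. *)
Lemma gauss_sign_affinity (K : nat) r : 0 <= r < 1 ->
  1 - gauss_mass (r / Num.sqrt (1 - r ^+ 2) * Num.sqrt (K%:R + 2)) <=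
  sign_affinity ((1 + r) / 2) ((1 - r) / 2) K 1 1.
Proof.
move=> /andP[r0 r1]; set v := r / _.
have s0 : 0 < 1 - r ^+ 2 by nra.
have v0 : 0 <= v by rewrite divr_ge0// sqrtr_ge0.
have vr : v * inv_sqrt1 v = r.
  rewrite /inv_sqrt1 /v expr_div_n sqr_sqrtr ?(ltW s0)//.
  have -> : 1 + r ^+ 2 / (1 - r ^+ 2) = (1 - r ^+ 2)^-1.
    by field; rewrite gt_eqF.
  by rewrite sqrtrV ?(ltW s0)// invrK divfK// gt_eqF// sqrtr_gt0.
have st k : sign_affinity ((1 + r) / 2) ((1 - r) / 2) k.*2 1 1 = 1 - student_mass k v.
  by rewrite -{1 2}vr sign_affinity_student// vr ltW.
have mono k : (k.*2.+1 <= K.+2)%N ->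
    1 - gauss_mass (v * Num.sqrt (K%:R + 2)) <= 1 - student_mass k v.
  move=> kK; rewrite lerD2l lerN2.
  apply: (le_trans (student_mass_le_gauss k v0)).
  have vK : Num.sqrt k.*2.+1%:R * v <= v * Num.sqrt (K%:R + 2).
    by rewrite mulrC ler_wpM2l// ler_wsqrtr// -natrD ler_nat addn2.
  by have /andP[+ _] := gauss_mass_lip vK; rewrite subr_ge0.
have [oK|eK] := boolP (odd K).
  rewrite -sign_affinity_odd//; last 2 first.
  - by apply/andP; split; lra.
  - by field.
  have -> : K.+1 = (K.+1)./2.*2 by lia.
  by rewrite st; apply: mono; lia.
have -> : K = K./2.*2 by lia.
by rewrite st (_ : K./2.*2 = K); [apply: mono|]; lia.
Qed.

(** The tangent at [t0] of a concave function of [t]. It follows from [gauss_mass_bounds] and from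
    [sqrt] lying below its own tangent. *)
Lemma gauss_mass_sqrt_concave (rho t0 t : R) : 0 <= rho -> 0 < t0 -> 0 <= t ->
  gauss_mass (rho * Num.sqrt t) <= gauss_mass (rho * Num.sqrt t0) +
    g (rho * Num.sqrt t0) * rho / Num.sqrt t0 * (t - t0).
Proof.
move=> rho0 t00 tp0.
have a0 : 0 < Num.sqrt t0 by rewrite sqrtr_gt0.
have b0 : 0 <= Num.sqrt t by rewrite sqrtr_ge0.
have -> : t - t0 = (Num.sqrt t + Num.sqrt t0) * (Num.sqrt t - Num.sqrt t0).
  by rewrite -[in LHS](sqr_sqrtr tp0) -[in LHS](sqr_sqrtr (ltW t00)); ring.
set a := Num.sqrt t0 in a0 *; set b := Num.sqrt t in b0 *.
set G := g (rho * a); have G0 : 0 <= G by exact: normal_pdf_ge0.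
have key : 2 * G * rho * (b - a) <= G * rho / a * ((b + a) * (b - a)).
  rewrite -subr_ge0.
  have -> : G * rho / a * ((b + a) * (b - a)) - 2 * G * rho * (b - a) =
    G * rho * ((b - a) ^+ 2 / a) by field; rewrite gt_eqF.
  by apply: mulr_ge0; [apply: mulr_ge0|apply: divr_ge0; [exact: sqr_ge0|exact: ltW]].
have [ab|/ltW ba] := leP a b.
  have /gauss_mass_bounds/andP[_ h] : 0 <= rho * a <= rho * b.
    by rewrite mulr_ge0 ?(ltW a0)//= ler_wpM2l.
  by move: h key; rewrite -/G; clearbody G a b; clear; lra.
have /gauss_mass_bounds/andP[h _] : 0 <= rho * b <= rho * a.
  by rewrite mulr_ge0//= ler_wpM2l.
by move: h key; rewrite -/G; clearbody G a b; clear; lra.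
Qed.

(** Jensen's inequality in tangent form: the tangent is taken at [t0 = n w + 2], the mean of
    [k + 2]. *)
Lemma binomial_mean_sign_affinity (w : R) n r : 0 <= w <= 1 -> 0 <= r < 1 ->
  1 - gauss_mass (r / Num.sqrt (1 - r ^+ 2) * Num.sqrt (n%:R * w + 2)) <=
  binomial_mean w n (fun k => sign_affinity ((1 + r) / 2) ((1 - r) / 2) k 1 1).
Proof.
move=> w01 r01; set rho := r / _; set t0 := n%:R * w + 2.
have t00 : 0 < t0.
  by rewrite /t0 ltr_wpDl// mulr_ge0//; case/andP: w01.
have rho0 : 0 <= rho by rewrite divr_ge0 ?sqrtr_ge0//; case/andP: r01.
set s := g (rho * Num.sqrt t0) * rho / Num.sqrt t0.
set M := gauss_mass (rho * Num.sqrt t0).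
apply: le_trans (le_binomial_mean _ _ (_ : forall k,
  (1 - M - s * (2 - t0)) + (- s) * k%:R <= _)) => //.
  by rewrite binomial_mean_affine /t0; lra.
move=> k; apply: le_trans (gauss_sign_affinity k r01).
have k20 : 0 <= k%:R + 2 :> R by rewrite addr_ge0.
have := gauss_mass_sqrt_concave rho0 t00 k20.
rewrite -/s -/M -/rho; lra.
Qed.

(** Removes the 2 from [sqrt(t + 2)] at the price [q = d^(1/4)]. The Gaussian estimate alone does
    not suffice for small [t], where the square root estimate takes over. *)
Lemma gauss_mass_correction d t (E : R) : 0 <= d < 1 -> 0 <= t -> 0 <= E ->
  1 - Num.sqrt (t * d) <= E ->
  1 - gauss_mass (Num.sqrt (d / (1 - d)) * Num.sqrt (t + 2)) <= E ->
  1 - gauss_mass (Num.sqrt (t * d / (1 - d))) - d `^ (1 / 4) <= E.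
Proof.
move=> /andP[d0 d1] t0 E0 Esqrt Egauss.
set q := d `^ (1 / 4).
have q0 : 0 <= q by exact: powR_ge0.
have q4 : q ^+ 4 = d.
  by rewrite -powR_mulrn// -powRrM mul1r mulVf// powRr1.
have q1 : q < 1 by rewrite -(@ltr_pXn2r _ 4) ?nnegrE// expr1n q4.
(* Here [t d = (t q^2) q^2 <= q^2], so the square root estimate already gives [1 - q <= E]. *)
have [tq|tq] := leP (t * q ^+ 2) 1.
  have : Num.sqrt (t * d) <= q.
    rewrite -[leRHS](@ger0_norm _ q)// -sqrtr_sqr ler_wsqrtr//.
    by rewrite -q4; have := sqr_ge0 q; move: tq; rewrite !exprS !expr0 !mulr1; nra.
  by have := gauss_mass_ge0 (Num.sqrt (t * d / (1 - d))); lra.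
have q0' : 0 < q by rewrite lt_neqAle q0 andbT; apply: contraTneq tq => <-; rewrite expr0n mulr0 -leNgt.
have d0' : 0 < d by rewrite -q4 exprn_gt0.
have dq : d <= q by rewrite -q4 -[leRHS]expr1 ler_wiXn2l// ltW.
have t1 : 1 < t by have : q ^+ 2 <= 1; [rewrite exprn_ile1// ltW|nra].
have d1' : 0 < 1 - d by lra.
have rho0 : 0 <= d / (1 - d) by rewrite divr_ge0// ltW.
have rt : Num.sqrt (t * d / (1 - d)) = Num.sqrt (d / (1 - d)) * Num.sqrt t.
  by rewrite -mulrA sqrtrM// mulrC.
(* For [d <= 1/2] the scale [sqrt(d / (1 - d))] is at most 1, and so is the Lipschitz constant of
   [gauss_mass], while [sqrt(t + 2) - sqrt t <= 1 / sqrt t <= q]. *)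
have [d2|d2] := leP d (1 / 2).
  have st0 : 0 < Num.sqrt t by rewrite sqrtr_gt0; lra.
  have st : Num.sqrt t <= Num.sqrt (t + 2) by rewrite ler_wsqrtr//; lra.
  have rho1 : Num.sqrt (d / (1 - d)) <= 1.
    by rewrite -[leRHS]sqrtr1 ler_wsqrtr// ler_pdivrMr//; lra.
  have sqt : 1 <= Num.sqrt t * q.
    rewrite -(@ler_pXn2r _ 2) ?nnegrE ?mulr_ge0 ?(ltW st0)// expr1n exprMn sqr_sqrtr//.
    exact: ltW.
  have e1 := sqr_sqrtr t0; have t20 : 0 <= t + 2 by lra.
  have e2 := sqr_sqrtr t20.
  have diff : Num.sqrt (t + 2) - Num.sqrt t <= q.
    have : (Num.sqrt (t + 2) - Num.sqrt t) * Num.sqrt t <= 1 by nra.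
    move=> h; rewrite -(ler_pM2r st0) [q * _]mulrC; exact: le_trans sqt.
  have rr : Num.sqrt (d / (1 - d)) * Num.sqrt t <= Num.sqrt (d / (1 - d)) * Num.sqrt (t + 2).
    by rewrite ler_wpM2l ?sqrtr_ge0.
  have /andP[_ h] := gauss_mass_lip rr.
  rewrite rt; have := sqrtr_ge0 (d / (1 - d)).
  move: (Num.sqrt (d / (1 - d))) rho1 h Egauss => rho rho1 h Egauss rho0'.
  have g0 : 0 <= 2 * g 0 by rewrite mulr_ge0// normal_pdf_ge0.
  have h' : 2 * g 0 * (rho * Num.sqrt (t + 2) - rho * Num.sqrt t) <= q.
    have x0 : 0 <= Num.sqrt (t + 2) - Num.sqrt t by lra.
    apply: (@le_trans _ _ (1 * (rho * (Num.sqrt (t + 2) - Num.sqrt t)))).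
      rewrite -mulrBr ler_wpM2r ?mulr_ge0//; exact: normal_pdf0_le.
    by rewrite mul1r; apply: le_trans diff; rewrite ler_piMl.
  move: h h' Egauss; clear; lra.
(* For [d > 1/2], since [q >= d > 1/2], the left side is negative once the Gaussian mass reaches
   1/2. That mass is bounded below by the case [k = 1] of the Student comparison, which equals
   [sqrt(x / (x + 3))] with [x >= 1]. *)
suff : 1 / 2 <= gauss_mass (Num.sqrt (t * d / (1 - d))) by lra.
set x := t * d / (1 - d).
have x1 : 1 <= x by rewrite ler_pdivlMr//; nra.
have v0 : 0 <= Num.sqrt (x / 3) by rewrite sqrtr_ge0.
have := student_mass_le_gauss 1 v0.
have -> : Num.sqrt 1.*2.+1%:R * Num.sqrt (x / 3) = Num.sqrt x.
  by rewrite -sqrtrM// -[1.*2.+1]/3%N; congr Num.sqrt; field.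
apply: le_trans; have -> : student_mass 1 (Num.sqrt (x / 3)) =
    Num.sqrt (x / 3) * inv_sqrt1 (Num.sqrt (x / 3)).
  rewrite /student_mass big_ord1 /central_binomial_ratio /=.
  by rewrite bin0 expr0 divr1 mul1r expr1.
rewrite -(@ler_pXn2r _ 2) ?nnegrE ?mulr_ge0 ?(ltW (inv_sqrt1_gt0 _))//.
rewrite [leRHS]exprMn inv_sqrt1E sqr_inv_sqrt1 sqr_sqrtr; last by lra.
have : (1 + x / 3)^-1 <= 3 / 4.
  rewrite -[leRHS]invrK lef_pV2 ?posrE; lra.
lra.
Qed.

End gauss_sign_test.

(** * Real inequalities *)

Section pointwise.
Context {R : realType}.
Implicit Types a b B k w s x : R.

(** Divided by [x^w], the right side is the mean, with weights [1 - w] and [w], of two exponentials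
    whose exponents average to 0; each lies above its tangent at 0. *)
Lemma powR_le_affine x w : 0 <= x -> 0 <= w <= 1 -> x `^ w <= 1 - w * (1 - x).
Proof.
move=> x0 /andP[w0 w1].
have [->|wn0] := eqVneq w 0; first by rewrite powRr0 mul0r subr0.
have [->|xn0] := eqVneq x 0; first by rewrite powR0// subr0; lra.
have xp : 0 < x by rewrite lt_neqAle eq_sym xn0.
rewrite /powR (negbTE xn0); set l := ln x.
have xl : x = expR l by rewrite lnK.
have h1 := expR_ge1Dx (- (w * l)); have h2 := expR_ge1Dx (l - w * l).
have E0 := expR_gt0 (w * l).
rewrite -(ler_pM2l (expR_gt0 (- (w * l)))) -expRD addNr expR0.
have -> : expR (- (w * l)) * (1 - w * (1 - x)) =
  (1 - w) * expR (- (w * l)) + w * expR (l - w * l).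
  by rewrite expRD -xl; ring.
by nra.
Qed.

Lemma powR_ge_affine x s : 0 <= x -> 1 <= s -> 1 - s * (1 - x) <= x `^ s.
Proof.
move=> x0 s1; have s0 : 0 < s by lra.
have V01 : 0 <= s^-1 <= 1 by rewrite invr_ge0 ltW//= invf_le1.
have := powR_le_affine (powR_ge0 x s) V01.
rewrite -powRrM mulfV ?gt_eqF// powRr1// => h.
have : s * x <= s * (1 - s^-1 * (1 - x `^ s)) by rewrite ler_wpM2l// ltW.
by rewrite mulrBr mulrA mulfV ?gt_eqF// mul1r; lra.
Qed.

(** A linear substitute for the Cauchy-Schwarz and Jensen inequalities. With [s = a + b] and [m] the
    geometric mean, [min a b = (s - |b - a|) / 2], where [|b - a| <= k s / 2 + (s^2 - 4 m^2) / (2 k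
    s)] and [m^2 / s >= B m - B^2 s / 4]. The gap is a sum of the two corresponding squares. *)
Lemma le_min_sqrtM a b B k : 0 <= a -> 0 <= b -> 0 < k ->
  (1 - k / 2 - (2 * k)^-1) * ((a + b) / 2) +
    (2 * k)^-1 * (2 * (B * Num.sqrt (a * b)) - B ^+ 2 * ((a + b) / 2)) <=
  Num.min a b.
Proof.
wlog : a b / a <= b => [hw a0 b0 k0|ab a0 b0 k0].
  have [ab|/ltW ba] := leP a b; first by have := hw a b ab a0 b0 k0; rewrite min_l.
  by have := hw b a ba b0 a0 k0; rewrite min_l// [b + a]addrC [b * a]mulrC.
rewrite min_l//; set m := Num.sqrt (a * b); set s := a + b.
have mE : m ^+ 2 = a * b by rewrite sqr_sqrtr// mulr_ge0.
have [s0|s0] := eqVneq s 0.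
  have a00 : a = 0 by rewrite /s in s0; lra.
  have m0 : m = 0 by rewrite /m a00 mul0r sqrtr0.
  by rewrite m0 s0 a00 !(mul0r, mulr0, subr0, addr0).
have sp : 0 < s by rewrite lt_neqAle eq_sym s0 addr_ge0.
rewrite -subr_ge0.
have -> : a - ((1 - k / 2 - (2 * k)^-1) * (s / 2) +
    (2 * k)^-1 * (2 * (B * m) - B ^+ 2 * (s / 2))) =
  ((k * s - (b - a)) ^+ 2 + (2 * m - B * s) ^+ 2) / (4 * k * s).
  have -> : (2 * m - B * s) ^+ 2 = 4 * m ^+ 2 - 4 * m * B * s + B ^+ 2 * s ^+ 2 by ring.
  by rewrite mE /s; field; rewrite !gt_eqF.
by rewrite divr_ge0 ?addr_ge0 ?sqr_ge0// !mulr_ge0// ltW.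
Qed.

(** In the square roots [x], [y] of [a], [b] the gap is [(x - y)^4 (x + y)^2] over a positive
    denominator: it vanishes to fourth order at [a = b], so little is lost when the two laws are
    close. *)
Lemma le_harmonic_mean a b : 0 < a -> 0 < b ->
  (a + b) / 2 + Num.sqrt (a * b) / 2 -
    (a ^+ 2 / Num.sqrt (a * b) + b ^+ 2 / Num.sqrt (a * b)) / 4 <=
  2 * (a * b) / (a + b).
Proof.
move=> a0 b0.
have x0 : 0 < Num.sqrt a by rewrite sqrtr_gt0.
have y0 : 0 < Num.sqrt b by rewrite sqrtr_gt0.
rewrite (sqrtrM _ (ltW a0)).
move: (Num.sqrt a) (Num.sqrt b) x0 y0 (sqr_sqrtr (ltW a0)) (sqr_sqrtr (ltW b0)).
move=> x y x0 y0 <- <-.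
have s0 : 0 < x ^+ 2 + y ^+ 2 by rewrite addr_gt0// exprn_gt0.
rewrite -subr_ge0.
have -> : 2 * (x ^+ 2 * y ^+ 2) / (x ^+ 2 + y ^+ 2) -
   ((x ^+ 2 + y ^+ 2) / 2 + x * y / 2 -
      ((x ^+ 2) ^+ 2 / (x * y) + (y ^+ 2) ^+ 2 / (x * y)) / 4) =
   ((x - y) ^+ 2) ^+ 2 * (x + y) ^+ 2 / (4 * x * y * (x ^+ 2 + y ^+ 2)).
  by field; rewrite !gt_eqF.
apply: divr_ge0; first by apply: mulr_ge0; exact: sqr_ge0.
by apply: ltW; rewrite !mulr_gt0.
Qed.

End pointwise.

(** * Concavity gap of a function with second derivative bounded away from 0 *)

Section strong_concavity.
Context {R : realType}.
Implicit Types (f : R -> R) (t l : R).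

Lemma is_derivative_within_cvg f t l : is_derivative_within `[0, 1] f t l ->
  f s @[s --> within `[0, 1] (nbhs t)] --> f t.
Proof.
move=> /cvgrPdist_lt/(_ 1 ltr01) hl; apply/cvgrPdist_lt => e e0.
have l1 : 0 < `|l| + 1 by rewrite ltr_wpDl.
have d0 : 0 < e / (`|l| + 1) by rewrite divr_gt0.
move: hl; rewrite /within /= /dnbhs /within /= => /nbhs_ballP[d /= dp hd].
apply/nbhs_ballP; exists (Num.min d (e / (`|l| + 1))) => /=.
  by rewrite lt_min dp.
move=> s; rewrite /ball /= lt_min => /andP[sd se] s01.
have [->|st] := eqVneq s t; first by rewrite subrr normr0.
have h1 := hd _ sd st s01.
have st0 : 0 < `|s - t| by rewrite normr_gt0 subr_eq0.
have : `|f s - f t| <= (`|l| + 1) * `|s - t|.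
  rewrite -ler_pdivrMr// -normf_div.
  have -> : (f s - f t) / (s - t) = l - (l - (f s - f t) / (s - t)) by ring.
  by apply: (le_trans (ler_normB _ _)); rewrite lerD2l ltW.
rewrite distrC => /le_lt_trans; apply.
by rewrite mulrC -ltr_pdivlMr// distrC.
Qed.

Lemma is_derivative_within_is_derive f t l : 0 < t < 1 ->
  is_derivative_within `[0, 1] f t l -> is_derive t 1 f l.
Proof.
move=> t01 hl.
suff h : (fun h => h^-1 *: (f (h *: 1 + t) - f t)) @ 0^' --> l.
  by apply: DeriveDef; [apply/cvg_ex; exists l|exact: cvg_lim].
move: t01 => /andP[t0 t1].
apply/cvgrPdist_lt => e e0.
move/cvgrPdist_lt : hl => /(_ e e0); rewrite /within /= /dnbhs /within /=.
move=> /nbhs_ballP[d /= d0 hd]; apply/nbhs_ballP.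
exists (Num.min d (Num.min t (1 - t))) => /=.
  by rewrite !lt_min d0 t0 subr_gt0.
move=> h; rewrite /ball /= sub0r normrN !lt_min => /and3P[hh1 hh2 hh3] hn.
have := hd (h + t); rewrite /ball /= opprD addrCA subrr addr0 normrN => /(_ hh1).
rewrite -subr_eq0 addrK => /(_ hn).
move: hh2 hh3; rewrite !ltr_norml => /andP[q1 q2] /andP[q3 q4].
rewrite in_itv/= => /(_ _)/wrap[]; first by apply/andP; split; lra.
by rewrite -[h *: 1]/(h * 1) mulr1 -[_ *: _]/(h^-1 * _) mulrC.
Qed.

(** Extracts from the limit one difference quotient in the direction [v], which can then be compared
    with a concavity or monotonicity inequality. *)
Lemma is_derivative_within_near f t l (v e : R) : 0 < e -> v != 0 ->
  0 <= t <= 1 -> 0 <= t + v <= 1 -> is_derivative_within `[0, 1] f t l ->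
  exists2 h, 0 < h < 1 & `|l - (f (t + h * v) - f t) / (h * v)| < e.
Proof.
move=> e0 v0 /andP[t0 t1] /andP[tv0 tv1] /cvgrPdist_lt/(_ e e0).
rewrite /within /= /dnbhs /within /= => /nbhs_ballP[d /= d0 hd].
have nv : 0 < `|v| by rewrite normr_gt0.
pose h := Num.min (1 / 2) (d / (2 * `|v|)).
have h0 : 0 < h by rewrite lt_min !divr_gt0// mulr_gt0.
have h2 : h <= 1 / 2 by rewrite ge_min lexx.
exists h; first by rewrite h0/=; lra.
have := hd (t + h * v); rewrite /ball /= opprD addrA subrr add0r normrN.
have -> : t + h * v - t = h * v by ring.
apply.
- rewrite normrM gtr0_norm//; have : h <= d / (2 * `|v|) by rewrite ge_min lexx orbT.
  rewrite ler_pdivlMr ?mulr_gt0// => hh; lra.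
- by rewrite -subr_eq0 addrAC subrr add0r mulf_neq0// gt_eqF.
- by rewrite in_itv/=; apply/andP; split; nra.
Qed.

(* Taylor's inequality at a p + (1 - a) q, towards p and towards q. *)
Lemma strong_concavity f f' f'' (z p q a : R) :
  (forall x y b, 0 <= x <= 1 -> 0 <= y <= 1 -> 0 <= b <= 1 ->
     b * f x + (1 - b) * f y <= f (b * x + (1 - b) * y)) ->
  (forall t, 0 <= t <= 1 -> is_derivative_within `[0, 1] f t (f' t)) ->
  (forall t, 0 <= t <= 1 -> is_derivative_within `[0, 1] f' t (f'' t)) ->
  (forall t, Num.min p q <= t <= Num.max p q -> z <= `|f'' t|) ->
  0 <= p <= 1 -> 0 <= q <= 1 -> 0 <= a <= 1 ->
  z / 2 * (a * (1 - a)) * (p - q) ^+ 2 <=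
    f (a * p + (1 - a) * q) - a * f p - (1 - a) * f q.
Proof.
move=> conc df df' f''z.
wlog : p q a f''z / q <= p.
  move=> hw p01 q01 a01; have [qp|/ltW pq] := leP q p; first exact: hw.
  have := hw q p (1 - a) _ pq q01 p01 _.
  rewrite minC maxC => /(_ f''z _)/wrap[]; first by move/andP: a01 => [? ?]; apply/andP; split; lra.
  have -> : (1 - (1 - a)) = a by ring.
  by rewrite [(1 - a) * q + _]addrC => h; lra.
move=> qp /andP[p0 p1] /andP[q0 q1] /andP[a0 a1].
have [->|an0] := eqVneq a 0; first by rewrite !(mul0r, mulr0, subr0, add0r, mul1r) subrr.
have [->|an1] := eqVneq a 1; first by rewrite !(subrr, mul0r, mulr0, subr0, addr0, mul1r).
have {an0}a0 : 0 < a by rewrite lt_neqAle eq_sym an0.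
have {an1}a1 : a < 1 by rewrite lt_neqAle an1.
move: qp; rewrite le_eqVlt => /predU1P[qp|qp].
  have -> : a * p + (1 - a) * q = p by rewrite qp; ring.
  by rewrite qp subrr expr0n mulr0; lra.
set m := a * p + (1 - a) * q.
have mp : m < p by rewrite /m; nra.
have qm : q < m by rewrite /m; nra.
have d1 t : 0 < t < 1 -> is_derive t 1 f (f' t).
  move=> /[dup] t01 /andP[t0 t1]; apply: is_derivative_within_is_derive => //.
  by apply: df; rewrite !ltW.
have d2 t : 0 < t < 1 -> is_derive t 1 f' (f'' t).
  move=> /[dup] t01 /andP[t0 t1]; apply: is_derivative_within_is_derive => //.
  by apply: df'; rewrite !ltW.
have cont (x y : R) : 0 <= x -> y <= 1 -> {within `[x, y], continuous f}.
  move=> x0 y1; have c01 : {within `[0, 1], continuous f}.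
    apply/subspace_continuousP => t /=; rewrite in_itv/= => t01.
    exact: is_derivative_within_cvg (df _ t01).
  apply: (continuous_subspaceW _ c01) => t /=; rewrite !in_itv/= => /andP[xt ty].
  by apply/andP; split; lra.
have cont' (x y : R) : 0 < x -> y < 1 -> {within `[x, y], continuous f'}.
  move=> x0 y1; apply: derivable_within_continuous => t.
  rewrite in_itv/= => /andP[xt ty].
  by have [] := d2 t; [apply/andP; split; lra|].
have tangent t u : 0 < t < 1 -> 0 <= u <= 1 -> f u <= f t + f' t * (u - t).
  move=> /andP[t0 t1] /andP[u0 u1]; have [->|ut] := eqVneq u t; first by lra.
  have v0 : u - t != 0 by rewrite subr_eq0.
  have nv : 0 < `|u - t| by rewrite normr_gt0.
  have t01 : 0 <= t <= 1 by rewrite !ltW.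
  rewrite leNgt; apply/negP => gap.
  set e := f u - f t - f' t * (u - t); have e0 : 0 < e by rewrite /e; lra.
  have tu : 0 <= t + (u - t) <= 1 by apply/andP; split; lra.
  have [h /andP[h0 h1]] := is_derivative_within_near (divr_gt0 e0 nv) v0 t01 tu (df _ t01).
  rewrite ltr_pdivlMr// -normrM mulrBl invfM => lt_e.
  have hu : h * f u + (1 - h) * f t <= f (t + h * (u - t)).
    have := conc u t h; rewrite u0 u1 t01 !(ltW h0, ltW h1) => /(_ isT isT isT).
    by congr (_ <= f _); ring.
  have qE : (f (t + h * (u - t)) - f t) * (h^-1 * (u - t)^-1) * (u - t) =
    (f (t + h * (u - t)) - f t) / h by field; rewrite v0 gt_eqF.
  rewrite qE in lt_e.
  have : f u - f t <= (f (t + h * (u - t)) - f t) / h.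
    by rewrite ler_pdivlMr//; lra.
  have := ler_norm (- (f' t * (u - t) - (f (t + h * (u - t)) - f t) / h)).
  by rewrite normrN; rewrite /e in lt_e; lra.
have anti s t : 0 < s < 1 -> 0 < t < 1 -> s < t -> f' t <= f' s.
  move=> /[dup] s01 /andP[s0 s1] /[dup] t01 /andP[t0 t1] st.
  have h1 : f t <= f s + f' s * (t - s) by apply: tangent; rewrite // !ltW.
  have h2 : f s <= f t + f' t * (s - t) by apply: tangent; rewrite // !ltW.
  by nra.
(* The hypothesis bounds only the absolute value of [f'']; its sign comes from [f'] being
   nonincreasing. *)
have f''neg t : 0 < t < 1 -> q <= t <= p -> f'' t <= - z.
  move=> /andP[t0 t1] qtp; have t01 : 0 <= t <= 1 by rewrite !ltW.
  have := f''z t; rewrite (min_idPr (ltW qp)) (max_idPl (ltW qp)) => /(_ qtp).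
  suff f''0 : f'' t <= 0 by rewrite ler0_norm//; lra.
  rewrite leNgt; apply/negP => e0.
  have v0 : (1 - t) / 2 != 0 by rewrite gt_eqF// divr_gt0// subr_gt0.
  have tv : 0 <= t + (1 - t) / 2 <= 1 by apply/andP; split; lra.
  have [h /andP[h0 h1]] := is_derivative_within_near e0 v0 t01 tv (df' _ t01).
  set s := t + _; have hv0 : 0 < h * ((1 - t) / 2) by rewrite mulr_gt0//; lra.
  have st : t < s by rewrite ltrDl.
  have s1 : s < 1 by rewrite /s; nra.
  have : (f' s - f' t) / (h * ((1 - t) / 2)) <= 0.
    rewrite pmulr_lle0 ?invr_gt0// subr_le0 anti//; last by rewrite (lt_trans t0).
    by rewrite t0 t1.
  by have := ler_norm (f'' t - (f' s - f' t) / (h * ((1 - t) / 2))); lra.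
(* The expansion starts at the interior point [m], because [p] and [q] may be 0 or 1, where the
   derivatives are one-sided. Two mean value steps show that [G], the function minus its would-be
   majorant, is maximal at [m]. *)
have taylor u : q <= u <= p -> f u <= f m + f' m * (u - m) - z / 2 * (u - m) ^+ 2.
  clear conc df df' f''z a0 a1; clearbody m; move=> /andP[qu up].
  pose G t := f t - f' m * (t - m) + z / 2 * (t - m) ^+ 2.
  have dG t : 0 < t < 1 -> is_derive t 1 G (f' t - f' m + z * (t - m)).
    move=> /d1 dft; apply: is_derive_eq.
    by rewrite -![_ *: _]/(_ * _) subr0; field.
  have cG x y : 0 <= x -> y <= 1 -> {within `[x, y], continuous G}.
    move=> x0 y1; pose h t := - (f' m * (t - m)) + z / 2 * (t - m) ^+ 2.
    have ch : continuous h.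
      move=> t; apply: differentiable_continuous; apply/derivable1_diffP.
      by have [] : is_derive t 1 h (- f' m + z * (t - m)); first by
        apply: is_derive_eq; rewrite -![_ *: _]/(_ * _) subr0; field.
    have -> : G = f \+ h by apply/funext => t; rewrite /G /h /= addrA.
    have hw : {within `[x, y], continuous h} by exact: continuous_subspaceT.
    by move=> t; apply: continuousD; [exact: cont|exact: hw].
  have Gm : G m = f m by rewrite /G subrr mulr0 expr0n mulr0 subr0 addr0.
  suff : G u <= G m by rewrite Gm /G; lra.
  have [um|mu|->] := ltgtP u m; last by [].
    have [x||c] := @MVT _ G (fun t => f' t - f' m + z * (t - m)) u m um.
    - by rewrite in_itv/= => /andP[ux xm]; apply: dG; apply/andP; split; lra.
    - by apply: cG; lra.
    rewrite in_itv/= => /andP[uc cm] GE.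
    have [x||e] := @MVT _ f' f'' c m cm.
    - by rewrite in_itv/= => /andP[cx xm]; apply: d2; apply/andP; split; lra.
    - by apply: cont'; lra.
    rewrite in_itv/= => /andP[ce em] f'E.
    have ez : f'' e <= - z by apply: f''neg; apply/andP; split; lra.
    have h1 : 0 <= (- z - f'' e) * (m - c) by apply: mulr_ge0; lra.
    have h2 : 0 <= (f' c - f' m + z * (c - m)) * (m - u) by apply: mulr_ge0; lra.
    lra.
  have [x||c] := @MVT _ G (fun t => f' t - f' m + z * (t - m)) m u mu.
  - by rewrite in_itv/= => /andP[ux xm]; apply: dG; apply/andP; split; lra.
  - by apply: cG; lra.
  rewrite in_itv/= => /andP[mc cu] GE.
  have [x||e] := @MVT _ f' f'' m c mc.
  - by rewrite in_itv/= => /andP[cx xm]; apply: d2; apply/andP; split; lra.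
  - by apply: cont'; lra.
  rewrite in_itv/= => /andP[me ec] f'E.
  have ez : f'' e <= - z by apply: f''neg; apply/andP; split; lra.
  have h1 : 0 <= (- z - f'' e) * (c - m) by apply: mulr_ge0; lra.
  have h2 : 0 <= - (f' c - f' m + z * (c - m)) * (u - m) by apply: mulr_ge0; lra.
  lra.
have := taylor p; have := taylor q; rewrite !lexx !(ltW qp) /= => /(_ isT) h1 /(_ isT) h2.
have := ler_wpM2l (ltW a0) h2; have a1' : 0 <= 1 - a by lra.
have := ler_wpM2l a1' h1.
have -> : p - m = (1 - a) * (p - q) by rewrite /m; ring.
have -> : q - m = - a * (p - q) by rewrite /m; ring.
lra.
Qed.

End strong_concavity.

(** * The hypercube as a family of densities *)

Section hypercube_density.
Context {R : realType} {dX dY : measure_display}.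
Context {X : measurableType dX} {Y : measurableType dY} {m : nat}.
Variable H : hypercube R X Y m.
Local Notation mu := (hc_mu H).
Local Notation X0 := (hc_part H ord0).
Local Notation block j := (hc_part H (lift ord0 j)).

Let mX0 : measurable X0. Proof. exact: hc_part_measurable. Qed.
Let mblock (j : 'I_m) : measurable (block j). Proof. exact: hc_part_measurable. Qed.
Let mC0 : measurable (~` X0). Proof. exact: measurableC. Qed.

Lemma hc_part_uniq i j x : hc_part H i x -> hc_part H j x -> i = j.
Proof.
move=> ix jx; have [//|/eqP ij] := eqVneq i j; exfalso.
have /trivIsetP/(_ i j I I) := @hc_part_disjoint _ _ _ _ _ _ H.
by move=> /(_ (introN eqP ij))/seteqP[+ _] => /(_ x); apply.
Qed.

Lemma hc_block_rest (j : 'I_m) x : block j x -> ~ X0 x.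
Proof. by move=> jx /(hc_part_uniq jx)/eqP; rewrite eq_sym (negbTE (neq_lift _ _)). Qed.

Lemma hc_rest_block x : ~ X0 x -> exists j : 'I_m, block j x.
Proof.
move=> x0; have [i _ ix] : (\bigcup_i hc_part H i) x by rewrite hc_part_cover.
case: (unliftP ord0 i) ix => [j ->|-> //]; by exists j.
Qed.

(* The two possible outputs, extended by a junk value on X_0. *)
Definition hc_output (b : bool) : X -> Y :=
  (if b then hc_h1 H else hc_h2 H) \_ (~` X0).

Lemma measurable_hc_output b : measurable_fun setT (hc_output b).
Proof.
apply/(measurable_restrictT _ mC0).1.
by case: b; [exact: hc_h1_measurable|exact: hc_h2_measurable].
Qed.

Lemma hc_output1 x : ~ X0 x -> hc_output true x = hc_h1 H x.
Proof. by move=> x0; rewrite /hc_output patchE mem_set. Qed.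

Lemma hc_output2 x : ~ X0 x -> hc_output false x = hc_h2 H x.
Proof. by move=> x0; rewrite /hc_output patchE mem_set. Qed.

Definition branch (p : R) (b : bool) : R := if b then p else 1 - p.

Lemma branch_ge0 p b : 0 <= p <= 1 -> 0 <= branch p b.
Proof. by case: b => /andP[]//=; rewrite subr_ge0. Qed.

Lemma measurable_branch d (T : measurableType d) (p : T -> R) (b : T -> bool) :
  measurable_fun setT p -> measurable_fun setT b ->
  measurable_fun setT (fun u => branch (p u) (b u)).
Proof.
by move=> mp mb; apply: measurable_fun_ifT => //; exact: measurable_funB.
Qed.

Definition hc_p (t : bool) : X -> R := if t then hc_pp H else hc_pm H.

(* q is a version of (p_+, p_-) defined on the whole of X. *)
Variable q : bool -> X -> R.
Hypothesis mq : forall t, measurable_fun setT (q t).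
Hypothesis q01 : forall t x, 0 <= q t x <= 1.
Hypothesis qE : forall t (j : 'I_m),
  {ae mu, forall x, block j x -> q t x = hc_p t x}.

(* The space X * Y * bool records which of h_1(x) and h_2(x) the output comes
   from: when the graphs of h_1 and h_2 are not measurable the likelihood ratio
   of two vertices cannot be written as a function of (x, y) alone. *)
Local Notation W := ((X * Y) * bool)%type.

(** Equal to 1 on X_0, where all vertices agree. The factor 2 makes up for the weight 1/2 that
    [hc_base] gives to each branch. *)
Definition hc_density (s : {ffun 'I_m -> bool}) (u : W) : R :=
  \1_X0 u.1.1 + \sum_(j < m) \1_(block j) u.1.1 * (2 * branch (q (s j) u.1.1) u.2).

Lemma hc_density_rest s u : X0 u.1.1 -> hc_density s u = 1.
Proof.
move=> x0; rewrite /hc_density indicE mem_set//= big1 ?addr0// => j _.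
by rewrite indicE memNset ?mul0r// => /hc_block_rest.
Qed.

Lemma hc_density_block s (j : 'I_m) u : block j u.1.1 ->
  hc_density s u = 2 * branch (q (s j) u.1.1) u.2.
Proof.
move=> jx; rewrite /hc_density indicE memNset/=; last exact: hc_block_rest jx.
rewrite add0r (bigD1 j)//= indicE mem_set// mul1r big1 ?addr0// => i ij.
rewrite indicE memNset ?mul0r// => ix.
by move/eqP: ij; apply; apply: (@lift_inj _ ord0); exact: hc_part_uniq ix jx.
Qed.

Lemma hc_density_ge0 s u : 0 <= hc_density s u.
Proof.
by rewrite addr_ge0// sumr_ge0// => j _; rewrite !mulr_ge0// branch_ge0.
Qed.

Let mx : measurable_fun [set: W] (fun u : W => u.1.1).
Proof. by apply: measurableT_comp => //; exact: measurable_fst. Qed.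

Let mb : measurable_fun [set: W] (fun u : W => u.2).
Proof. exact: measurable_snd. Qed.

Lemma measurable_hc_density s : measurable_fun setT (hc_density s).
Proof.
apply: measurable_funD; first by apply: measurableT_comp => //; exact: measurable_indic.
apply: measurable_sum => j; apply: measurable_funM.
  by apply: measurableT_comp => //; exact: measurable_indic.
apply: measurable_funM => //; apply: measurable_branch => //.
exact: measurableT_comp.
Qed.

Let s0 : {ffun 'I_m -> bool} := [ffun=> true].
Let wt0 (z : X * Y) : R := \1_X0 z.1.
Let wt (x : X) : R := 1 / 2 * \1_(~` X0) x.
Let mwt0 : measurable_fun setT wt0.
Proof. exact: measurableT_comp. Qed.
Let mwt : measurable_fun setT wt.
Proof. by apply: measurable_funM => //; exact: measurable_indic. Qed.
Let wt00 z : 0 <= wt0 z. Proof. by []. Qed.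
Let wt_ge0 x : 0 <= wt x. Proof. by rewrite mulr_ge0. Qed.
Let mpair : measurable_fun setT (fun z : X * Y => (z, true) : W).
Proof. exact: measurable_fun_pair. Qed.
Let mout b : measurable_fun setT (fun x : X => ((x, hc_output b x), b) : W).
Proof.
apply: measurable_fun_pair => //; apply: measurable_fun_pair => //.
exact: measurable_hc_output.
Qed.

(** Above X_0 this is the restriction of a fixed vertex, tagged [true] by convention; elsewhere a
    fair coin chooses between h_1 and h_2. The total mass is 1, so independent samples can be drawn
    from it. *)
Definition hc_base : set W -> \bar R :=
  measure_add (pushdensity_measure (hc_P H s0) mwt0 wt00 mpair)
  (measure_add (pushdensity_measure mu mwt wt_ge0 (mout true))
               (pushdensity_measure mu mwt wt_ge0 (mout false))).

HB.instance Definition _ := Measure.on hc_base.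

Lemma ge0_integral_hc_base (F : W -> \bar R) : measurable_fun setT F ->
  (forall u, (0 <= F u)%E) ->
  (\int[hc_base]_u F u =
   \int[hc_P H s0]_z (F (z, true) * (\1_X0 z.1)%:E) +
   (\int[mu]_x (F ((x, hc_output true x), true) * (1 / 2 * \1_(~` X0) x)%:E) +
    \int[mu]_x (F ((x, hc_output false x), false) * (1 / 2 * \1_(~` X0) x)%:E)))%E.
Proof.
move=> mF F0; rewrite !ge0_integral_measure_add//; congr (_ + (_ + _))%E.
- exact: (@ge0_integral_pushdensity _ _ _ _ _ (hc_P H s0) _ _ mwt0 wt00 mpair).
- exact: (@ge0_integral_pushdensity _ _ _ _ _ mu _ _ mwt wt_ge0 (mout true)).
- exact: (@ge0_integral_pushdensity _ _ _ _ _ mu _ _ mwt wt_ge0 (mout false)).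
Qed.

Lemma hc_P_rest s (A : set X) : measurable A ->
  (\int[hc_P H s]_z (\1_A z.1)%:E = mu A)%E.
Proof.
move=> mA; rewrite -(hc_marginal H s mA).
rewrite (_ : (fun z => _) = (fun z : X * Y => (\1_(A `*` setT) z)%:E)); last first.
  by apply/funext => z; congr EFin; rewrite !indicE; congr (nat_of_bool _)%:R;
    apply/idP/idP; rewrite !inE //= => -[].
by rewrite integral_indic ?setIT//; exact: measurableX.
Qed.

Lemma hc_base_setT : hc_base setT = 1%E.
Proof.
rewrite -[LHS]mul1e -integral_cst// ge0_integral_hc_base//=.
under eq_integral do rewrite mul1e.
under [X in (_ + (X + _))%E]eq_integral do rewrite mul1e EFinM.
under [X in (_ + (_ + X))%E]eq_integral do rewrite mul1e EFinM.
rewrite hc_P_rest// !ge0_integralZl_EFin//; do ?[by move=> x _; rewrite lee_fin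
  |exact/measurable_EFinP/measurable_indic].
rewrite integral_indic// setIT -ge0_muleDl ?lee_fin// -EFinD.
have -> : 1 / 2 + 1 / 2 = 1 :> R by field.
rewrite mul1e -measureU// ?setICr// setUv.
exact: probability_setT.
Qed.

HB.instance Definition _ := Measure_isProbability.Build _ _ _ hc_base hc_base_setT.

End hypercube_density.

Section hypercube_law.
Context {R : realType} {dX dY : measure_display}.
Context {X : measurableType dX} {Y : measurableType dY} {m : nat}.
Variable H : hypercube R X Y m.
Local Notation mu := (hc_mu H).
Local Notation X0 := (hc_part H ord0).
Local Notation block j := (hc_part H (lift ord0 j)).
Variable q : bool -> X -> R.
Hypothesis mq : forall t, measurable_fun setT (q t).
Hypothesis q01 : forall t x, 0 <= q t x <= 1.
Hypothesis qE : forall t (j : 'I_m),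
  {ae mu, forall x, block j x -> q t x = hc_p H t x}.
Local Notation W := ((X * Y) * bool)%type.
Local Notation dens := (hc_density H q).

Let mX0 : measurable X0. Proof. exact: hc_part_measurable. Qed.
Let mC0 : measurable (~` X0). Proof. exact: measurableC. Qed.

Lemma prob_two_points d (T : measurableType d) (P : {measure set T -> \bar R})
    (a b : T) (p : R) (B : set T) :
  P setT = 1%E -> a <> b -> measurable [set a] -> measurable [set b] ->
  P [set a] = p%:E -> P [set b] = (1 - p)%:E -> measurable B ->
  P B = (p * \1_B a + (1 - p) * \1_B b)%:E.
Proof.
move=> PT ab ma mb Pa Pb mB.
have mD : measurable ([set a] `|` [set b]) by exact: measurableU.
have dab : [set a] `&` [set b] = set0.
  by apply/seteqP; split => // t [/= ta tb]; apply: ab; rewrite -ta -tb.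
have PD : P (~` ([set a] `|` [set b])) = 0%E.
  have := PT; rewrite -(setUv ([set a] `|` [set b])).
  have -> : P (([set a] `|` [set b]) `|` ~` ([set a] `|` [set b])) =
      (P ([set a] `|` [set b]) + P (~` ([set a] `|` [set b])))%E.
    by apply: measureU; [|exact: measurableC|exact: setICr].
  have -> : P ([set a] `|` [set b]) = (P [set a] + P [set b])%E by exact: measureU.
  rewrite Pa Pb -EFinD [p + _]addrC subrK.
  case: (P _) => // r [r1]; congr EFin.
  by apply: (@addrI _ (1 : R)); rewrite addr0.
have point t r : P [set t] = r%:E -> measurable [set t] ->
    P (B `&` [set t]) = (r * \1_B t)%:E.
  move=> Pt mt; rewrite indicE; have [tB|tB] := boolP (t \in B).
    rewrite mulr1 -Pt; congr (P _); apply/seteqP; split => [z []//|z /= ->].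
    by split=> //; exact: set_mem.
  rewrite mulr0 (_ : B `&` _ = set0) ?measure0//; apply/seteqP; split => // z [zB /= zt].
  by move/negP: tB; apply; rewrite -zt; exact: mem_set.
have mBD : measurable (B `&` ([set a] `|` [set b])) by exact: measurableI.
have mBC : measurable (B `&` ~` ([set a] `|` [set b])).
  by apply: measurableI => //; exact: measurableC.
have PBC : P (B `&` ~` ([set a] `|` [set b])) = 0%E.
  have mDC : measurable (~` ([set a] `|` [set b])) by exact: measurableC.
  exact: (@subset_measure0 _ _ _ P _ (~` ([set a] `|` [set b]))).
have -> : P B = (P (B `&` ([set a] `|` [set b])) +
                 P (B `&` ~` ([set a] `|` [set b])))%E.
  rewrite -[in LHS](setIT B) -(setUv ([set a] `|` [set b])) setIUr.
  by apply: measureU => //; rewrite setIACA setICr setI0.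
have -> : P (B `&` ([set a] `|` [set b])) = (P (B `&` [set a]) + P (B `&` [set b]))%E.
  rewrite setIUr; apply: measureU; [exact: measurableI..|].
  by rewrite setIACA dab setI0.
by rewrite PBC adde0 (point a p)// (point b (1 - p)).
Qed.

Lemma hc_cond_branch s (j : 'I_m) x (B : set Y) : block j x -> measurable B ->
  hc_cond H s x B = (branch (hc_p H (s j) x) true * \1_B (hc_output H true x) +
    branch (hc_p H (s j) x) false * \1_B (hc_output H false x))%:E.
Proof.
move=> jx mB; have x0 := hc_block_rest jx.
have [m1 m2] := hc_set1_measurable x0.
rewrite hc_output1// hc_output2//.
have [Pa Pb] := hc_cond_block s jx.
apply: (@prob_two_points _ _ (hc_cond H s x)) => //.
- exact: prob_kernel.
- exact: hc_h_neq.
- by rewrite Pa /hc_p; case: (s j).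
- have -> : hc_p H (s j) x = (if s j then hc_pp H x else hc_pm H x).
    by rewrite /hc_p; case: (s j).
  by move: Pb; case: (hc_cond H s x [set hc_h2 H x]) => // r -[->]; rewrite subKr.
Qed.

Lemma hc_P_density s (S : set (X * Y)) : measurable S ->
  hc_P H s S = pushdensity (hc_base H) (dens s) fst S.
Proof.
apply: density_rectangles.
- exact: measurable_hc_density.
- exact: hc_density_ge0.
- exact: measurable_fst.
move=> A B mA mB.
transitivity (\int[mu]_(x in A `&` X0) hc_cond H s x B +
              \int[mu]_(x in A `&` ~` X0) hc_cond H s x B)%E.
  transitivity (\int[mu]_(x in A) hc_cond H s x B)%E.
    exact: hc_disintegration.
  rewrite -ge0_integral_setU//; do ?[exact: measurableI
    |by apply: measurable_funTS; exact: measurable_kernel].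
    by rewrite -setIUr setUv setIT.
  by apply/disj_setPS; rewrite setIACA setICr setI0.
rewrite /pushdensity integral_mkcond.
pose F (u : W) : \bar R := (\1_(A `*` B) u.1 * dens s u)%:E.
have mF : measurable_fun setT F.
  apply/measurable_EFinP/measurable_funM; last exact: measurable_hc_density.
  by apply: measurableT_comp => //; apply: measurable_indic; exact: measurableX.
transitivity (\int[hc_base H]_u F u)%E; last first.
  apply: eq_integral => u _; rewrite patchE /F indicE.
  have -> : (u \in fst @^-1` (A `*` B)) = (u.1 \in A `*` B).
    by apply/idP/idP; rewrite !inE.
  by case: ifPn; rewrite ?mul1r ?mul0r.
rewrite ge0_integral_hc_base//; last first.
  by move=> u; rewrite lee_fin mulr_ge0// hc_density_ge0.
congr (_ + _)%E.
  (* On X_0 the kernel of [s] agrees with that of the vertex used in [hc_base]. *)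
  rewrite (eq_integral (fun x => hc_cond H [ffun=> true] x B)); last first.
    by move=> x /set_mem[_ x0]; exact: hc_cond_rest.
  rewrite -hc_disintegration//; last exact: measurableI.
  rewrite -[LHS]mul1e -integral_cst; last by apply: measurableX => //; exact: measurableI.
  rewrite integral_mkcond; apply: eq_integral => z _; rewrite patchE /F.
  case: ifPn => [/set_mem[[zA z0] zB]|zn].
    by rewrite hc_density_rest// !indicE !mem_set//= ?mul1r ?mulr1// mule1.
  rewrite -EFinM -mulrA [_ * \1_X0 _]mulrC mulrA !indicE.
  case: (boolP (z \in A `*` B)) => [/set_mem[zA zB]|]; rewrite ?mul0r//.
  rewrite memNset ?mulr0 ?mul0r// => z0; move/negP: zn; apply.
  by rewrite inE.
have mFb b : measurable_fun setT (fun x => F ((x, hc_output H b x), b)).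
  apply: (measurableT_comp mF); apply: measurable_fun_pair => //.
  by apply: measurable_fun_pair => //; exact: measurable_hc_output.
have mwt : measurable_fun setT (fun x => (1 / 2 * \1_(~` X0) x : R)%:E).
  by apply/measurable_EFinP/measurable_funM => //; exact: measurable_indic.
have F0 u : (0 <= F u)%E by rewrite lee_fin mulr_ge0// hc_density_ge0.
rewrite -ge0_integralD//; do ?[by move=> x _; rewrite mule_ge0// lee_fin mulr_ge0
  |exact: emeasurable_funM].
rewrite [LHS]integral_mkcond; apply: ge0_ae_eq_integral => //.
- apply/(measurable_restrictT _ _).1; first exact: measurableI.
  by apply: measurable_funTS; exact: measurable_kernel.
- by apply: emeasurable_funD; exact: emeasurable_funM.
- by move=> x _; rewrite erestrict_ge0.
- by move=> x _; rewrite adde_ge0// mule_ge0// lee_fin mulr_ge0.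
have : {ae mu, forall x, forall t (j : 'I_m), block j x -> q t x = hc_p H t x}.
  apply: filter_forall => -[]; apply: filter_forall => j; exact: qE.
apply: filterS => x qx _; rewrite patchE.
case: ifPn => [/set_mem[xA x0]|xn].
  have [j jx] := hc_rest_block x0.
  have D b y : dens s ((x, y), b) = 2 * branch (q (s j) x) b.
    exact: hc_density_block.
  rewrite (hc_cond_branch _ jx mB) /F !D.
  have e (b : bool) : \1_(A `*` B) (x, hc_output H b x) = \1_B (hc_output H b x) :> R.
    rewrite !indicE; congr (nat_of_bool _)%:R.
    by apply/idP/idP; rewrite !inE/= => // -[].
  rewrite !e (qx _ _ jx) -!EFinM -EFinD; congr EFin.
  by rewrite [\1_(~` X0) x]indicE mem_set//=; field.
rewrite /F; have [xA|xA] := pselect (A x); last first.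
  have e (b : bool) : \1_(A `*` B) (x, hc_output H b x) = 0 :> R.
    by rewrite indicE memNset//= => -[].
  by rewrite !e !mul0r !mul0e adde0.
have -> : \1_(~` X0) x = 0 :> R.
  by rewrite indicE memNset// => x0; move/negP: xn; apply; rewrite inE.
by rewrite mulr0 !mule0 adde0.
Qed.

End hypercube_law.

(** * Excess risk of a prediction function *)

(** Subtraction of risks is deferred to this point: [pg], [ng] and [ps], [ns] are the positive and
    negative parts of two risks, possibly infinite, and they are compared through sums of
    nonnegative terms only. *)
Lemma ereal_gap (R : realType) (S pg ng ps ns b : \bar R) (e : R) :
  (0 <= S -> 0 <= pg -> 0 <= ng -> 0 <= ps -> 0 <= ns ->
   b \is a fin_num -> S + ps + ng <= ns + pg + e%:E ->
   b <= pg - ng -> b <= ps - ns -> pg < +oo \/ ng < +oo -> ps < +oo \/ ns < +oo ->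
   S <= pg - ng - b + e%:E)%E.
Proof.
case: b => [b||]// S0 pg0 ng0 ps0 ns0 _.
case: pg pg0 => [pg||]//= pg0; last first.
  by move=> _ _ _ [//|]; case: ng ng0 => //= ng ng0 _; rewrite leey.
case: ng ng0 => [ng||]//= ng0.
case: ns ns0 => [ns||]//= ns0; last first.
  by move=> _ _ + _ [|//]; case: ps ps0.
case: ps ps0 => [ps||]//= ps0; last first.
  by case: S S0.
case: S S0 => [S||]//= S0.
by rewrite -!EFinD !lee_fin => h _ h' _ _; lra.
Qed.

Section excess_risk.
Context {R : realType} {dX dY : measure_display}.
Context {X : measurableType dX} {Y : measurableType dY} {m : nat}.
Variable H : hypercube R X Y m.
Local Notation mu := (hc_mu H).
Local Notation X0 := (hc_part H ord0).
Local Notation block j := (hc_part H (lift ord0 j)).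
Variable q : bool -> X -> R.
Hypothesis mq : forall t, measurable_fun setT (q t).
Hypothesis q01 : forall t x, 0 <= q t x <= 1.
Hypothesis qE : forall t (j : 'I_m),
  {ae mu, forall x, block j x -> q t x = hc_p H t x}.
Local Notation W := ((X * Y) * bool)%type.
Local Notation dens := (hc_density H q).
Variable ell : Y -> Y -> R.
Hypothesis ell_measurable : measurable_fun [set: Y * Y] (fun u => ell u.1 u.2).
Hypothesis phi_defined : forall (y1 y2 : Y) (p : R), 0 <= p <= 1 ->
  has_lbound (range (two_point_risk ell y1 y2 p)).
Hypothesis phi_measurable :
  measurable_fun ([set p : R | 0 <= p <= 1] `*` [set: Y * Y])
    (fun u => phi ell u.2.1 u.2.2 u.1).

Let mX0 : measurable X0. Proof. exact: hc_part_measurable. Qed.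
Let mC0 : measurable (~` X0). Proof. exact: measurableC. Qed.
Let mblock (j : 'I_m) : measurable (block j). Proof. exact: hc_part_measurable. Qed.

Lemma phi_le (y1 y2 y : Y) (p : R) : 0 <= p <= 1 ->
  phi ell y1 y2 p <= two_point_risk ell y1 y2 p y.
Proof. by move=> p01; apply: ge_inf; [exact: phi_defined|exists y]. Qed.

(** The probability under [s] that the output at [x] comes from branch [b], set to 0 on X_0. *)
Definition branch_weight s b (x : X) : R :=
  dens s ((x, hc_output H b x), b) * (1 / 2 * \1_(~` X0) x).

Lemma branch_weight_rest s b x : X0 x -> branch_weight s b x = 0.
Proof. by move=> x0; rewrite /branch_weight indicE memNset ?mulr0//= => /(_ x0). Qed.

Lemma branch_weight_block s b (j : 'I_m) x : block j x ->
  branch_weight s b x = branch (q (s j) x) b.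
Proof.
move=> jx; rewrite /branch_weight indicE mem_set/=; last exact: hc_block_rest jx.
have -> : dens s ((x, hc_output H b x), b) = 2 * branch (q (s j) x) b.
  exact: hc_density_block.
by field.
Qed.

Lemma branch_weight_ge0 s b x : 0 <= branch_weight s b x.
Proof. by rewrite mulr_ge0 ?mulr_ge0// hc_density_ge0. Qed.

Let mout b : measurable_fun setT (fun x : X => ((x, hc_output H b x), b) : W).
Proof.
apply: measurable_fun_pair => //; apply: measurable_fun_pair => //.
exact: measurable_hc_output.
Qed.

Lemma measurable_branch_weight s b : measurable_fun setT (branch_weight s b).
Proof.
apply: measurable_funM.
  by apply: (measurableT_comp _ (mout b)); exact: measurable_hc_density.
by apply: measurable_funM => //; exact: measurable_indic.
Qed.

Lemma ge0_integral_hc_P s (G : X * Y -> \bar R) : measurable_fun setT G ->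
  (forall z, (0 <= G z)%E) ->
  (\int[hc_P H s]_z G z =
   \int[hc_P H [ffun=> true]]_z (G z * (\1_X0 z.1)%:E) +
   \int[mu]_x (G (x, hc_output H true x) * (branch_weight s true x)%:E +
               G (x, hc_output H false x) * (branch_weight s false x)%:E))%E.
Proof.
move=> mG G0; have md := measurable_hc_density H mq s.
have dE S : measurable S -> hc_P H s S = pushdensity (hc_base H) (dens s) fst S.
  exact: hc_P_density.
rewrite (ge0_integral_density md (hc_density_ge0 H q01 s) measurable_fst dE)//.
have mF : measurable_fun setT (fun u : W => G u.1 * (dens s u)%:E)%E.
  apply: emeasurable_funM; last exact/measurable_EFinP.
  by apply: measurableT_comp => //; exact: measurable_fst.
rewrite ge0_integral_hc_base//; last first.
  by move=> u; rewrite mule_ge0// lee_fin hc_density_ge0.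
congr (_ + _)%E.
  apply: eq_integral => z _; rewrite /= indicE.
  case: (boolP (z.1 \in X0)) => [/set_mem z0|_]; last by rewrite !mule0.
  by rewrite hc_density_rest// mule1.
have mGb b : measurable_fun setT
    (fun x => G (x, hc_output H b x) * (branch_weight s b x)%:E)%E.
  apply: emeasurable_funM; last exact/measurable_EFinP/measurable_branch_weight.
  apply: (measurableT_comp mG); apply: measurable_fun_pair => //.
  exact: measurable_hc_output.
rewrite ge0_integralD//; do ?[by move=> x _; rewrite mule_ge0// lee_fin branch_weight_ge0].
by congr (_ + _)%E; apply: eq_integral => x _; rewrite -muleA -EFinM.
Qed.

Definition excess_gap (t : bool) (g : {mfun X >-> Y}) (x : X) : R :=
  two_point_risk ell (hc_output H true x) (hc_output H false x) (q t x) (g x) -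
  phi ell (hc_output H true x) (hc_output H false x) (q t x).

Lemma excess_gap_ge0 t g x : 0 <= excess_gap t g x.
Proof. by rewrite subr_ge0 phi_le. Qed.

Let mell (f g : X -> Y) : measurable_fun setT f -> measurable_fun setT g ->
  measurable_fun setT (fun x => ell (f x) (g x)).
Proof.
move=> mf mg; apply: (measurableT_comp ell_measurable (g := fun x => (f x, g x))).
exact: measurable_fun_pair.
Qed.

Lemma measurable_phi_comp (p : X -> R) : measurable_fun setT p ->
  (forall x, 0 <= p x <= 1) ->
  measurable_fun setT
    (fun x => phi ell (hc_output H true x) (hc_output H false x) (p x)).
Proof.
move=> mp p01.
have mI : measurable [set p : R | 0 <= p <= 1].
  exact: (@measurable_itv R `[0, 1]).
pose T x := (p x, (hc_output H true x, hc_output H false x)).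
apply: (measurable_comp (F := [set p : R | 0 <= p <= 1] `*` [set: Y * Y])
  (f := fun u => phi ell u.2.1 u.2.2 u.1) (g := T)) => //.
- exact: measurableX.
- by move=> _ [x _ <-]; split => //=; exact: p01.
- apply: measurable_fun_pair => //; apply: measurable_fun_pair;
    exact: measurable_hc_output.
Qed.

Lemma measurable_excess_gap t g : measurable_fun setT (excess_gap t g).
Proof.
apply: measurable_funB; last exact: measurable_phi_comp.
apply: measurable_funD; apply: measurable_funM => //.
- by apply: mell => //; exact: measurable_hc_output.
- exact: measurable_funB.
- by apply: mell => //; exact: measurable_hc_output.
Qed.

Definition block_excess (j : 'I_m) t g : \bar R :=
  (\int[mu]_(x in block j) (excess_gap t g x)%:E)%E.

Lemma block_excess_ge0 j t g : (0 <= block_excess j t g)%E.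
Proof. by apply: integral_ge0 => x _; rewrite lee_fin excess_gap_ge0. Qed.

Let posr (r : R) := Num.max r 0.
Let negr (r : R) := Num.max (- r) 0.
Let prE r : r = posr r - negr r.
Proof. by rewrite /posr /negr; case: (ltgtP r 0) => [r0|r0|->];
  rewrite ?(max_r (ltW r0)) ?(max_l (ltW r0)) ?oppr0 ?maxxx ?subrr//;
  [rewrite max_l|rewrite max_r]; lra. Qed.

(** The risk of [g] is compared with that of a competitor equal to [g] on X_0 and to a near
    minimizer elsewhere: what happens on X_0 cancels, and each block contributes its excess up to
    [e]. *)
Lemma risk_gap s (g : {mfun X >-> Y}) :
  (forall g, expectation_defined ell (hc_P H s) g) ->
  best_risk ell (hc_P H s) \is a fin_num ->
  has_measurable_near_minimizers ell H ->
  (\sum_(j < m) block_excess j (s j) g <=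
   risk ell (hc_P H s) g - best_risk ell (hc_P H s))%E.
Proof.
move=> expdef bfin near; apply/lee_addgt0Pr => e e0.
have [ge geE] := near s e e0.
pose gs' := fun x => if x \in X0 then g x else ge x.
have mgs : measurable_fun setT gs'.
  apply: measurable_fun_ifT => //; apply: (@measurable_fun_bool _ _ _ _ true).
  rewrite setTI (_ : _ @^-1` _ = X0)//.
  by apply/seteqP; split => x /= h; [exact: set_mem|exact: mem_set].
pose gs : {mfun X >-> Y} := HB.pack gs' (isMeasurableFun.Build _ _ _ _ gs' mgs).
pose pos (h : {mfun X >-> Y}) (z : X * Y) := (posr (ell z.2 (h z.1)))%:E.
pose neg (h : {mfun X >-> Y}) (z : X * Y) := (negr (ell z.2 (h z.1)))%:E.
have mz (h : {mfun X >-> Y}) : measurable_fun setT (fun z : X * Y => ell z.2 (h z.1)).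
  apply: (measurableT_comp ell_measurable (g := fun z : X * Y => (z.2, h z.1))).
  by apply: measurable_fun_pair => //; apply: measurableT_comp => //; exact: measurable_fst.
have mpos h : measurable_fun setT (pos h).
  by apply/measurable_EFinP; apply: measurable_maxr.
have mneg h : measurable_fun setT (neg h).
  by apply/measurable_EFinP; apply: measurable_maxr => //; exact: measurableT_comp.
have pos0 h z : (0 <= pos h z)%E by rewrite lee_fin le_max lexx orbT.
have neg0 h z : (0 <= neg h z)%E by rewrite lee_fin le_max lexx orbT.
pose Ip h := (\int[hc_P H s]_z pos h z)%E.
pose In h := (\int[hc_P H s]_z neg h z)%E.
have Ip0 h : (0 <= Ip h)%E by exact: integral_ge0.
have In0 h : (0 <= In h)%E by exact: integral_ge0.
have riskE h : risk ell (hc_P H s) h = (Ip h - In h)%E.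
  rewrite /risk integralE; congr (_ - _)%E; apply: eq_integral => z _.
    by rewrite /pos /posr funeposE EFin_max.
  by rewrite /neg /negr funenegE EFin_max.
have expE h : (Ip h < +oo)%E \/ (In h < +oo)%E.
  have [he|he] := expdef h; [left|right]; apply: le_lt_trans he;
    rewrite le_eqVlt; apply/orP; left; apply/eqP; apply: eq_integral => z _.
    by rewrite /pos /posr funeposE EFin_max.
  by rewrite /neg /negr funenegE EFin_max.
set S := (\sum_(j < m) _)%E.
have S0 : (0 <= S)%E by apply: sume_ge0 => j _; exact: block_excess_ge0.
(* The contributions of X_0 may be infinite, so they are matched on the two sides instead of being
   subtracted. *)
have key : (S + Ip gs + In g <= In gs + Ip g + e%:E)%E.
  pose w b x := (branch_weight s b x)%:E.
  pose I0p h := (\int[hc_P H [ffun=> true]]_z (pos h z * (\1_X0 z.1)%:E))%E.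
  pose I0n h := (\int[hc_P H [ffun=> true]]_z (neg h z * (\1_X0 z.1)%:E))%E.
  pose fp h x := (pos h (x, hc_output H true x) * w true x +
                  pos h (x, hc_output H false x) * w false x)%E.
  pose fn h x := (neg h (x, hc_output H true x) * w true x +
                  neg h (x, hc_output H false x) * w false x)%E.
  have mf h (F : {mfun X >-> Y} -> X * Y -> \bar R) : measurable_fun setT (F h) ->
      measurable_fun setT (fun x => F h (x, hc_output H true x) * w true x +
                                    F h (x, hc_output H false x) * w false x)%E.
    move=> mF; have mb b : measurable_fun setT (fun x => F h (x, hc_output H b x) * w b x)%E.
      apply: emeasurable_funM; last exact/measurable_EFinP/measurable_branch_weight.
      apply: (measurableT_comp mF); apply: measurable_fun_pair => //.
      exact: measurable_hc_output.
    exact: emeasurable_funD.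
  have w0 b x : (0 <= w b x)%E by rewrite lee_fin branch_weight_ge0.
  have fp0 h x : (0 <= fp h x)%E by rewrite adde_ge0// mule_ge0.
  have fn0 h x : (0 <= fn h x)%E by rewrite adde_ge0// mule_ge0.
  have mfp h : measurable_fun setT (fp h) by exact: mf.
  have mfn h : measurable_fun setT (fn h) by exact: mf.
  have IpE h : Ip h = (I0p h + \int[mu]_x fp h x)%E by exact: ge0_integral_hc_P.
  have InE h : In h = (I0n h + \int[mu]_x fn h x)%E by exact: ge0_integral_hc_P.
  have rest h : (h = pos) \/ (h = neg) -> 
      (\int[hc_P H [ffun=> true]]_z (h gs z * (\1_X0 z.1)%:E) =
       \int[hc_P H [ffun=> true]]_z (h g z * (\1_X0 z.1)%:E))%E.
    move=> hE; apply: eq_integral => z _; rewrite indicE.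
    have [z0|_] := boolP (z.1 \in X0); last by rewrite !mule0.
    by case: hE => ->; rewrite /pos /neg /gs /= /gs' z0.
  pose gap x := (\sum_(j < m) \1_(block j) x * excess_gap (s j) g x).
  have gap0 x : 0 <= gap x.
    by apply: sumr_ge0 => j _; rewrite mulr_ge0// excess_gap_ge0.
  have mgap : measurable_fun setT gap.
    apply: measurable_sum => j; apply: measurable_funM; last exact: measurable_excess_gap.
    exact: measurable_indic.
  have SE : S = (\int[mu]_x (gap x)%:E)%E.
    under eq_integral do rewrite /gap -sumEFin.
    rewrite ge0_integral_sum//; first last.
    - by move=> j x _; rewrite lee_fin mulr_ge0// excess_gap_ge0.
    - move=> j; apply/measurable_EFinP/measurable_funM; last exact: measurable_excess_gap.
      exact: measurable_indic.
    apply: eq_bigr => j _; rewrite /block_excess [LHS]integral_mkcond.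
    apply: eq_integral => x _; rewrite patchE indicE.
    by case: ifPn => _; rewrite ?mul1r ?mul0r.
  have main : (S + \int[mu]_x fp gs x + \int[mu]_x fn g x <=
      \int[mu]_x fn gs x + \int[mu]_x fp g x + e%:E)%E.
    have ecst : e%:E = (\int[mu]_x (cst e%:E x))%E.
      by rewrite integral_cst// [X in (_ * X)%E]probability_setT mule1.
    have mgapE : measurable_fun setT (fun x => (gap x)%:E) by exact/measurable_EFinP.
    have gapE0 x : (0 <= (gap x)%:E)%E by rewrite lee_fin.
    have e00 x : (0 <= cst e%:E x :> \bar R)%E by rewrite lee_fin ltW.
    have mA : measurable_fun setT (fun x => (gap x)%:E + fp gs x)%E.
      exact: emeasurable_funD.
    have A0 x : (0 <= (gap x)%:E + fp gs x)%E by exact: adde_ge0.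
    have mB : measurable_fun setT (fun x => fn gs x + fp g x)%E.
      exact: emeasurable_funD.
    have B0 x : (0 <= fn gs x + fp g x)%E by exact: adde_ge0.
    rewrite SE ecst -!ge0_integralD//.
    apply: ae_ge0_le_integral => //.
    - by move=> x _; exact: adde_ge0.
    - exact: emeasurable_funD.
    - by move=> x _; exact: adde_ge0.
    - exact: emeasurable_funD.
    have aeq : {ae mu, forall x, forall t (j : 'I_m), block j x -> q t x = hc_p H t x}.
      by apply: filter_forall => t; apply: filter_forall => j; exact: qE.
    have aege : {ae mu, forall x, forall j : 'I_m, block j x ->
        let p := if s j then hc_pp H x else hc_pm H x in
        two_point_risk ell (hc_h1 H x) (hc_h2 H x) p (ge x)
        <= phi ell (hc_h1 H x) (hc_h2 H x) p + e}.
      by apply: filter_forall => j; exact: geE.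
    apply: filterS (filterI aege aeq) => x [gex qx] _.
    have [x0|x0] := pselect (X0 x).
      have -> : gap x = 0.
        rewrite /gap big1// => j _; rewrite indicE memNset ?mul0r//.
        by move=> /hc_block_rest.
      rewrite /fp /fn /w !branch_weight_rest// !mule0 !adde0 !add0e.
      by rewrite lee_fin ltW.
    have [j jx] := hc_rest_block x0.
    have gapE : gap x = excess_gap (s j) g x.
      rewrite /gap (bigD1 j)//= indicE mem_set// mul1r big1 ?addr0// => i ij.
      rewrite indicE memNset ?mul0r// => ix.
      by move/eqP: ij; apply; apply: (@lift_inj _ ord0); exact: hc_part_uniq ix jx.
    have gsx : gs' x = ge x by rewrite /gs' memNset.
    have qj : q (s j) x = if s j then hc_pp H x else hc_pm H x.
      by rewrite (qx _ j jx) /hc_p; case: (s j).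
    have := gex j jx; rewrite /= -qj -(hc_output1 x0) -(hc_output2 x0).
    rewrite gapE /fp /fn /w !(branch_weight_block _ _ jx) /pos /neg /= gsx.
    rewrite /excess_gap /two_point_risk -!EFinM -!EFinD lee_fin.
    move: (ell (hc_output H true x) (g x)) (posr (ell (hc_output H true x) (g x)))
      (negr (ell (hc_output H true x) (g x)))
      (prE (ell (hc_output H true x) (g x))) => rtg ptg ntg ->.
    move: (ell (hc_output H true x) (ge x)) (posr (ell (hc_output H true x) (ge x)))
      (negr (ell (hc_output H true x) (ge x)))
      (prE (ell (hc_output H true x) (ge x))) => rtge ptge ntge ->.
    move: (ell (hc_output H false x) (g x)) (posr (ell (hc_output H false x) (g x)))
      (negr (ell (hc_output H false x) (g x)))
      (prE (ell (hc_output H false x) (g x))) => rfg pfg nfg ->.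
    move: (ell (hc_output H false x) (ge x)) (posr (ell (hc_output H false x) (ge x)))
      (negr (ell (hc_output H false x) (ge x)))
      (prE (ell (hc_output H false x) (ge x))) => rfge pfge nfge ->.
    rewrite /branch; move: (q _ _) (phi _ _ _ _) => p f; lra.
  have rp : I0p gs = I0p g := rest pos (or_introl erefl).
  have rn : I0n gs = I0n g := rest neg (or_intror erefl).
  have AC1 (i k a b : \bar R) : (S + (i + a) + (k + b) = (i + k) + (S + a + b))%E.
    by rewrite [(S + _)%E]addeCA addeACA.
  have AC2 (i k c d : \bar R) : (k + c + (i + d) + e%:E = (i + k) + (c + d + e%:E))%E.
    by rewrite [RHS]addeA addeACA; congr (_ + _ + _)%E; exact: addeC.
  by rewrite !IpE !InE rp rn AC1 AC2; exact: leeD2l.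
have best_le h : (best_risk ell (hc_P H s) <= Ip h - In h)%E.
  by rewrite -riskE; apply: ereal_inf_lbound; exists h.
rewrite riskE; apply: (ereal_gap _ _ _ _ _ bfin key) => //.
Qed.

End excess_risk.

(** * The lower bound over the vertices *)

(** Subtracting the minimal risk inside the integral leaves a nonnegative integrand, to which the
    change of measure applies. The integral of [D] may be infinite, hence the passage through
    positive and negative parts when [c < 0]. *)
Lemma integral_shift (R : realType) d (T : measurableType d)
    (P : probability T R) (D : T -> \bar R) (c : R) :
  measurable_fun setT D -> (forall t, 0 <= D t)%E ->
  (\int[P]_t (D t + c%:E) = \int[P]_t D t + c%:E)%E.
Proof.
move=> mD D0; pose f t := (D t + c%:E)%E.
have mf : measurable_fun setT f by apply: emeasurable_funD.
have cst_int (r : R) : (\int[P]_t r%:E = r%:E)%E.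
  by rewrite integral_cst// [X in (_ * X)%E]probability_setT mule1.
have [c0|c0] := leP 0 c.
  by rewrite ge0_integralD// cst_int.
have nc0 : 0 <= - c by rewrite oppr_ge0 ltW.
rewrite integralE.
have mp := measurable_funepos mf; have mn := measurable_funeneg mf.
have nle t : (f^\- t <= (- c)%:E)%E.
  rewrite funenegE ge_max lee_fin nc0 andbT /f; move: (D0 t).
  by case: (D t) => [r||]//=; rewrite ?leNye// !lee_fin; lra.
have nfin : (\int[P]_t f^\- t)%E \is a fin_num.
  rewrite ge0_fin_numE ?integral_ge0//; apply: (@le_lt_trans _ _ (- c)%:E); last exact: ltry.
  by rewrite -(cst_int (- c)); apply: ge0_le_integral.
have E : (\int[P]_t f^\+ t + (- c)%:E = \int[P]_t D t + \int[P]_t f^\- t)%E.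
  rewrite -(cst_int (- c)) -!ge0_integralD//.
  apply: eq_integral => t _; rewrite funeposE funenegE /f; move: (D0 t).
  case: (D t) => [r||]//= r0; last by rewrite max_l ?leey// max_r ?leNye.
  rewrite -!EFin_max -!EFinD; congr EFin; rewrite lee_fin in r0.
  case/orP: (le_total 0 (r + c)) => h.
    by rewrite (max_l h) max_r; lra.
  by rewrite (max_r h) max_l; lra.
have iD0 : (0 <= \int[P]_t D t)%E by exact: integral_ge0.
have if0 : (0 <= \int[P]_t f^\+ t)%E by exact: integral_ge0.
move: E nfin iD0 if0.
case: (\int[P]_t f^\- t)%E => [k||]// + _; case: (\int[P]_t D t)%E => [x||]//;
  case: (\int[P]_t f^\+ t)%E => [y||]//= [] h _ _.
by rewrite -!EFinD; congr EFin; lra.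
Qed.

Section supremum.
Context {R : realType} {dX dY : measure_display}.
Context {X : measurableType dX} {Y : measurableType dY} {m n : nat}.
Variable H : hypercube R X Y m.
Variable q : bool -> X -> R.
Hypothesis mq : forall t, measurable_fun setT (q t).
Hypothesis q01 : forall t x, 0 <= q t x <= 1.
Hypothesis qE : forall t (j : 'I_m),
  {ae hc_mu H, forall x, hc_part H (lift ord0 j) x -> q t x = hc_p H t x}.
Local Notation W := ((X * Y) * bool)%type.
Variable ell : Y -> Y -> R.
Hypothesis ell_measurable : measurable_fun [set: Y * Y] (fun u => ell u.1 u.2).
Hypothesis phi_defined : forall (y1 y2 : Y) (p : R), 0 <= p <= 1 ->
  has_lbound (range (two_point_risk ell y1 y2 p)).
Hypothesis phi_measurable :
  measurable_fun ([set p : R | 0 <= p <= 1] `*` [set: Y * Y])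
    (fun u => phi ell u.2.1 u.2.2 u.1).
Variable ghat : n.-tuple (X * Y)%type -> {mfun X >-> Y}.
Hypothesis well_posedP : forall s, well_posed ell (hc_P H s).
Hypothesis risk_measurable : forall s,
  measurable_fun setT (fun z => risk ell (hc_P H s) (ghat z)).
Hypothesis near_minimizers : has_measurable_near_minimizers ell H.

Definition flip (j : 'I_m) (s : {ffun 'I_m -> bool}) : {ffun 'I_m -> bool} :=
  [ffun i => if i == j then ~~ s i else s i].

Lemma flipK j : involutive (flip j).
Proof. by move=> s; apply/ffunP => i; rewrite !ffunE; case: eqP; rewrite ?negbK. Qed.

Definition likelihood s (u : n.-tuple W) : R := \prod_(x <- u) hc_density H q s x.

Lemma likelihood_ge0 s u : 0 <= likelihood s u.
Proof. by apply: prodr_ge0 => x _; exact: hc_density_ge0. Qed.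

Lemma measurable_likelihood s : measurable_fun setT (likelihood s).
Proof. by apply: measurable_prod_tuple; exact: measurable_hc_density. Qed.

Lemma expected_excess_riskE s :
  expected_excess_risk ell ghat (hc_P H s) =
  (\int[iid (hc_base H) n]_u
     ((risk ell (hc_P H s) (ghat (map_tuple fst u)) - best_risk ell (hc_P H s)) *
      (likelihood s u)%:E))%E.
Proof.
have [_ bfin] := well_posedP s; rewrite /expected_excess_risk.
have bestE : best_risk ell (hc_P H s) = (fine (best_risk ell (hc_P H s)))%:E.
  by rewrite fineK.
have D0 z : (0 <= risk ell (hc_P H s) (ghat z) - best_risk ell (hc_P H s))%E.
  by rewrite sube_ge0 ?bfin//; apply: ereal_inf_lbound; exists (ghat z).
have mD : measurable_fun setT
    (fun z => risk ell (hc_P H s) (ghat z) - best_risk ell (hc_P H s))%E.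
  by apply: emeasurable_funB.
have mden := measurable_hc_density H mq s.
have dE S : measurable S ->
    hc_P H s S = pushdensity (hc_base H) (hc_density H q s) fst S.
  exact: hc_P_density.
rewrite -(ge0_integral_iid_density mden (hc_density_ge0 H q01 s) measurable_fst dE
  (F := fun z => risk ell (hc_P H s) (ghat z) - best_risk ell (hc_P H s))%E)//.
have -> : (\int[iid (hc_P H s) n]_z risk ell (hc_P H s) (ghat z) =
    \int[iid (hc_P H s) n]_z (risk ell (hc_P H s) (ghat z) - best_risk ell (hc_P H s)) +
    best_risk ell (hc_P H s))%E.
  rewrite {2}bestE -integral_shift//; apply: eq_integral => z _.
  by rewrite -bestE subeK.
by rewrite addeK.
Qed.

(** [l] is the bound used for a pair of likelihoods: twice their minimum, or twice their product
    over their sum. In the sum over ordered pairs [(s, flip j s)] every vertex occurs twice for each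
    [j], once in each place; hence the factor [m / 2]. *)
Lemma sup_excess_ge (l : R -> R -> R) (C M : \bar R) (e : R) :
  measurable_fun setT (fun v : R * R => l v.1 v.2) ->
  (forall a b, 0 <= a -> 0 <= b -> 0 <= l a b) ->
  (forall a b, l a b = l b a) -> (0 <= C)%E ->
  (forall j a b (g : {mfun X >-> Y}), 0 <= a -> 0 <= b ->
     ((l a b)%:E * C <= a%:E * block_excess H q ell j true g +
                        b%:E * block_excess H q ell j false g)%E) ->
  (forall j s, (e%:E <= \int[iid (hc_base H) n]_u
     (l (likelihood s u) (likelihood (flip j s) u))%:E)%E) ->
  (forall s, (expected_excess_risk ell ghat (hc_P H s) <= M)%E) ->
  ((m%:R / 2)%:E * (e%:E * C) <= M)%E.
Proof.
move=> ml l0 lC C0 lle ele exM.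
pose N : R := #|{: {ffun 'I_m -> bool}}|%:R.
have N0 : 0 < N by rewrite ltr0n card_ffun card_bool card_ord expn_gt0.
have mfst : measurable_fun setT (map_tuple fst : n.-tuple W -> n.-tuple (X * Y)).
  exact: measurable_map_tuple.
pose D s (u : n.-tuple W) :=
  (risk ell (hc_P H s) (ghat (map_tuple fst u)) - best_risk ell (hc_P H s))%E.
pose T s u := (D s u * (likelihood s u)%:E)%E.
have D0 s u : (0 <= D s u)%E.
  have [_ bfin] := well_posedP s.
  by rewrite sube_ge0 ?bfin//; apply: ereal_inf_lbound; exists (ghat (map_tuple fst u)).
have mT s : measurable_fun setT (T s).
  apply: emeasurable_funM; last by apply/measurable_EFinP; exact: measurable_likelihood.
  have mR := measurableT_comp (risk_measurable s) mfst.
  by apply: emeasurable_funB; [exact: mR|exact: measurable_cst].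
have T0 s u : (0 <= T s u)%E by rewrite mule_ge0// lee_fin likelihood_ge0.
pose L j s u : \bar R := ((l (likelihood s u) (likelihood (flip j s) u))%:E * C)%E.
have L0 j s u : (0 <= L j s u)%E by rewrite mule_ge0// lee_fin l0// likelihood_ge0.
have ml' j s : measurable_fun setT
    (fun u => (l (likelihood s u) (likelihood (flip j s) u))%:E).
  apply/measurable_EFinP.
  apply: (measurableT_comp ml (g := fun u => (likelihood s u, likelihood (flip j s) u))).
  by apply: measurable_fun_pair; exact: measurable_likelihood.
have mL j s : measurable_fun setT (L j s) by apply: emeasurable_funM.
pose B j s u := ((likelihood s u)%:E *
  block_excess H q ell j (s j) (ghat (map_tuple fst u)))%E.
have B0 j s u : (0 <= B j s u)%E.
  by rewrite mule_ge0 ?lee_fin ?likelihood_ge0// block_excess_ge0.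
have BT s u : (\sum_(j < m) B j s u <= T s u)%E.
  have [ed bfin] := well_posedP s.
  rewrite /B -ge0_sume_distrr; last by move=> j _; exact: block_excess_ge0.
  rewrite muleC lee_wpmul2r ?lee_fin ?likelihood_ge0//.
  exact: risk_gap.
have LB j s u : (L j s u <= B j s u + B j (flip j s) u)%E.
  rewrite /L /B ffunE eqxx; case: (s j) => /=.
    by apply: lle; exact: likelihood_ge0.
  by rewrite lC addeC; apply: lle; exact: likelihood_ge0.
have pt u : (\sum_s \sum_(j < m) L j s u <= \sum_s T s u + \sum_s T s u)%E.
  apply: (@le_trans _ _ (\sum_s \sum_(j < m) B j s u + \sum_s \sum_(j < m) B j s u)%E); last first.
    by apply: leeD; apply: lee_sum => s _.
  rewrite exchange_big [X in (_ <= X + X)%E]exchange_big /= -big_split /=.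
  apply: lee_sum => j _.
  rewrite [X in (_ <= _ + X)%E](reindex_inj (inv_inj (flipK j))) -big_split /=.
  by apply: lee_sum => s _; exact: LB.
have sumC (x : \bar R) : (\sum_(s : {ffun 'I_m -> bool}) x = N%:E * x)%E.
  by rewrite sumr_const mule_natl.
have sumj (x : \bar R) : (\sum_(j < m) x = m%:R%:E * x)%E.
  by rewrite sumr_const card_ord mule_natl.
have upper : (\sum_s \int[iid (hc_base H) n]_u T s u <= N%:E * M)%E.
  by rewrite -sumC; apply: lee_sum => s _; rewrite -expected_excess_riskE.
have lower : (N%:E * (m%:R%:E * (e%:E * C)) <=
    \sum_s \int[iid (hc_base H) n]_u T s u + \sum_s \int[iid (hc_base H) n]_u T s u)%E.
  apply: (@le_trans _ _ (\int[iid (hc_base H) n]_u \sum_s \sum_(j < m) L j s u)%E).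
    rewrite ge0_integral_sum//; first last.
    - by move=> s u _; apply: sume_ge0.
    - by move=> s; apply: emeasurable_sum.
    rewrite -sumC; apply: lee_sum => s _; rewrite ge0_integral_sum// -sumj.
    apply: lee_sum => j _; rewrite ge0_integralZr//; first exact: lee_wpmul2r.
    by move=> u _; rewrite lee_fin l0// likelihood_ge0.
  rewrite -ge0_integral_sum// -ge0_integralD//; do ?[exact: emeasurable_sum
    |by move=> u _; exact: sume_ge0].
  apply: ge0_le_integral => //.
  - by move=> u _; apply: sume_ge0 => s _; exact: sume_ge0.
  - by apply: emeasurable_sum => s; exact: emeasurable_sum.
  - by apply: emeasurable_funD; exact: emeasurable_sum.
have : (N%:E * (m%:R%:E * (e%:E * C)) <= N%:E * M + N%:E * M)%E.
  by apply: (le_trans lower); exact: leeD.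
have -> : (N%:E * M + N%:E * M = (2 * N)%:E * M)%E.
  have NM : (0 <= N%:E * M)%E \/ (N%:E * M <= 0)%E
    by case: (leP 0%E (N%:E * M)%E) => [|/ltW]; [left|right].
  by rewrite -mule2n -mule_natl muleA -EFinM.
have -> : (N%:E * (m%:R%:E * (e%:E * C)) = (2 * N)%:E * ((m%:R / 2)%:E * (e%:E * C)))%E.
  by rewrite !muleA -!EFinM; congr (_%:E * _)%E; field.
by rewrite lee_pmul2l// lte_fin mulr_gt0.
Qed.

End supremum.

(** * Integrals over blocks and equality of the block laws *)

Section block_laws.
Context {R : realType} {dX dY : measure_display}.
Context {X : measurableType dX} {Y : measurableType dY} {m : nat}.
Variable H : hypercube R X Y m.
Local Notation mu := (hc_mu H).
Local Notation X0 := (hc_part H ord0).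
Local Notation block j := (hc_part H (lift ord0 j)).
Local Notation W := ((X * Y) * bool)%type.

Let mX0 : measurable X0. Proof. exact: hc_part_measurable. Qed.
Let mC0 : measurable (~` X0). Proof. exact: measurableC. Qed.
Let mblock (j : 'I_m) : measurable (block j). Proof. exact: hc_part_measurable. Qed.

(** The values of p_+ and p_- on X_0 are junk, with no measurability or bounds; 0 is put there. *)
Definition hc_p0 (t : bool) : X -> R := hc_p H t \_ (~` X0).

Lemma hc_p0E t x : ~ X0 x -> hc_p0 t x = hc_p H t x.
Proof. by move=> x0; rewrite /hc_p0 patchE mem_set. Qed.

Lemma measurable_hc_p0 t : measurable_fun setT (hc_p0 t).
Proof.
apply/(measurable_restrictT _ mC0).1.
by case: t; [exact: hc_pp_measurable|exact: hc_pm_measurable].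
Qed.

Lemma hc_p0_itv t x : 0 <= hc_p0 t x <= 1.
Proof.
have [x0|x0] := pselect (X0 x).
  rewrite /hc_p0 patchE memNset; last by move=> /(_ x0).
  by rewrite lexx ler01.
by rewrite hc_p0E//; have [] := hc_p_itv x0; case: t.
Qed.

Lemma hc_p0_ae t (j : 'I_m) : {ae mu, forall x, block j x -> hc_p0 t x = hc_p H t x}.
Proof. by apply: aeW => x /hc_block_rest; exact: hc_p0E. Qed.

Section version.
Variable q : bool -> X -> R.
Hypothesis mq : forall t, measurable_fun setT (q t).
Hypothesis q01 : forall t x, 0 <= q t x <= 1.
Hypothesis qE : forall t (j : 'I_m),
  {ae mu, forall x, block j x -> q t x = hc_p H t x}.
Local Notation dens := (hc_density H q).

Let mx : measurable_fun [set: W] (fun u : W => u.1.1).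
Proof. by apply: measurableT_comp => //; exact: measurable_fst. Qed.

Let mb : measurable_fun [set: W] (fun u : W => u.2).
Proof. exact: measurable_snd. Qed.

Lemma integral_density_off_block s (j : 'I_m) :
  (\int[hc_base H]_u (\1_(~` block j) u.1.1 * dens s u)%:E =
   1 - mu (block j))%E.
Proof.
have mS : measurable (~` block j `*` [set: Y]).
  by apply: measurableX => //; exact: measurableC.
have := hc_P_density mq q01 qE s mS.
rewrite hc_marginal; last exact: measurableC.
have -> : mu (~` block j) = (1 - mu (block j))%E by exact: probability_setC.
move=> ->; rewrite /pushdensity integral_mkcond; apply: eq_integral => u _.
rewrite patchE indicE.
have -> : (u \in fst @^-1` (~` block j `*` [set: Y])) = (u.1.1 \in ~` block j).
  by apply/idP/idP; rewrite !inE/= => // -[].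
by case: ifPn => _; rewrite ?mul1r ?mul0r.
Qed.

(** On a block the base is [mu] together with a fair coin, hence the mean of the two values of
    [K]. *)
Lemma integral_on_block (j : 'I_m) (K : X -> bool -> R) :
  (forall b, measurable_fun setT (K^~ b)) -> (forall x b, 0 <= K x b) ->
  (\int[hc_base H]_u (\1_(block j) u.1.1 * K u.1.1 u.2)%:E =
   \int[mu]_(x in block j) ((K x true + K x false) / 2)%:E)%E.
Proof.
move=> mK K0.
have mKW : measurable_fun setT (fun u : W => K u.1.1 u.2).
  rewrite (_ : (fun u => _) = fun u : W => if u.2 then K u.1.1 true else K u.1.1 false).
    by apply: measurable_fun_ifT => //; apply: (measurableT_comp (mK _) mx).
  by apply/funext => -[z []].
have mF : measurable_fun setT (fun u : W => (\1_(block j) u.1.1 * K u.1.1 u.2)%:E).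
  apply/measurable_EFinP/measurable_funM => //.
  by apply: (measurableT_comp _ mx); exact: measurable_indic.
rewrite ge0_integral_hc_base//; last by move=> u; rewrite lee_fin mulr_ge0.
rewrite (eq_integral (fun=> 0%E)); last first.
  move=> z _; rewrite /= !indicE; case: (boolP (z.1 \in X0)) => [/set_mem z0|_].
    by rewrite memNset ?mul0r ?mul0e// => /hc_block_rest.
  by rewrite mule0.
rewrite integral0 add0e -ge0_integralD//; do ?[
  by move=> x _; rewrite -EFinM lee_fin !mulr_ge0
  |apply: emeasurable_funM; apply/measurable_EFinP; do ?apply: measurable_funM;
    do ?[exact: measurable_indic|exact: mK|exact: measurable_cst]].
rewrite [RHS]integral_mkcond; apply: eq_integral => x _; rewrite patchE /=.
rewrite !indicE; case: ifPn => [xj|_]; last by rewrite !mul0r !mul0e adde0.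
rewrite mem_set/=; last by apply: hc_block_rest; exact: set_mem xj.
by rewrite -!EFinM -EFinD; congr EFin; field.
Qed.

End version.

Definition hc_quadruple (x : X) : R * R * Y * Y :=
  (hc_p0 true x, hc_p0 false x, hc_output H true x, hc_output H false x).

Lemma measurable_hc_quadruple : measurable_fun setT hc_quadruple.
Proof.
do ?apply: measurable_fun_pair;
  do ?[exact: measurable_hc_p0|exact: measurable_hc_output].
Qed.

Lemma hc_quadrupleE (j : 'I_m) x : block j x ->
  hc_quadruple x = (hc_pp H x, hc_pm H x, hc_h1 H x, hc_h2 H x).
Proof.
move=> /hc_block_rest x0; rewrite /hc_quadruple !hc_p0E//.
by rewrite hc_output1// hc_output2.
Qed.

Lemma same_quadruple_law (i j : 'I_m) (F : R * R * Y * Y -> \bar R) :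
  measurable_fun setT F -> (forall v, (0 <= F v)%E) ->
  (\int[mu]_(x in block i) F (hc_quadruple x) =
   \int[mu]_(x in block j) F (hc_quadruple x))%E.
Proof.
move=> mF F0.
(* On null blocks the conditional laws are identically 0 and carry no information, but both
   integrals vanish. *)
have [w0|w0] := eqVneq (mu (block j)) 0%E.
  have mFq (k : 'I_m) : measurable_fun (block k) (fun x => F (hc_quadruple x)).
    apply: measurable_funTS; apply: (measurableT_comp mF).
    exact: measurable_hc_quadruple.
  have wi : mu (block i) = 0%E by rewrite (hc_same_mass H i j).
  by rewrite !null_set_integral.
have law B : measurable B ->
    mu (block i `&` hc_quadruple @^-1` B) = mu (block j `&` hc_quadruple @^-1` B).
  move=> mB; have := hc_same_law H i j mB; rewrite /= /cond_prob.
  have e (k : 'I_m) : block k `&` ((fun x => (hc_pp H x, hc_pm H x, hc_h1 H x, hc_h2 H x)) @^-1` B) =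
      block k `&` hc_quadruple @^-1` B.
    by apply/seteqP; split => x [xk] /=; rewrite (hc_quadrupleE xk).
  rewrite !e (hc_same_mass H i j).
  have : mu (block j) \is a fin_num by exact: fin_num_measure.
  move: w0; case: (mu (block j)) => // r r0 _.
  have r0' : r != 0 by move: r0; apply: contra_neq => ->.
  rewrite inver (negbTE r0') => /(congr1 (fun x => x * r%:E)%E).
  by rewrite -!muleA -EFinM mulVf// !mule1.
pose nu k := @pushdensity_measure _ _ X _ R mu (\1_(block k)) hc_quadruple
   (measurable_indic (mblock k)) (fun x => ler0n _ _) measurable_hc_quadruple.
(* The image measure [nu k] computes the integral over any block [l] with the same image law; it is
   used with [k = i] and [l] equal to [i], then [j]. *)
have E (k l : 'I_m) : (forall B, measurable B ->
   mu (block k `&` hc_quadruple @^-1` B) = mu (block l `&` hc_quadruple @^-1` B)) ->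
   (\int[nu k]_v F v = \int[mu]_(x in block l) F (hc_quadruple x))%E.
  move=> kl; rewrite (@ge0_integral_density _ _ X _ R mu (\1_(block l)) hc_quadruple).
  - rewrite [RHS]integral_mkcond; apply: eq_integral => x _; rewrite patchE indicE.
    by case: ifPn => _; rewrite ?mule1 ?mule0.
  - exact: measurable_indic.
  - by [].
  - exact: measurable_hc_quadruple.
  - move=> B mB; have mpre : measurable (hc_quadruple @^-1` B).
      by rewrite -[X in measurable X]setTI; exact: measurable_hc_quadruple.
    by rewrite /= /pushdensity !integral_indic//; exact: kl.
  - exact: mF.
  - exact: F0.
by rewrite -(E i i)// (E i j).
Qed.

End block_laws.

(** * The concavity gap of the minimal conditional risk *)

Lemma phi_concave (R : realType) d (Y : measurableType d) (ell : Y -> Y -> R)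
    (y1 y2 : Y) (x y b : R) :
  (forall p, 0 <= p <= 1 -> has_lbound (range (two_point_risk ell y1 y2 p))) ->
  0 <= x <= 1 -> 0 <= y <= 1 -> 0 <= b <= 1 ->
  b * phi ell y1 y2 x + (1 - b) * phi ell y1 y2 y <=
  phi ell y1 y2 (b * x + (1 - b) * y).
Proof.
move=> lb x01 y01 /andP[b0 b1]; apply: lb_le_inf.
  by exists (two_point_risk ell y1 y2 (b * x + (1 - b) * y) point); exists point.
move=> _ [z _ <-].
have -> : two_point_risk ell y1 y2 (b * x + (1 - b) * y) z =
  b * two_point_risk ell y1 y2 x z + (1 - b) * two_point_risk ell y1 y2 y z.
  by rewrite /two_point_risk; ring.
by apply: lerD; apply: ler_wpM2l; rewrite ?subr_ge0//; apply: ge_inf;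
  [exact: lb|by exists z|exact: lb|by exists z].
Qed.

Section psi.
Context {R : realType} {dX dY : measure_display}.
Context {X : measurableType dX} {Y : measurableType dY} {m : nat}.
Variable H : hypercube R X Y m.
Local Notation mu := (hc_mu H).
Local Notation block j := (hc_part H (lift ord0 j)).
Variable q : bool -> X -> R.
Hypothesis mq : forall t, measurable_fun setT (q t).
Hypothesis q01 : forall t x, 0 <= q t x <= 1.
Hypothesis qE : forall t (j : 'I_m),
  {ae mu, forall x, block j x -> q t x = hc_p H t x}.
Variable ell : Y -> Y -> R.
Hypothesis ell_measurable : measurable_fun [set: Y * Y] (fun u => ell u.1 u.2).
Hypothesis phi_defined : forall (y1 y2 : Y) (p : R), 0 <= p <= 1 ->
  has_lbound (range (two_point_risk ell y1 y2 p)).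
Hypothesis phi_measurable :
  measurable_fun ([set p : R | 0 <= p <= 1] `*` [set: Y * Y])
    (fun u => phi ell u.2.1 u.2.2 u.1).

Let mblock (j : 'I_m) : measurable (block j). Proof. exact: hc_part_measurable. Qed.

Lemma mix01 (a x y : R) : 0 <= a <= 1 -> 0 <= x <= 1 -> 0 <= y <= 1 ->
  0 <= a * x + (1 - a) * y <= 1.
Proof. by move=> /andP[a0 a1] /andP[x0 x1] /andP[y0 y1]; apply/andP; split; nra. Qed.

Lemma psi_ge0 (qp qm a : R) (y1 y2 : Y) : 0 <= qp <= 1 -> 0 <= qm <= 1 ->
  0 <= a <= 1 -> 0 <= psi ell qp qm y1 y2 a.
Proof.
move=> p01 m01 a01; rewrite /psi -addrA -opprD subr_ge0.
by apply: phi_concave => // p; exact: phi_defined.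
Qed.

Definition block_psi (j : 'I_m) (a : R) : \bar R :=
  (\int[mu]_(x in block j) (psi ell (q true x) (q false x)
     (hc_output H true x) (hc_output H false x) a)%:E)%E.

Lemma measurable_psi a : 0 <= a <= 1 ->
  measurable_fun setT (fun x => psi ell (q true x) (q false x)
     (hc_output H true x) (hc_output H false x) a).
Proof.
move=> a01; have mp (p : X -> R) := measurable_phi_comp H phi_measurable (p := p).
apply: measurable_funB; last by apply: measurable_funM => //; exact: mp.
apply: measurable_funB; last by apply: measurable_funM => //; exact: mp.
apply: mp; last by move=> x; exact: mix01.
by apply: measurable_funD; apply: measurable_funM.
Qed.

Lemma block_psi_ge0 j a : 0 <= a <= 1 -> (0 <= block_psi j a)%E.
Proof. by move=> a01; apply: integral_ge0 => x _; rewrite lee_fin psi_ge0. Qed.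

(* Whatever the prediction, the posterior mixture of the two conditional risks
   is at least the concavity gap of phi. *)
Lemma le_block_excess (j : 'I_m) (a b : R) (g : {mfun X >-> Y}) :
  0 <= a -> 0 <= b -> 0 < a + b ->
  ((a + b)%:E * block_psi j (a / (a + b)) <=
   a%:E * block_excess H q ell j true g + b%:E * block_excess H q ell j false g)%E.
Proof.
move=> a0 b0 ab; set al := a / (a + b).
have al01 : 0 <= al <= 1.
  by rewrite divr_ge0 ?(ltW ab)//= ler_pdivrMr// mul1r lerDl.
have mg t := measurable_excess_gap H mq q01 ell_measurable phi_measurable t g.
have g0 t x : 0 <= excess_gap H q ell t g x by exact: excess_gap_ge0.
rewrite /block_psi /block_excess.
rewrite -!ge0_integralZl_EFin//; do ?[exact: ltW
  |by move=> x _; rewrite lee_fin psi_ge0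
  |by apply/measurable_EFinP; apply: measurable_funTS; exact: measurable_psi
  |by apply/measurable_EFinP; apply: measurable_funTS
  |by move=> x _; rewrite lee_fin].
rewrite -ge0_integralD//; do ?[
  by move=> x _; rewrite -EFinM lee_fin mulr_ge0
  |by apply/measurable_EFinP; apply: measurable_funTS; apply: measurable_funM].
apply: ge0_le_integral => //.
- by move=> x _; rewrite -EFinM lee_fin mulr_ge0 ?psi_ge0// ltW.
- apply/measurable_EFinP; apply: measurable_funTS; apply: measurable_funM => //.
  exact: measurable_psi.
- apply/measurable_EFinP; apply: measurable_funTS.
  by apply: measurable_funD; apply: measurable_funM.
move=> x _; rewrite -!EFinM -EFinD lee_fin /psi /excess_gap.
set y1 := hc_output H true x; set y2 := hc_output H false x.
have := phi_le phi_defined y1 y2 (g x) (mix01 al01 (q01 true x) (q01 false x)).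
set f := phi ell y1 y2 (al * _ + _) => hf.
(* [two_point_risk] is affine in [p], so the posterior mixture of the two risks is the risk at the
   mixed probability. *)
have -> : a * (two_point_risk ell y1 y2 (q true x) (g x) - phi ell y1 y2 (q true x)) +
  b * (two_point_risk ell y1 y2 (q false x) (g x) - phi ell y1 y2 (q false x)) =
  (a + b) * (two_point_risk ell y1 y2 (al * q true x + (1 - al) * q false x) (g x) -
    al * phi ell y1 y2 (q true x) - (1 - al) * phi ell y1 y2 (q false x)).
  by rewrite /two_point_risk /al; field; rewrite gt_eqF.
by rewrite ler_wpM2l ?(ltW ab)//; lra.
Qed.

Lemma block_psiE (i j : 'I_m) a : 0 <= a <= 1 ->
  block_psi j a = (\int[mu]_(x in block i)
    (psi ell (hc_pp H x) (hc_pm H x) (hc_h1 H x) (hc_h2 H x) a)%:E)%E.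
Proof.
move=> a01.
pose S : set (R * R * Y * Y) := [set v | 0 <= v.1.1.1 <= 1 /\ 0 <= v.1.1.2 <= 1].
pose f (v : R * R * Y * Y) := psi ell v.1.1.1 v.1.1.2 v.1.2 v.2 a.
have m1 : measurable_fun [set: R * R * Y * Y] (fun v : R * R * Y * Y => v.1.1.1).
  by apply: measurableT_comp => //; apply: measurableT_comp.
have m2 : measurable_fun [set: R * R * Y * Y] (fun v : R * R * Y * Y => v.1.1.2).
  by apply: measurableT_comp => //; apply: measurableT_comp.
have mS : measurable S.
  have mI (g : R * R * Y * Y -> R) : measurable_fun setT g ->
      measurable [set v | 0 <= g v <= 1].
    move=> mg; have := mg measurableT _ (@measurable_itv R `[0, 1]).
    by rewrite setTI.
  by apply: measurableI; exact: mI.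
have mphi (p : R * R * Y * Y -> R) : measurable_fun setT p ->
    (forall v, S v -> 0 <= p v <= 1) ->
    measurable_fun S (fun v => phi ell v.1.2 v.2 (p v)).
  move=> mp p01.
  have mI : measurable [set p : R | 0 <= p <= 1] by exact: (@measurable_itv R `[0, 1]).
  apply: (measurable_comp (F := [set p : R | 0 <= p <= 1] `*` [set: Y * Y])
    (f := fun u => phi ell u.2.1 u.2.2 u.1)
    (g := fun v : R * R * Y * Y => (p v, (v.1.2, v.2)))) => //.
  - exact: measurableX.
  - by move=> _ [v vS <-]; split => //=; exact: p01.
  - apply: measurable_funTS; apply: measurable_fun_pair => //.
    by apply: measurable_fun_pair => //; apply: measurableT_comp.
have mf : measurable_fun S f.
  apply: measurable_funB; last first.
    by apply: measurable_funM => //; apply: mphi => // v [].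
  apply: measurable_funB; last first.
    by apply: measurable_funM => //; apply: mphi => // v [].
  apply: mphi; last by move=> v [v1 v2]; exact: mix01.
  by apply: measurable_funD; apply: measurable_funM.
(* [phi] is assumed measurable only for probabilities in [0, 1]; the extension by 0 is harmless, as
   [hc_quadruple] stays in [S]. *)
pose F := (EFin \o f) \_ S.
have mF : measurable_fun setT F.
  have mEf : measurable_fun S (fun v => (f v)%:E) by apply/measurable_EFinP.
  exact: ((measurable_restrictT _ mS).1 mEf).
have F0 v : (0 <= F v)%E.
  rewrite /F patchE; case: ifPn => // /set_mem[v1 v2].
  by rewrite lee_fin psi_ge0.
have FE x : F (hc_quadruple H x) = (psi ell (hc_p0 H true x) (hc_p0 H false x)
   (hc_output H true x) (hc_output H false x) a)%:E.
  by rewrite /F patchE mem_set//; split => /=; exact: hc_p0_itv.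
transitivity (\int[mu]_(x in block j) F (hc_quadruple H x))%E.
  apply: ge0_ae_eq_integral => //.
  - by apply/measurable_EFinP; apply: measurable_funTS; exact: measurable_psi.
  - apply: measurable_funTS; apply: (measurableT_comp mF).
    exact: measurable_hc_quadruple.
  - by move=> x _; rewrite lee_fin psi_ge0.
  - apply: filterS (filterI (qE true j) (qE false j)) => x [q1 q2] xj.
    rewrite FE (q1 xj) (q2 xj) !hc_p0E//; exact: hc_block_rest xj.
rewrite (same_quadruple_law H j i mF F0).
apply: eq_integral => x /set_mem xi; rewrite FE !hc_p0E; do ?exact: hc_block_rest xi.
by rewrite hc_output1 ?hc_output2//; exact: hc_block_rest xi.
Qed.

End psi.

(** * Likelihood ratios of neighbouring vertices *)

Lemma measurable_sqrt (R : realType) d (T : measurableType d) (f : T -> R) :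
  measurable_fun setT f -> measurable_fun setT (fun x => Num.sqrt (f x)).
Proof.
move=> mf; apply: measurableT_comp => //.
by apply: continuous_measurable_fun; exact: sqrt_continuous.
Qed.

(** The optimal [k] is [sqrt(1 - T)]; when it is 0, small positive [k] approach the bound. *)
Lemma le_one_sub_sqrt (R : realType) (x T : R) : T <= 1 ->
  (forall k, 0 < k -> 1 - k / 2 - (1 - T) / (2 * k) <= x) ->
  1 - Num.sqrt (1 - T) <= x.
Proof.
move=> T1 h; have [T1'|Tn1] := eqVneq T 1.
  rewrite T1' subrr sqrtr0 subr0; apply/ler_addgt0Pr => e e0.
  have := h (2 * e); rewrite T1' subrr mul0r subr0 mulr_gt0// => /(_ isT).
  by rewrite [2 * e]mulrC mulfK//; lra.
have k0 : 0 < Num.sqrt (1 - T) by rewrite sqrtr_gt0 subr_gt0 lt_neqAle Tn1.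
have := h _ k0; set k := Num.sqrt _ in k0 *.
have -> : 1 - T = k * k by rewrite -expr2 sqr_sqrtr// subr_ge0.
have -> : k * k / (2 * k) = k / 2 by field; rewrite gt_eqF.
lra.
Qed.

(** Negative coefficients are avoided by moving terms across inequalities, so two nonnegative
    summands suffice. *)
Lemma integral_lin2 (R : realType) d (T : measurableType d)
    (P : {measure set T -> \bar R}) (f g : T -> R) (a b r1 r2 : R) :
  measurable_fun setT f -> measurable_fun setT g ->
  (forall t, 0 <= f t) -> (forall t, 0 <= g t) -> 0 <= a -> 0 <= b ->
  (\int[P]_t (f t)%:E = r1%:E)%E -> (\int[P]_t (g t)%:E = r2%:E)%E ->
  (\int[P]_t (a * f t + b * g t)%:E = (a * r1 + b * r2)%:E)%E.
Proof.
move=> mf mg f0 g0 a0 b0 fr gr.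
under eq_integral do rewrite EFinD !EFinM.
rewrite ge0_integralD//; do ?[by move=> x _; rewrite -EFinM lee_fin mulr_ge0
  |by apply/measurable_EFinP; apply: measurable_funM].
rewrite !ge0_integralZl_EFin//; do ?[by move=> x _; rewrite lee_fin
  |by apply/measurable_EFinP].
by rewrite fr gr -!EFinM -EFinD.
Qed.

Section likelihood_ratio.
Context {R : realType} {dX dY : measure_display}.
Context {X : measurableType dX} {Y : measurableType dY} {m : nat}.
Variable H : hypercube R X Y m.
Local Notation mu := (hc_mu H).
Local Notation block j := (hc_part H (lift ord0 j)).
Local Notation W := ((X * Y) * bool)%type.
Variable q : bool -> X -> R.
Hypothesis mq : forall t, measurable_fun setT (q t).
Hypothesis q01 : forall t x, 0 <= q t x <= 1.
Hypothesis qE : forall t (j : 'I_m),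
  {ae mu, forall x, block j x -> q t x = hc_p H t x}.
Variable w : R.
Hypothesis wE : forall j : 'I_m, mu (block j) = w%:E.
Local Notation dens := (hc_density H q).
Local Notation lam n := (iid (hc_base H) n).
Local Notation L := (likelihood H q).

Let mblock (j : 'I_m) : measurable (block j). Proof. exact: hc_part_measurable. Qed.
Let mx : measurable_fun [set: W] (fun u : W => u.1.1).
Proof. by apply: measurableT_comp => //; exact: measurable_fst. Qed.
Let mb : measurable_fun [set: W] (fun u : W => u.2).
Proof. exact: measurable_snd. Qed.

Lemma hc_density_flip_off s (j : 'I_m) u : ~ block j u.1.1 ->
  dens (flip j s) u = dens s u.
Proof.
move=> nj; rewrite /hc_density; congr (_ + _); apply: eq_bigr => i _.
rewrite ffunE; case: eqP => [->|//].
by rewrite indicE memNset ?mul0r.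
Qed.

Lemma integral_hc_density s : (\int[hc_base H]_u (dens s u)%:E = 1)%E.
Proof.
have := hc_P_density mq q01 qE s measurableT.
by rewrite probability_setT /pushdensity preimage_setT => <-.
Qed.

Lemma integral_likelihood n s : (\int[lam n]_u (L s u)%:E = 1)%E.
Proof.
rewrite ge0_integral_iid_prod; last 2 first.
- exact: measurable_hc_density.
- by move=> u; exact: hc_density_ge0.
by rewrite integral_hc_density; elim: n => // n IH; rewrite expeS IH mule1.
Qed.

Lemma integral_iid_prod_fin n (g : W -> R) (r : R) : measurable_fun setT g ->
  (forall u, 0 <= g u) -> (\int[hc_base H]_u (g u)%:E = r%:E)%E ->
  (\int[lam n]_u (\prod_(x <- u) g x)%R%:E = (r ^+ n)%:E)%E.
Proof. by move=> mg g0 gr; rewrite ge0_integral_iid_prod// gr -EFin_expe. Qed.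

(** Neighbouring densities agree off block [j]. So all the products needed below (tilted densities,
    geometric means, quotients) are densities of vertices modified on that block only. *)
Definition splice s (j : 'I_m) (K : X -> bool -> R) (u : W) : R :=
  \1_(~` block j) u.1.1 * dens s u + \1_(block j) u.1.1 * K u.1.1 u.2.

Lemma splice_off s (j : 'I_m) (K : X -> bool -> R) u :
  ~ block j u.1.1 -> splice s j K u = dens s u.
Proof.
by move=> nj; rewrite /splice !indicE mem_set//= mul1r memNset// mul0r addr0.
Qed.

Lemma splice_on s (j : 'I_m) (K : X -> bool -> R) u : block j u.1.1 ->
  splice s j K u = K u.1.1 u.2.
Proof.
by move=> xj; rewrite /splice !indicE memNset//= mul0r add0r mem_set// mul1r.
Qed.

Lemma splice_ge0 s j (K : X -> bool -> R) :
  (forall x b, 0 <= K x b) -> forall u, 0 <= splice s j K u.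
Proof. by move=> K0 u; rewrite addr_ge0 ?mulr_ge0// hc_density_ge0. Qed.

Lemma measurable_splice s j (K : X -> bool -> R) :
  (forall b, measurable_fun setT (K^~ b)) ->
  measurable_fun setT (splice s j K).
Proof.
move=> mK; apply: measurable_funD; apply: measurable_funM.
- apply: (measurableT_comp _ mx); apply: measurable_indic; exact: measurableC.
- exact: measurable_hc_density.
- by apply: (measurableT_comp _ mx); exact: measurable_indic.
- rewrite (_ : (fun u => _) = fun u : W => if u.2 then K u.1.1 true else K u.1.1 false).
    by apply: measurable_fun_ifT => //; apply: (measurableT_comp (mK _) mx).
  by apply/funext => -[z []].
Qed.

Lemma integral_splice s (j : 'I_m) (K : X -> bool -> R) (k : R) :
  (forall b, measurable_fun setT (K^~ b)) -> (forall x b, 0 <= K x b) ->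
  (\int[mu]_(x in block j) ((K x true + K x false) / 2)%:E = k%:E)%E ->
  (\int[hc_base H]_u (splice s j K u)%:E = (1 - w + k)%:E)%E.
Proof.
move=> mK K0 Kk.
under eq_integral do rewrite /splice EFinD.
rewrite ge0_integralD//; first last.
- apply/measurable_EFinP; apply: measurable_funM.
    by apply: (measurableT_comp _ mx); exact: measurable_indic.
  rewrite (_ : (fun u => _) = fun u : W => if u.2 then K u.1.1 true else K u.1.1 false).
    by apply: measurable_fun_ifT => //; apply: (measurableT_comp (mK _) mx).
  by apply/funext => -[z []].
- by move=> u _; rewrite lee_fin mulr_ge0.
- apply/measurable_EFinP; apply: measurable_funM; last exact: measurable_hc_density.
  by apply: (measurableT_comp _ mx); apply: measurable_indic; exact: measurableC.
- by move=> u _; rewrite lee_fin mulr_ge0// hc_density_ge0.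
by rewrite integral_density_off_block// integral_on_block// Kk wE -EFinB -EFinD.
Qed.

Lemma min_likelihood_off_block n s (j : 'I_m) :
  (((1 - w) ^+ n)%:E <=
   \int[lam n]_u (Num.min (L s u) (L (flip j s) u))%:E)%E.
Proof.
(* This keeps only the samples avoiding block [j], on which the two likelihoods coincide. *)
pose K (x : X) (b : bool) : R := 0.
have mK b : measurable_fun setT (K^~ b) by exact: measurable_cst.
have K0 x b : 0 <= K x b by [].
have i0 : (\int[mu]_(x in block j) ((K x true + K x false) / 2)%:E = 0%:E)%E.
  by rewrite /K; under eq_integral do rewrite addr0 mul0r; rewrite integral0.
have := integral_splice s mK K0 i0; rewrite addr0 => iK.
rewrite -(integral_iid_prod_fin n (measurable_splice s j mK) (splice_ge0 s j K0) iK).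
apply: ge0_le_integral => //.
- by move=> u _; rewrite lee_fin prodr_ge0// => x _; exact: splice_ge0.
- by apply: emeasurable_prod_tuple; exact: measurable_splice.
- by apply/measurable_EFinP; apply: measurable_minr; exact: measurable_likelihood.
move=> u _; rewrite lee_fin le_min; apply/andP; split; apply: ler_prod => x _;
    rewrite splice_ge0//=; have [xj|xj] := pselect (block j x.1.1).
- by rewrite splice_on// hc_density_ge0.
- by rewrite splice_off.
- by rewrite splice_on// hc_density_ge0.
- by rewrite splice_off// hc_density_flip_off.
Qed.

Definition hellinger x : R :=
  Num.sqrt (q true x * q false x) + Num.sqrt ((1 - q true x) * (1 - q false x)).

Definition discrepancy x : R :=
  (Num.sqrt (q true x * (1 - q false x)) - Num.sqrt ((1 - q true x) * q false x)) ^+ 2.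

Lemma hellinger_ge0 x : 0 <= hellinger x.
Proof. by rewrite addr_ge0// sqrtr_ge0. Qed.

(** Lagrange's identity for two unit vectors, the square roots of the two conditional laws. *)
Lemma hellinger_sqr x : hellinger x ^+ 2 = 1 - discrepancy x.
Proof.
rewrite /hellinger /discrepancy; have /andP[a0 a1] := q01 true x.
have /andP[b0 b1] := q01 false x; move: (q true x) (q false x) a0 a1 b0 b1 => a b a0 a1 b0 b1.
have a1' : 0 <= 1 - a by lra.
have b1' : 0 <= 1 - b by lra.
rewrite !sqrtrM//.
have e1 := sqr_sqrtr a0; have e2 := sqr_sqrtr b0.
have e3 := sqr_sqrtr a1'; have e4 := sqr_sqrtr b1'.
move: (Num.sqrt a) (Num.sqrt b) (Num.sqrt (1 - a)) (Num.sqrt (1 - b)) e1 e2 e3 e4.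
move=> A B A' B' e1 e2 e3 e4.
have -> : (A * B + A' * B') ^+ 2 = (A ^+ 2 + A' ^+ 2) * (B ^+ 2 + B' ^+ 2) -
  (A * B' - A' * B) ^+ 2 by ring.
by rewrite e1 e2 e3 e4; ring.
Qed.

Lemma measurable_discrepancy : measurable_fun setT discrepancy.
Proof.
apply: measurable_funX; apply: measurable_funB; apply: measurable_sqrt;
  apply: measurable_funM => //; exact: measurable_funB.
Qed.

Lemma measurable_hellinger : measurable_fun setT hellinger.
Proof.
apply: measurable_funD; apply: measurable_sqrt; apply: measurable_funM => //;
  exact: measurable_funB.
Qed.

(** Given the inputs, the affinity of the two sample laws is [B], the product of [hellinger] over
    the inputs in block [j], and their total variation distance is at most [sqrt(1 - B^2)]. Jensen's
    inequality and the mean [(1 - w d)^n] of [B^2] conclude; the unconditional affinity would only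
    bring in the square of the mean of [B]. *)
Lemma min_likelihood_hellinger n s (j : 'I_m) (d : R) :
  (\int[mu]_(x in block j) (discrepancy x)%:E = (w * d)%:E)%E ->
  ((1 - Num.sqrt (1 - (1 - w * d) ^+ n))%:E <=
   \int[lam n]_u (Num.min (L s u) (L (flip j s) u))%:E)%E.
Proof.
move=> dE.
have ih : (\int[mu]_(x in block j) (hellinger x ^+ 2)%:E = (w - w * d)%:E)%E.
  have : (\int[mu]_(x in block j) (hellinger x ^+ 2)%:E +
          \int[mu]_(x in block j) (discrepancy x)%:E = w%:E)%E.
    rewrite -ge0_integralD//; do ?[by move=> x _; rewrite lee_fin sqr_ge0
      |by apply/measurable_EFinP; apply: measurable_funTS; exact: measurable_discrepancy
      |by apply/measurable_EFinP; apply: measurable_funTS; apply: measurable_funX;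
        exact: measurable_hellinger].
    under eq_integral => x _ do rewrite -EFinD hellinger_sqr subrK.
    by rewrite integral_cst// mul1e; exact: wE.
  rewrite dE; case: (\int[mu]_(x in _) _)%E => //= r [].
  by move=> rw; congr EFin; lra.
(* On the block, [K1] tilts the geometric mean of the two densities by [hellinger], and [K2] tilts
   each density by its square. All of these have the integral of [hellinger^2] over the block,
   namely [w - w d]. *)
pose K1 x b := hellinger x * (2 * Num.sqrt (branch (q true x) b * branch (q false x) b)).
pose K2 s' x b := hellinger x ^+ 2 * (2 * branch (q (s' : bool) x) b).
have mbr t b : measurable_fun setT (fun x => branch (q t x) b).
  by apply: measurable_branch.
have mK1 b : measurable_fun setT (K1^~ b).
  apply: measurable_funM; first exact: measurable_hellinger.
  by apply: measurable_funM => //; apply: measurable_sqrt; exact: measurable_funM.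
have mK2 t b : measurable_fun setT ((K2 t)^~ b).
  apply: measurable_funM; last exact: measurable_funM.
  by apply: measurable_funX; exact: measurable_hellinger.
have K10 x b : 0 <= K1 x b by rewrite !mulr_ge0 ?hellinger_ge0 ?sqrtr_ge0.
have K20 t x b : 0 <= K2 t x b by rewrite !mulr_ge0 ?hellinger_ge0 ?branch_ge0.
have i1 : (\int[mu]_(x in block j) ((K1 x true + K1 x false) / 2)%:E = (w - w * d)%:E)%E.
  rewrite -ih; apply: eq_integral => x _; congr EFin.
  by rewrite /K1 /branch -mulrDr -mulrDr -/(hellinger x); field.
have i2 t : (\int[mu]_(x in block j) ((K2 t x true + K2 t x false) / 2)%:E = (w - w * d)%:E)%E.
  by rewrite -ih; apply: eq_integral => x _; congr EFin; rewrite /K2 /branch; field.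
pose s' := flip j s; set rho := 1 - w * d.
have rhoE : 1 - w + (w - w * d) = rho by rewrite /rho; ring.
have P1 := integral_iid_prod_fin n (measurable_splice s j mK1) (splice_ge0 s j K10)
  (integral_splice s mK1 K10 i1).
have P2 := integral_iid_prod_fin n (measurable_splice s j (mK2 (s j)))
  (splice_ge0 s j (K20 (s j))) (integral_splice s (mK2 (s j)) (K20 (s j)) (i2 (s j))).
have P3 := integral_iid_prod_fin n (measurable_splice s' j (mK2 (~~ s j)))
  (splice_ge0 s' j (K20 (~~ s j)))
  (integral_splice s' (mK2 (~~ s j)) (K20 (~~ s j)) (i2 (~~ s j))).
rewrite !rhoE in P1 P2 P3.
pose ht (u : W) := if `[< block j u.1.1 >] then hellinger u.1.1 else 1.
have s'j : s' j = ~~ s j by rewrite ffunE eqxx.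
have E1 u : splice s j K1 u = ht u * Num.sqrt (dens s u * dens s' u).
  rewrite /ht; case: asboolP => xj; last first.
    have -> : dens s' u = dens s u by exact: hc_density_flip_off.
    rewrite splice_off// mul1r -[dens s u * _]expr2 sqrtr_sqr.
    by rewrite ger0_norm// hc_density_ge0.
  rewrite splice_on// /K1 !(hc_density_block q _ xj) s'j.
  have -> : 2 * branch (q (s j) u.1.1) u.2 * (2 * branch (q (~~ s j) u.1.1) u.2) =
     2 ^+ 2 * (branch (q true u.1.1) u.2 * branch (q false u.1.1) u.2).
    by case: (s j) => /=; ring.
  by rewrite [in RHS](sqrtrM _ (sqr_ge0 _)) sqrtr_sqr ger0_norm.
have E2 u : splice s j (K2 (s j)) u = ht u ^+ 2 * dens s u.
  rewrite /ht; case: asboolP => xj; last by rewrite splice_off// expr1n mul1r.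
  by rewrite splice_on// /K2 (hc_density_block q _ xj).
have E3 u : splice s' j (K2 (~~ s j)) u = ht u ^+ 2 * dens s' u.
  rewrite /ht; case: asboolP => xj; last by rewrite splice_off// expr1n mul1r.
  by rewrite splice_on// /K2 (hc_density_block q _ xj) s'j.
pose B (u : n.-tuple W) := \prod_(x <- u) ht x.
have PE1 (u : n.-tuple W) : \prod_(x <- u) splice s j K1 x = B u * Num.sqrt (L s u * L s' u).
  rewrite (eq_bigr _ (fun i _ => E1 i)) big_split; congr (_ * _).
  rewrite /likelihood -[in RHS]big_split /=.
  elim: (tval u) => [|a l IH]; first by rewrite !big_nil sqrtr1.
  by rewrite !big_cons [in RHS]sqrtrM ?mulr_ge0 ?hc_density_ge0// IH.
have PE2 (u : n.-tuple W) : \prod_(x <- u) splice s j (K2 (s j)) x = B u ^+ 2 * L s u.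
  by rewrite (eq_bigr _ (fun i _ => E2 i)) big_split /= prodrXl.
have PE3 (u : n.-tuple W) : \prod_(x <- u) splice s' j (K2 (~~ s j)) x = B u ^+ 2 * L s' u.
  by rewrite (eq_bigr _ (fun i _ => E3 i)) big_split /= prodrXl.
have mL t := measurable_likelihood H mq t (n := n).
have L0 t u := likelihood_ge0 H q01 t (u : n.-tuple W).
pose M (u : n.-tuple W) := Num.min (L s u) (L s' u).
have mM : measurable_fun setT M by apply: measurable_minr.
have M0 u : 0 <= M u by rewrite le_min !L0.
have I1 : (\int[lam n]_u (M u)%:E <= 1)%E.
  rewrite -(integral_likelihood n s); apply: ge0_le_integral => //.
  - by move=> u _; rewrite lee_fin M0.
  - exact/measurable_EFinP.
  - exact/measurable_EFinP.
  - by move=> u _; rewrite lee_fin ge_min lexx.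
have I0 : (0 <= \int[lam n]_u (M u)%:E)%E.
  by apply: integral_ge0 => u _; rewrite lee_fin.
have [r Ir] : exists r, (\int[lam n]_u (M u)%:E = r%:E)%E.
  by move: I0 I1; case: (\int[lam n]_u _)%E => // r; exists r.
rewrite -/s' -/(M _) Ir lee_fin.
have Q2 (u : n.-tuple W) : 0 <= \prod_(x <- u) splice s j (K2 (s j)) x.
  by apply: prodr_ge0 => x _; exact: splice_ge0.
have Q3 (u : n.-tuple W) : 0 <= \prod_(x <- u) splice s' j (K2 (~~ s j)) x.
  by apply: prodr_ge0 => x _; exact: splice_ge0.
have Q1 (u : n.-tuple W) : 0 <= \prod_(x <- u) splice s j K1 x.
  by apply: prodr_ge0 => x _; exact: splice_ge0.
have mQ1 : measurable_fun [set: n.-tuple W] (fun u => \prod_(x <- u) splice s j K1 x).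
  by apply: measurable_prod_tuple; exact: measurable_splice.
have mQ2 : measurable_fun [set: n.-tuple W] (fun u => \prod_(x <- u) splice s j (K2 (s j)) x).
  by apply: measurable_prod_tuple; exact: measurable_splice.
have mQ3 : measurable_fun [set: n.-tuple W] (fun u => \prod_(x <- u) splice s' j (K2 (~~ s j)) x).
  by apply: measurable_prod_tuple; exact: measurable_splice.
have h0 : 0 <= 1 / 2 :> R by lra.
pose A (u : n.-tuple W) := 1 / 2 * L s u + 1 / 2 * L s' u.
pose A' (u : n.-tuple W) := 1 / 2 * \prod_(x <- u) splice s j (K2 (s j)) x +
  1 / 2 * \prod_(x <- u) splice s' j (K2 (~~ s j)) x.
have mA : measurable_fun setT A by apply: measurable_funD; apply: measurable_funM.
have mA' : measurable_fun setT A' by apply: measurable_funD; apply: measurable_funM.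
have A0 u : 0 <= A u by rewrite addr_ge0// mulr_ge0.
have A'0 u : 0 <= A' u by rewrite addr_ge0// mulr_ge0.
have iA := integral_lin2 (mL s) (mL s') (L0 s) (L0 s') h0 h0
  (integral_likelihood n s) (integral_likelihood n s').
have iA' := integral_lin2 mQ2 mQ3 Q2 Q3 h0 h0 P2 P3.
have half2 (x : R) : 1 / 2 * x + 1 / 2 * x = x by field.
rewrite !half2 in iA iA'.
have rho0 : 0 <= rho ^+ n.
  by rewrite -lee_fin -P1; apply: integral_ge0 => u _; rewrite lee_fin.
apply: le_one_sub_sqrt => [|k k0].
  have rho1 : rho <= 1.
    rewrite /rho gerBl -lee_fin -dE; apply: integral_ge0 => x _.
    by rewrite lee_fin sqr_ge0.
  have [rho_ge0|rho_lt0] := leP 0 rho; first exact: exprn_ile1.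
  have : (0%:E <= rho%:E)%E.
    rewrite -rhoE -(integral_splice s mK1 K10 i1); apply: integral_ge0 => u _.
    by rewrite lee_fin splice_ge0.
  by rewrite lee_fin leNgt rho_lt0.
have ki : 0 <= k^-1 by rewrite invr_ge0 ltW.
have k2i : 0 <= (2 * k)^-1 by rewrite invr_ge0 mulr_ge0// ltW.
have kk : 0 <= k / 2 + (2 * k)^-1 by rewrite addr_ge0// divr_ge0// ltW.
have iL := integral_lin2 mA mQ1 A0 Q1 ler01 ki iA P1.
have iR1 := integral_lin2 mM mA M0 A0 ler01 kk Ir iA.
have m1 : measurable_fun setT (fun u => 1 * M u + (k / 2 + (2 * k)^-1) * A u).
  by apply: measurable_funD; apply: measurable_funM.
have p1 u : 0 <= 1 * M u + (k / 2 + (2 * k)^-1) * A u.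
  by rewrite addr_ge0// mulr_ge0.
have iR := integral_lin2 m1 mA' p1 A'0 ler01 k2i iR1 iA'.
(* [le_min_sqrtM] integrated over the samples, with its negative terms moved to the other side. *)
have : ((1 * 1 + k^-1 * rho ^+ n)%:E <=
  (1 * (1 * r + (k / 2 + (2 * k)^-1) * 1) + (2 * k)^-1 * rho ^+ n)%:E)%E.
  rewrite -iL -iR; apply: ge0_le_integral => //.
  - by move=> u _; rewrite lee_fin addr_ge0// mulr_ge0.
  - by apply/measurable_EFinP; apply: measurable_funD; apply: measurable_funM.
  - by apply/measurable_EFinP; apply: measurable_funD; apply: measurable_funM.
  move=> u _; rewrite lee_fin /A' PE1 PE2 PE3 /A.
  have := le_min_sqrtM (B u) (L0 s u) (L0 s' u) k0; rewrite -/(M u).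
  have -> : k^-1 = 2 * (2 * k)^-1 by field; rewrite gt_eqF.
  by clear; lra.
rewrite lee_fin; have -> : (1 - rho ^+ n) / (2 * k) = (2 * k)^-1 * (1 - rho ^+ n).
  by rewrite mulrC.
have -> : k^-1 = 2 * (2 * k)^-1 by field; rewrite gt_eqF.
lra.
Qed.

End likelihood_ratio.

(** * Likelihoods of constant symmetrical hypercubes *)

Section constant_symmetrical.
Context {R : realType} {dX dY : measure_display}.
Context {X : measurableType dX} {Y : measurableType dY} {m : nat}.
Variable H : hypercube R X Y m.
Local Notation mu := (hc_mu H).
Local Notation block j := (hc_part H (lift ord0 j)).
Local Notation W := ((X * Y) * bool)%type.
Variable c : bool -> R.
Hypothesis c01 : forall t, 0 <= c t <= 1.
Hypothesis c_sym : forall t, c (~~ t) = 1 - c t.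
Let q t (x : X) := c t.
Hypothesis qE : forall t (j : 'I_m),
  {ae mu, forall x, block j x -> q t x = hc_p H t x}.
Variable w : R.
Hypothesis wE : forall j : 'I_m, mu (block j) = w%:E.
Local Notation dens := (hc_density H q).
Local Notation lam n := (iid (hc_base H) n).
Local Notation L := (likelihood H q).

Let mq t : measurable_fun setT (q t). Proof. exact: measurable_cst. Qed.
Let q01 t x : 0 <= q t x <= 1. Proof. exact: c01. Qed.

(** Off block [j] the two densities coincide and homogeneity pulls them out of [G]; on the block the
    observation is a sign, with opposite biases under the two vertices. *)
Lemma integral_homogeneous s (j : 'I_m) (G : R -> R -> R) (x y : R) :
  0 <= x -> 0 <= y ->
  (forall a b, 0 <= a -> 0 <= b -> 0 <= G a b) ->
  (forall k a b, 0 <= k -> 0 <= a -> 0 <= b -> G (k * a) (k * b) = k * G a b) ->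
  (\int[hc_base H]_u (G (x * dens s u) (y * dens (flip j s) u))%:E =
   ((1 - w) * G x y + w * (G (c (s j) * x) ((1 - c (s j)) * y) +
                           G ((1 - c (s j)) * x) (c (s j) * y)))%:E)%E.
Proof.
move=> x0 y0 G0 GZ; set p := c (s j).
have /andP[p0 p1] : 0 <= p <= 1 by exact: c01.
have p'E : c (~~ s j) = 1 - p by exact: c_sym.
have p'0 : 0 <= 1 - p by lra.
pose K (_ : X) (b : bool) : R :=
  G (x * (2 * branch p b)) (y * (2 * branch (1 - p) b)).
have br0 b : 0 <= branch p b by case: b.
have br'0 b : 0 <= branch (1 - p) b by case: b => //=; lra.
have K0 z b : 0 <= K z b by apply: G0; rewrite !mulr_ge0.
have mK b : measurable_fun setT (K^~ b) by exact: measurable_cst.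
have g0 : 0 <= G x y by exact: G0.
have mx : measurable_fun [set: W] (fun u : W => u.1.1).
  by apply: measurableT_comp => //; exact: measurable_fst.
have mblock : measurable (block j) by exact: hc_part_measurable.
have mK2 : measurable_fun setT (fun u : W => K u.1.1 u.2).
  rewrite (_ : (fun u => _) = fun u : W => if u.2 then K point true else K point false).
    by apply: measurable_fun_ifT => //; exact: measurable_snd.
  by apply/funext => -[z []].
transitivity (\int[hc_base H]_u (G x y * (\1_(~` block j) u.1.1 * dens s u) +
    1 * (\1_(block j) u.1.1 * K u.1.1 u.2))%:E)%E.
  apply: eq_integral => u _; congr EFin; rewrite !indicE mul1r.
  have [uj|uj] := pselect (block j u.1.1).
    rewrite memNset/=; last by [].
    rewrite mem_set// mul0r mulr0 add0r mul1r /K.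
    by rewrite !(hc_density_block q _ uj) ffunE eqxx /q p'E.
  rewrite mem_set// memNset// mul0r addr0 mul1r hc_density_flip_off//.
  by rewrite [x * _]mulrC [y * _]mulrC GZ ?hc_density_ge0// mulrC.
rewrite (integral_lin2 (r1 := 1 - w) (r2 := w * ((K point true + K point false) / 2)))//.
- congr EFin; rewrite mul1r [_ * (1 - w)]mulrC /K /=.
  have e z b : z * (2 * b) = 2 * (b * z) :> R by ring.
  have -> : 1 - (1 - p) = p by ring.
  by rewrite !e !GZ ?mulr_ge0//; field.
- apply: measurable_funM; last exact: measurable_hc_density.
  by apply: (measurableT_comp _ mx); apply: measurable_indic; exact: measurableC.
- apply: measurable_funM => //.
  by apply: (measurableT_comp _ mx); exact: measurable_indic.
- by move=> u; rewrite mulr_ge0// hc_density_ge0.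
- by move=> u; rewrite mulr_ge0.
- by rewrite integral_density_off_block// wE EFinB.
- rewrite integral_on_block//.
  transitivity (\int[mu]_(x in block j) ((K point true + K point false) / 2)%:E)%E.
    by apply: eq_integral.
  rewrite integral_cst// [X in (_ * X)%E = _](_ : _ = w%:E); last exact: wE.
  by rewrite -EFinM mulrC.
Qed.

(** A binomial number of observations falls in block [j], and these are independent signs. The
    weights [x] and [y] carry the likelihoods of earlier observations through the induction. *)
Lemma integral_min_likelihood n s (j : 'I_m) (x y : R) : 0 <= w <= 1 ->
  0 <= x -> 0 <= y ->
  (\int[lam n]_u (Num.min (x * L s u) (y * L (flip j s) u))%:E =
   (binomial_mean w n (fun k =>
      sign_affinity (c (s j)) (1 - c (s j)) k x y))%:E)%E.
Proof.
move=> w01; have /andP[w0 w1] := w01.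
have /andP[p0 p1] := c01 (s j); set p := c (s j) in p0 p1 *.
have p'0 : 0 <= 1 - p by lra.
have mL n' t := measurable_likelihood H mq t (n := n').
have L0 n' t u := likelihood_ge0 H q01 t (u : n'.-tuple W).
have bm0 k a b : 0 <= a -> 0 <= b ->
    0 <= binomial_mean w k (fun i => sign_affinity p (1 - p) i a b).
  move=> a0 b0; have -> : 0 = binomial_mean w k (fun i => 0 + 0 * i%:R).
    by rewrite binomial_mean_affine mul0r addr0.
  apply: le_binomial_mean => // i; rewrite mul0r addr0.
  exact: sign_affinity_ge0.
elim: n x y => [|n IH] x y x0 y0.
  rewrite /= integral_dirac//; last first.
    apply/measurable_EFinP; apply: measurable_minr; apply: measurable_funM => //; exact: mL.
  by rewrite diracT mul1e /likelihood !big_nil !mulr1 sign_affinity0.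
rewrite ge0_integral_iidS; last 2 first.
- apply/measurable_EFinP; apply: measurable_minr; apply: measurable_funM => //; exact: mL.
- by move=> u; rewrite lee_fin le_min !mulr_ge0// L0.
transitivity (\int[hc_base H]_u (binomial_mean w n (fun k =>
   sign_affinity p (1 - p) k (x * dens s u) (y * dens (flip j s) u)))%:E)%E.
  apply: eq_integral => u _.
  rewrite -IH ?mulr_ge0 ?hc_density_ge0//; apply: eq_integral => t _.
  by rewrite /likelihood /= !big_cons !mulrA.
rewrite (@integral_homogeneous s j (fun a b => binomial_mean w n (fun k =>
  sign_affinity p (1 - p) k a b)))//.
- rewrite /= -binomial_meanD; congr (_ + _ * binomial_mean _ _ _)%:E.
  by apply/funext => k /=; rewrite sign_affinityS.
- by move=> a b a0 b0; exact: bm0.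
- move=> k a b k0 a0 b0; rewrite -binomial_meanZ; congr binomial_mean.
  by apply/funext => i; rewrite sign_affinityZ.
Qed.

Lemma hc_density_gt0 s u : (forall t, 0 < c t) -> 0 < dens s u.
Proof.
move=> c0; have br t b : 0 < branch (c t) b.
  by case: b => //=; rewrite -c_sym.
have [u0|u0] := pselect (hc_part H ord0 u.1.1); first by rewrite hc_density_rest.
have [j uj] := hc_rest_block u0.
by rewrite (hc_density_block q _ uj); apply: mulr_gt0 => //; exact: br.
Qed.

(** [le_harmonic_mean] integrated term by term. Positive [c] keeps its denominators nonzero, and
    writing the inverse as a real power gives access to the measurability of powers. *)
Lemma integral_harmonic_likelihood n s (j : 'I_m) (d : R) :
  (forall t, 0 < c t) -> (forall t, (2 * c t - 1) ^+ 2 = d) ->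
  ((1 + 1 / 2 * (1 - (1 - Num.sqrt (1 - d)) * w) ^+ n -
    1 / 2 * (1 + ((1 + d) / Num.sqrt (1 - d) - 1) * w) ^+ n)%:E <=
   \int[lam n]_u (2 * (L s u * L (flip j s) u) *
     (L s u + L (flip j s) u) `^ (-1))%:E)%E.
Proof.
move=> c0 cd; pose s' := flip j s; set p := c (s j).
have s'j : s' j = ~~ s j by rewrite ffunE eqxx.
have p0 : 0 < p by exact: c0.
have p'E : c (~~ s j) = 1 - p by exact: c_sym.
have p'0 : 0 < 1 - p by rewrite -p'E.
set r := Num.sqrt (1 - d).
have dE : d = (2 * p - 1) ^+ 2 by rewrite cd.
have d4 : 1 - d = 2 ^+ 2 * (p * (1 - p)) by rewrite dE; ring.
have rE : r = 2 * Num.sqrt (p * (1 - p)).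
  by rewrite /r d4 (sqrtrM _ (sqr_ge0 _)) sqrtr_sqr ger0_norm.
have r0 : 0 < r by rewrite rE mulr_gt0// sqrtr_gt0 mulr_gt0.
have r2 : r ^+ 2 = 1 - d by rewrite sqr_sqrtr// d4 !mulr_ge0// ltW.
have den0 t u : 0 < dens t u by exact: hc_density_gt0.
have L0 t (u : n.-tuple W) : 0 < L t u by apply: prodr_gt0.
have mL t := measurable_likelihood H mq t (n := n).
have mblock : measurable (block j) by exact: hc_part_measurable.
(* On the block the geometric mean of the two densities is [2 sqrt(p (1 - p)) = r], and the square
   of either over it has mean [(1 + d) / r], because [2 p^2 + 2 (1 - p)^2 = 1 + (2 p - 1)^2]. *)
pose K1 (_ : X) (b : bool) := r.
pose K2 t (_ : X) (b : bool) := (2 * branch (c t) b) ^+ 2 / r.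
have mK1 b : measurable_fun setT (K1^~ b) by exact: measurable_cst.
have mK2 t b : measurable_fun setT ((K2 t)^~ b) by exact: measurable_cst.
have K10 x b : 0 <= K1 x b by rewrite ltW.
have K20 t x b : 0 <= K2 t x b by rewrite divr_ge0 ?sqr_ge0// ltW.
have const_int (k : R) : (\int[mu]_(x in block j) k%:E = (w * k)%:E)%E.
  rewrite integral_cst// EFinM muleC; congr (_ * _)%E; exact: wE.
have i1 : (\int[mu]_(x in block j) ((K1 x true + K1 x false) / 2)%:E = (w * r)%:E)%E.
  by rewrite -const_int; apply: eq_integral => x _; congr EFin; rewrite /K1; field.
have i2 t : (\int[mu]_(x in block j) ((K2 t x true + K2 t x false) / 2)%:E =
    (w * ((1 + d) / r))%:E)%E.
  rewrite -const_int; apply: eq_integral => x _; congr EFin.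
  by rewrite /K2 /= -(cd t); field; rewrite gt_eqF.
have P1 := integral_iid_prod_fin n (measurable_splice H mq s j mK1)
  (splice_ge0 H q01 s j K10) (integral_splice mq q01 qE wE s mK1 K10 i1).
have P2 t t' := integral_iid_prod_fin n (measurable_splice H mq t' j (mK2 t))
  (splice_ge0 H q01 t' j (K20 t)) (integral_splice mq q01 qE wE t' (mK2 t) (K20 t) (i2 t)).
have E1 u : splice H q s j K1 u = Num.sqrt (dens s u * dens s' u).
  have [uj|uj] := pselect (block j u.1.1); last first.
    rewrite splice_off// (_ : dens s' u = dens s u); last exact: hc_density_flip_off.
    by rewrite -expr2 sqrtr_sqr ger0_norm// ltW.
  rewrite splice_on// /K1 !(hc_density_block q _ uj) s'j /q p'E /r d4 -/p.
  by congr Num.sqrt; case: u.2; rewrite /branch; ring.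
have E2 t u : t = s \/ t = s' -> splice H q t j (K2 (t j)) u = dens t u ^+ 2 / splice H q s j K1 u.
  move=> tE; have [uj|uj] := pselect (block j u.1.1); last first.
    rewrite !splice_off//; have -> : dens t u = dens s u.
      by case: tE => -> //; exact: hc_density_flip_off.
    by field; rewrite gt_eqF.
  by rewrite !splice_on// /K2 /K1 (hc_density_block q _ uj).
have PE1 (u : n.-tuple W) :
    \prod_(x <- u) splice H q s j K1 x = Num.sqrt (L s u * L s' u).
  rewrite (eq_bigr _ (fun i _ => E1 i)) /likelihood -[in RHS]big_split /=.
  elim: (tval u) => [|a l IH]; first by rewrite !big_nil sqrtr1.
  by rewrite !big_cons [in RHS]sqrtrM ?mulr_ge0 ?(ltW (den0 _ _))// IH.
have PE2 t (u : n.-tuple W) : t = s \/ t = s' ->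
    \prod_(x <- u) splice H q t j (K2 (t j)) x =
    L t u ^+ 2 / Num.sqrt (L s u * L s' u).
  move=> tE; rewrite (eq_bigr _ (fun i _ => E2 t i tE)) big_split /= prodrXl.
  by rewrite prodfV PE1.
have Q1 (u : n.-tuple W) : 0 <= \prod_(x <- u) splice H q s j K1 x.
  by apply: prodr_ge0 => x _; exact: splice_ge0.
have Q2 t (u : n.-tuple W) : 0 <= \prod_(x <- u) splice H q t j (K2 (t j)) x.
  by apply: prodr_ge0 => x _; exact: splice_ge0.
have mQ1 : measurable_fun [set: n.-tuple W]
    (fun u => \prod_(x <- u) splice H q s j K1 x).
  by apply: measurable_prod_tuple; exact: measurable_splice.
have mQ2 t : measurable_fun [set: n.-tuple W]
    (fun u => \prod_(x <- u) splice H q t j (K2 (t j)) x).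
  by apply: measurable_prod_tuple; exact: measurable_splice.
have h0 : 0 <= 1 / 2 :> R by lra.
have q0 : 0 <= 1 / 4 :> R by lra.
pose A (u : n.-tuple W) := 1 / 2 * L s u + 1 / 2 * L s' u.
pose B (u : n.-tuple W) := 1 / 4 * \prod_(x <- u) splice H q s j (K2 (s j)) x +
  1 / 4 * \prod_(x <- u) splice H q s' j (K2 (s' j)) x.
pose hm (u : n.-tuple W) := 2 * (L s u * L s' u) * (L s u + L s' u) `^ (-1).
have hmE u : hm u = 2 * (L s u * L s' u) / (L s u + L s' u).
  by rewrite /hm powR_inv1// addr_ge0// ltW.
have mA : measurable_fun setT A by apply: measurable_funD; apply: measurable_funM.
have mB : measurable_fun setT B by apply: measurable_funD; apply: measurable_funM.
have mhm : measurable_fun setT hm.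
  apply: measurable_funM; first by apply: measurable_funM => //; exact: measurable_funM.
  apply: (measurableT_comp (measurable_powR (-1)) (measurable_funD (mL s) (mL s'))).
have A0 u : 0 <= A u by rewrite addr_ge0// mulr_ge0// ltW.
have B0 u : 0 <= B u by rewrite addr_ge0// mulr_ge0.
have hm0 u : 0 <= hm u.
  by rewrite !mulr_ge0 ?powR_ge0// ltW.
have iA := integral_lin2 (mL s) (mL s') (fun u => ltW (L0 s u)) (fun u => ltW (L0 s' u))
  h0 h0 (integral_likelihood mq q01 qE n s) (integral_likelihood mq q01 qE n s').
have iB := integral_lin2 (mQ2 s) (mQ2 s') (Q2 s) (Q2 s') q0 q0 (P2 (s j) s) (P2 (s' j) s').
have hA u : hm u <= A u.
  rewrite hmE ler_pdivrMr ?addr_gt0// /A; have := sqr_ge0 (L s u - L s' u); nra.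
have [z iz] : exists z, (\int[lam n]_u (hm u)%:E = z%:E)%E.
  have I0 : (0 <= \int[lam n]_u (hm u)%:E)%E.
    by apply: integral_ge0 => u _; rewrite lee_fin.
  have I1 : (\int[lam n]_u (hm u)%:E <= (1 / 2 * 1 + 1 / 2 * 1)%:E)%E.
    rewrite -iA; apply: ge0_le_integral => //.
    - by move=> u _; rewrite lee_fin.
    - exact/measurable_EFinP.
    - exact/measurable_EFinP.
    - by move=> u _; rewrite lee_fin; exact: hA.
  by move: I0 I1; case: (\int[lam n]_u _)%E => // z; exists z.
rewrite -/s' iz lee_fin.
have iL := integral_lin2 mA mQ1 A0 Q1 ler01 h0 iA P1.
have iR := integral_lin2 mhm mB hm0 B0 ler01 ler01 iz iB.
have : ((1 * (1 / 2 * 1 + 1 / 2 * 1) + 1 / 2 * (1 - w + w * r) ^+ n)%:E <=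
   (1 * z + 1 * (1 / 4 * (1 - w + w * ((1 + d) / r)) ^+ n +
                 1 / 4 * (1 - w + w * ((1 + d) / r)) ^+ n))%:E)%E.
  rewrite -iL -iR; apply: ge0_le_integral => //.
  - by move=> u _; rewrite lee_fin addr_ge0// mulr_ge0.
  - by apply/measurable_EFinP; apply: measurable_funD; apply: measurable_funM.
  - by apply/measurable_EFinP; apply: measurable_funD; apply: measurable_funM.
  move=> u _; rewrite lee_fin hmE /B (PE2 s u (or_introl erefl)) (PE2 s' u (or_intror erefl)) PE1 /A.
  by have := le_harmonic_mean (L0 s u) (L0 s' u); lra.
rewrite lee_fin.
have -> : 1 - w + w * r = 1 - (1 - r) * w by ring.
have -> : 1 - w + w * ((1 + d) / r) = 1 + ((1 + d) / r - 1) * w by ring.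
lra.
Qed.

End constant_symmetrical.

(** * Edge probability and edge discrepancies *)

Section edge.
Context {R : realType} {dX dY : measure_display}.
Context {X : measurableType dX} {Y : measurableType dY} {m : nat}.
Variable H : hypercube R X Y m.
Local Notation mu := (hc_mu H).
Local Notation block j := (hc_part H (lift ord0 j)).
Local Notation w := (edge_probability H).
Local Notation dII := (edge_discrepancy2 H).
Variable m_ge1 : (1 <= m)%N.
Local Notation j0 := (Ordinal m_ge1).

Lemma first_blockE : first_block H = block j0.
Proof.
rewrite /first_block; congr hc_part; apply: val_inj.
by rewrite /= inordK.
Qed.

Lemma edge_probabilityE j : mu (block j) = w%:E.
Proof.
rewrite /edge_probability fineK; last by apply: fin_num_measure; exact: hc_part_measurable.
by rewrite first_blockE; exact: hc_same_mass.
Qed.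

Lemma edge_probability_itv : 0 <= w <= 1.
Proof.
have e := edge_probabilityE j0.
have e0 : (0 <= w%:E)%E by rewrite -e; exact: measure_ge0.
have e1 : (w%:E <= 1)%E.
  by rewrite -e; apply: probability_le1; exact: hc_part_measurable.
by rewrite -!lee_fin e0.
Qed.

Lemma edge_discrepancy1E (ell : Y -> Y -> R) (r : R) : w != 0 ->
  ((r * w)%:E * edge_discrepancy1 ell H = r%:E * \int[mu]_(x in block j0)
     (psi ell (hc_pp H x) (hc_pm H x) (hc_h1 H x) (hc_h2 H x) (1 / 2))%:E)%E.
Proof.
move=> w0; rewrite /edge_discrepancy1 /cond_expect first_blockE.
rewrite [X in inve X](_ : _ = w%:E); last exact: edge_probabilityE.
rewrite inver (negbTE w0) [X in (_ * X)%E = _]muleC muleA -EFinM.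
by rewrite mulfK.
Qed.

Lemma integral_discrepancy_hc_p0 j :
  (\int[mu]_(x in block j) (discrepancy (hc_p0 H) x)%:E = (w * dII)%:E)%E /\
  0 <= dII <= 1.
Proof.
have mblock i : measurable (block i) by exact: hc_part_measurable.
have md := measurable_discrepancy (measurable_hc_p0 H).
have d0 x : 0 <= discrepancy (hc_p0 H) x by exact: sqr_ge0.
have d1 x : discrepancy (hc_p0 H) x <= 1.
  have := sqr_ge0 (hellinger (hc_p0 H) x).
  by rewrite (hellinger_sqr (hc_p0_itv H)) subr_ge0.
have /andP[w0 w1] := edge_probability_itv.
set D := (\int[mu]_(x in block j0) (discrepancy (hc_p0 H) x)%:E)%E.
have Dj i : (\int[mu]_(x in block i) (discrepancy (hc_p0 H) x)%:E = D)%E.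
  pose F (v : R * R * Y * Y) : \bar R :=
    ((Num.sqrt (v.1.1.1 * (1 - v.1.1.2)) - Num.sqrt ((1 - v.1.1.1) * v.1.1.2)) ^+ 2)%:E.
  have F0 v : (0 <= F v)%E by rewrite lee_fin sqr_ge0.
  have m1 : measurable_fun [set: R * R * Y * Y] (fun v : R * R * Y * Y => v.1.1.1).
    by apply: measurableT_comp => //; apply: measurableT_comp.
  have m2 : measurable_fun [set: R * R * Y * Y] (fun v : R * R * Y * Y => v.1.1.2).
    by apply: measurableT_comp => //; apply: measurableT_comp.
  have mF : measurable_fun setT F.
    apply/measurable_EFinP; apply: measurable_funX; apply: measurable_funB;
      apply: measurable_sqrt; apply: measurable_funM => //; exact: measurable_funB.
  rewrite /D.
  have e := same_quadruple_law H i j0 mF F0.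
 exact: e.
have dE : dII = fine (D / w%:E)%E.
  rewrite /edge_discrepancy2 /cond_expect first_blockE; congr (fine (_ * inve _)).
    apply: eq_integral => x /set_mem xj; rewrite /discrepancy !hc_p0E//;
    exact: hc_block_rest xj.
  exact: edge_probabilityE.
have D0 : (0 <= D)%E by apply: integral_ge0 => x _; rewrite lee_fin.
have D1 : (D <= w%:E)%E.
  apply: (@le_trans _ _ (\int[mu]_(x in block j0) 1%:E)%E).
    apply: ge0_le_integral => //.
    - by move=> x _; rewrite lee_fin.
    - by apply/measurable_EFinP; exact: measurable_funTS.
    - by move=> x _; rewrite lee_fin.
  rewrite integral_cst// mul1e le_eqVlt; apply/orP; left; apply/eqP; exact: edge_probabilityE.
rewrite Dj dE; move: D0 D1; clear Dj dE; case: D => // r; rewrite !lee_fin => r0 rw.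
(* For [w = 0] the convention [0 * +oo = 0] gives [dII = 0], which satisfies both claims. *)
have [wz|wz] := eqVneq w 0.
  have -> : r = 0 by apply/le_anti; rewrite r0 -wz rw.
  by rewrite mul0e /= mulr0 lexx ler01.
rewrite inver (negbTE wz) -EFinM /=; split; first by congr EFin; field.
have w_gt0 : 0 < w by rewrite lt_neqAle eq_sym wz.
by rewrite divr_ge0//= ler_pdivrMr// mul1r.
Qed.

End edge.

(** * From bounds on pairs of likelihoods to bounds on the excess risk *)

Section testing.
Context {R : realType} {dX dY : measure_display}.
Context {X : measurableType dX} {Y : measurableType dY} {m n : nat}.
Variable H : hypercube R X Y m.
Variable q : bool -> X -> R.
Hypothesis mq : forall t, measurable_fun setT (q t).
Hypothesis q01 : forall t x, 0 <= q t x <= 1.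
Hypothesis qE : forall t (j : 'I_m),
  {ae hc_mu H, forall x, hc_part H (lift ord0 j) x -> q t x = hc_p H t x}.
Variable ell : Y -> Y -> R.
Hypothesis ell_measurable : measurable_fun [set: Y * Y] (fun u => ell u.1 u.2).
Hypothesis phi_defined : forall (y1 y2 : Y) (p : R), 0 <= p <= 1 ->
  has_lbound (range (two_point_risk ell y1 y2 p)).
Hypothesis phi_measurable :
  measurable_fun ([set p : R | 0 <= p <= 1] `*` [set: Y * Y])
    (fun u => phi ell u.2.1 u.2.2 u.1).
Variable ghat : n.-tuple (X * Y)%type -> {mfun X >-> Y}.
Hypothesis well_posedP : forall s, well_posed ell (hc_P H s).
Hypothesis risk_measurable : forall s,
  measurable_fun setT (fun z => risk ell (hc_P H s) (ghat z)).
Hypothesis near_minimizers : has_measurable_near_minimizers ell H.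

Lemma sup_excess_ge_min (i : 'I_m) (M : \bar R) (e : R) :
  (forall j s, (e%:E <= \int[iid (hc_base H) n]_u
     (Num.min (likelihood H q s u) (likelihood H q (flip j s) u))%:E)%E) ->
  (forall s, (expected_excess_risk ell ghat (hc_P H s) <= M)%E) ->
  (m%:R%:E * \int[hc_mu H]_(x in hc_part H (lift ord0 i))
     (psi ell (hc_pp H x) (hc_pm H x) (hc_h1 H x) (hc_h2 H x) (1 / 2))%:E
   * e%:E <= M)%E.
Proof.
move=> he hM; set C := (\int[_]_(x in _) _)%E.
have h01 : 0 <= (1 / 2 : R) <= 1 by apply/andP; split; lra.
have CE j : block_psi H q ell j (1 / 2) = C by exact: block_psiE.
have C0 : (0 <= C)%E by rewrite -(CE i); exact: block_psi_ge0.
have -> : (m%:R%:E * C * e%:E = (m%:R / 2)%:E * ((2 * e)%:E * C))%E.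
  by rewrite muleA -EFinM muleAC -EFinM; congr (_%:E * _)%E; field.
apply: (sup_excess_ge mq q01 qE ell_measurable phi_defined phi_measurable
  well_posedP risk_measurable near_minimizers
  (l := fun a b => 2 * Num.min a b)) => //.
- by apply: measurable_funM => //; exact: measurable_minr.
- by move=> a b a0 b0; rewrite mulr_ge0// le_min a0.
- by move=> a b; rewrite minC.
(* Both weights are lowered to [c], as the block excesses are nonnegative; equal weights make the
   posterior 1/2. *)
- move=> j a b g a0 b0; set c := Num.min a b.
  have c0 : 0 <= c by rewrite le_min a0.
  have A0 t : (0 <= block_excess H q ell j t g)%E by exact: block_excess_ge0.
  have [->|cn0] := eqVneq c 0.
    by rewrite mulr0 mul0e adde_ge0// mule_ge0// lee_fin.
  have c_gt0 : 0 < c by rewrite lt_neqAle eq_sym cn0.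
  have cc : 0 < c + c by rewrite addr_gt0.
  have := le_block_excess H mq q01 ell_measurable phi_defined phi_measurable j g c0 c0 cc.
  rewrite (_ : c / (c + c) = 1 / 2); last by (field; rewrite gt_eqF).
  rewrite CE (_ : c + c = 2 * c); last by ring.
  move=> /le_trans; apply; apply: leeD; (apply: lee_wpmul2r; first exact: A0);
    rewrite lee_fin ge_min lexx ?orbT//.
- move=> j s; have := he j s.
  move=> h; have -> : (\int[iid (hc_base H) n]_u
      (2 * Num.min (likelihood H q s u) (likelihood H q (flip j s) u))%:E =
      2%:E * \int[iid (hc_base H) n]_u
      (Num.min (likelihood H q s u) (likelihood H q (flip j s) u))%:E)%E.
    rewrite -ge0_integralZl//.
    + by apply/measurable_EFinP; apply: measurable_minr; exact: measurable_likelihood.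
    + by move=> u _; rewrite lee_fin le_min !likelihood_ge0.
  by rewrite EFinM; apply: lee_wpmul2l => //; rewrite lee_fin.
Qed.

(** At the posterior weight [al = a / (a + b)] one has [(a + b) * al * (1 - al) = a b / (a + b)].
    The constant 1/4 is the 1/2 of the pairing times the 1/2 that offsets the factor 2 in the
    harmonic mean. *)
Lemma sup_excess_ge_harmonic (i : 'I_m) (M : \bar R) (e k w : R) : 0 <= k ->
  hc_mu H (hc_part H (lift ord0 i)) = w%:E ->
  (forall x a, hc_part H (lift ord0 i) x -> 0 <= a <= 1 ->
     k * (a * (1 - a)) <=
     psi ell (hc_pp H x) (hc_pm H x) (hc_h1 H x) (hc_h2 H x) a) ->
  (forall j s, (e%:E <= \int[iid (hc_base H) n]_u
     (2 * (likelihood H q s u * likelihood H q (flip j s) u) *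
      (likelihood H q s u + likelihood H q (flip j s) u) `^ (-1))%:E)%E) ->
  (forall s, (expected_excess_risk ell ghat (hc_P H s) <= M)%E) ->
  ((m%:R * w * k / 4 * e)%:E <= M)%E.
Proof.
move=> k0 wE kE he hM.
have mblock j : measurable (hc_part H (lift ord0 j)) by exact: hc_part_measurable.
have w0 : 0 <= w.
  have h : (0 <= w%:E)%E by rewrite -wE; exact: measure_ge0.
  by rewrite lee_fin in h.
have psi_ge j a : 0 <= a <= 1 -> ((w * k * (a * (1 - a)))%:E <= block_psi H q ell j a)%E.
  move=> /[dup] a01 /andP[a0 a1].
  rewrite (block_psiE mq q01 qE phi_defined phi_measurable i j a01).
  rewrite -(block_psiE mq q01 qE phi_defined phi_measurable i i a01).
  have -> : (w * k * (a * (1 - a)))%:E = (\int[hc_mu H]_(x in hc_part H (lift ord0 i))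
      (k * (a * (1 - a)))%:E)%E.
    rewrite integral_cst// [X in _ = (_ * X)%E](_ : _ = w%:E); last exact: wE.
    by rewrite -EFinM; congr EFin; ring.
  apply: ae_ge0_le_integral => //.
  - by move=> x _; rewrite lee_fin !mulr_ge0// subr_ge0.
  - by move=> x _; rewrite lee_fin psi_ge0.
  - by apply/measurable_EFinP; apply: measurable_funTS; exact: measurable_psi.
  - apply: filterS (filterI (qE true i) (qE false i)) => x [q1 q2] xi.
    have x0 := hc_block_rest xi.
    by rewrite lee_fin (q1 xi) (q2 xi) hc_output1// hc_output2//; exact: kE.
have -> : (m%:R * w * k / 4 * e)%:E = ((m%:R / 2)%:E * (e%:E * (w * k / 2)%:E))%E.
  by rewrite -!EFinM; congr EFin; field.
apply: (sup_excess_ge mq q01 qE ell_measurable phi_defined phi_measurable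
  well_posedP risk_measurable near_minimizers
  (l := fun a b => 2 * (a * b) * (a + b) `^ (-1))) => //.
- apply: measurable_funM; first by apply: measurable_funM => //; exact: measurable_funM.
  exact: (measurableT_comp (measurable_powR (-1)) (measurable_funD measurable_fst measurable_snd)).
- by move=> a b a0 b0; rewrite !mulr_ge0// powR_ge0.
- by move=> a b; rewrite [b * a]mulrC [b + a]addrC.
- by rewrite lee_fin !mulr_ge0.
move=> j a b g a0 b0.
have A0 t : (0 <= block_excess H q ell j t g)%E by exact: block_excess_ge0.
have [ab|ab] := eqVneq (a + b) 0.
  have -> : a = 0 by lra.
  by rewrite mul0r mulr0 !mul0r !mul0e add0e mule_ge0.
have ab0 : 0 < a + b by rewrite lt0r ab addr_ge0.
apply: le_trans (le_block_excess H mq q01 ell_measurable phi_defined phi_measurable j g a0 b0 ab0).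
have al01 : 0 <= a / (a + b) <= 1.
  by rewrite divr_ge0 ?(ltW ab0)//= ler_pdivrMr ?mul1r ?lerDl.
apply: le_trans (lee_wpmul2l _ (psi_ge j _ al01)); last by rewrite lee_fin ltW.
rewrite powR_inv1; last exact: ltW.
rewrite -!EFinM lee_fin le_eqVlt; apply/orP; left; apply/eqP; field.
by rewrite gt_eqF.
Qed.

End testing.

Lemma bernoulli_inequality (R : realFieldType) (x : R) n : 0 <= x <= 1 ->
  1 - n%:R * x <= (1 - x) ^+ n.
Proof.
move=> /andP[x0 x1]; elim: n => [|n IH]; first by rewrite mul0r subr0 expr0.
have : (1 - x) * (1 - n%:R * x) <= (1 - x) ^+ n.+1.
  by rewrite exprS; apply: ler_wpM2l => //; rewrite subr_ge0.
apply: le_trans; rewrite -natr1.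
have : 0 <= n%:R * x * x by rewrite !mulr_ge0.
lra.
Qed.

Section constant_version.
Context {R : realType} {dX dY : measure_display}.
Context {X : measurableType dX} {Y : measurableType dY} {m : nat}.
Variable H : hypercube R X Y m.
Local Notation mu := (hc_mu H).
Local Notation block j := (hc_part H (lift ord0 j)).
Local Notation w := (edge_probability H).

(** Constancy is assumed on X_1 alone; the equality of the block laws carries it almost everywhere
    to the other blocks. *)
Lemma constant_symmetrical_version : (1 <= m)%N -> w != 0 ->
  constant_hypercube H -> symmetrical_hypercube H ->
  exists c : R, [/\ 0 <= c <= 1,
    forall x, first_block H x -> hc_pp H x = c /\ hc_pm H x = 1 - c,
    edge_discrepancy2 H = (2 * c - 1) ^+ 2 &
    forall t (j : 'I_m), {ae mu, forall x, block j x ->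
      (if t then c else 1 - c) = hc_p H t x}].
Proof.
move=> m_ge1 w0 [[c cE] _] sym; exists c.
pose j0 : 'I_m := Ordinal m_ge1.
have fb : first_block H = block j0 := first_blockE H m_ge1.
have wE j : mu (block j) = w%:E := edge_probabilityE H m_ge1 j.
have mblock i : measurable (block i) by exact: hc_part_measurable.
have cE' x : first_block H x -> hc_pp H x = c /\ hc_pm H x = 1 - c.
  move=> x1; split; first exact: cE.
  rewrite -(cE _ x1) sym; first by ring.
  by move: x1; rewrite fb; exact: hc_block_rest.
have c01 : 0 <= c <= 1.
  (* An empty X_1 would leave [c] arbitrary; [w != 0] excludes it. *)
  have [x x1] : first_block H !=set0.
    apply/set0P/eqP => h; move/eqP: w0; apply.
    by rewrite /edge_probability h measure0.
  rewrite -(cE _ x1); have x0 : ~ hc_part H ord0 x.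
    by move: x1; rewrite fb; exact: hc_block_rest.
  by have [] := hc_p_itv x0.
have /andP[c0 c1] := c01.
split=> //.
  rewrite /edge_discrepancy2 /cond_expect fb.
  rewrite (eq_integral (fun=> ((2 * c - 1) ^+ 2)%:E)); last first.
    move=> x /set_mem; rewrite -fb => /cE'[-> ->]; congr EFin.
    have -> : c * (1 - (1 - c)) = c ^+ 2 by ring.
    have -> : (1 - c) * (1 - c) = (1 - c) ^+ 2 by ring.
    rewrite !sqrtr_sqr !ger0_norm ?subr_ge0//; ring.
  rewrite integral_cst// [X in (_ * X / X)%E](_ : _ = w%:E); last exact: wE.
  by rewrite inver (negbTE w0) -!EFinM /= mulfK.
move=> t j.
(* The event [p_+ != c] is empty within X_1, hence null in every block; symmetry then fixes p_-. *)
pose S : set (R * R * Y * Y) := [set v | v.1.1.1 != c].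
have mS : measurable S.
  have m1 : measurable_fun [set: R * R * Y * Y] (fun v : R * R * Y * Y => v.1.1.1).
    by apply: measurableT_comp => //; apply: measurableT_comp.
  have := m1 measurableT (~` [set c]) (measurableC (measurable_set1 c)).
  rewrite setTI; congr measurable; apply/seteqP; split => v /=; first by move/eqP.
  by move=> /eqP.
pose N := hc_quadruple H @^-1` S `&` block j.
have mN : measurable N.
  apply: measurableI => //; rewrite -[_ @^-1` _]setTI.
  exact: measurable_hc_quadruple.
have mF : measurable_fun [set: R * R * Y * Y] (fun v => (\1_S v : R)%:E).
  by apply/measurable_EFinP; exact: measurable_indic.
have key i : (\int[mu]_(x in block i) (\1_S (hc_quadruple H x))%:E =
    mu (hc_quadruple H @^-1` S `&` block i))%E.
  have mQ : measurable (hc_quadruple H @^-1` S).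
    by rewrite -[_ @^-1` _]setTI; exact: measurable_hc_quadruple.
  by rewrite -(integral_indic _ (mblock i) mQ).
have N0 : mu N = 0%E.
  rewrite /N -key (same_quadruple_law H j j0 mF); last first.
    by move=> v; rewrite lee_fin indicE.
  rewrite key (_ : _ `&` _ = set0) ?measure0//.
  apply/seteqP; split => // x [] /= + xj; rewrite (hc_quadrupleE xj) /S /=.
  by rewrite cE ?eqxx// fb.
exists N; split => // x /= /not_implyP[xj h]; split => //=.
rewrite (hc_quadrupleE xj) /S /=; apply/eqP => e; apply: h.
have x0 : ~ hc_part H ord0 x by exact: hc_block_rest xj.
rewrite /hc_p; case: t; first by rewrite e.
by rewrite -e sym//; ring.
Qed.

End constant_version.

Lemma min_likelihood_gauss (R : realType) (dX dY : measure_display)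
    (X : measurableType dX) (Y : measurableType dY) (m n : nat)
    (H : hypercube R X Y m) (c : bool -> R) (w d : R)
    (s : {ffun 'I_m -> bool}) (j : 'I_m) :
  (forall t, 0 <= c t <= 1) -> (forall t, c (~~ t) = 1 - c t) ->
  (forall t (j : 'I_m), {ae hc_mu H, forall x, hc_part H (lift ord0 j) x ->
     c t = hc_p H t x}) ->
  (forall j : 'I_m, hc_mu H (hc_part H (lift ord0 j)) = w%:E) ->
  0 <= w <= 1 -> (forall t, (2 * c t - 1) ^+ 2 = d) -> d < 1 ->
  ((1 - gauss_mass (Num.sqrt (n%:R * w * d / (1 - d))) - d `^ (1 / 4))%:E <=
   \int[iid (hc_base H) n]_u (Num.min (likelihood H (fun t _ => c t) s u)
      (likelihood H (fun t _ => c t) (flip j s) u))%:E)%E.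
Proof.
move=> c01 c_sym qE wE w01 dE d1.
have /andP[w0 w1] := w01.
have q01 : forall (t : bool) (x : X), 0 <= c t <= 1 by move=> t _; exact: c01.
have mq (t : bool) : measurable_fun [set: X] (fun _ : X => c t) by exact: measurable_cst.
have d0 : 0 <= d by rewrite -(dE true) sqr_ge0.
set I := (\int[_]_u _)%E.
have IE : I = (binomial_mean w n (fun k =>
    sign_affinity (c (s j)) (1 - c (s j)) k 1 1))%:E.
  rewrite -(integral_min_likelihood c01 c_sym qE wE n s j w01 ler01 ler01).
  by apply: eq_integral => u _; rewrite !mul1r.
have := min_likelihood_hellinger mq q01 qE wE n s (j := j) (d := d).
rewrite -/I IE !lee_fin => h1.
have {}h1 : 1 - Num.sqrt (1 - (1 - w * d) ^+ n) <=
    binomial_mean w n (fun k => sign_affinity (c (s j)) (1 - c (s j)) k 1 1).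
  apply: h1; transitivity (\int[hc_mu H]_(x in hc_part H (lift ord0 j)) d%:E)%E; last first.
    rewrite integral_cst; last exact: hc_part_measurable.
    by rewrite [X in (_ * X)%E = _](_ : _ = w%:E) -?EFinM 1?mulrC//; exact: wE.
  apply: eq_integral => x _; rewrite /discrepancy; congr EFin.
  have -> : c false = 1 - c true by exact: c_sym true.
  have /andP[a0 a1] := c01 true.
  have -> : c true * (1 - (1 - c true)) = c true ^+ 2 by ring.
  have -> : (1 - c true) * (1 - c true) = (1 - c true) ^+ 2 by ring.
  by rewrite !sqrtr_sqr !ger0_norm ?subr_ge0// -(dE true); ring.
pose r := Num.sqrt d.
have r0 : 0 <= r by exact: sqrtr_ge0.
have r2 : r ^+ 2 = d by rewrite sqr_sqrtr.
have r1 : r < 1 by rewrite -sqrtr1 ltr_sqrt.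
(* [c (s j)] is [(1 + r) / 2] or [(1 - r) / 2]; exchanging successes and failures makes the two
   cases equal. *)
have affE k : sign_affinity (c (s j)) (1 - c (s j)) k 1 1 =
    sign_affinity ((1 + r) / 2) ((1 - r) / 2) k 1 1.
  have : (2 * c (s j) - 1 - r) * (2 * c (s j) - 1 + r) = 0.
    have -> : (2 * c (s j) - 1 - r) * (2 * c (s j) - 1 + r) =
      (2 * c (s j) - 1) ^+ 2 - r ^+ 2 by ring.
    by rewrite dE r2 subrr.
  move=> /eqP; rewrite mulf_eq0 => /orP[] /eqP e.
    have -> : c (s j) = (1 + r) / 2 by lra.
    by congr sign_affinity; field.
  have -> : c (s j) = (1 - r) / 2 by lra.
  rewrite (_ : 1 - (1 - r) / 2 = (1 + r) / 2); last by field.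
  by rewrite sign_affinity_swap.
rewrite /= in h1 *; move: h1.
rewrite (_ : (fun k => _) =
  fun k => sign_affinity ((1 + r) / 2) ((1 - r) / 2) k 1 1); last first.
  by apply/funext => k.
(* With [t = n w], the square root estimate comes from the Hellinger bound and the Gaussian one from
   the averaged Student comparison. *)
move=> h1; apply: gauss_mass_correction.
- by rewrite d0.
- by rewrite mulr_ge0.
- have -> : 0 = binomial_mean w n (fun k => 0 + 0 * k%:R).
    by rewrite binomial_mean_affine mul0r addr0.
  apply: le_binomial_mean => // k; rewrite mul0r addr0.
  by apply: sign_affinity_ge0 => //; lra.
- apply: le_trans h1; rewrite lerD2l lerN2; apply: ler_wsqrtr.
  have := @bernoulli_inequality _ (w * d) n; rewrite mulr_ge0// mulr_ile1//; last exact: ltW.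
  by move=> /(_ isT); rewrite mulrA; lra.
have := binomial_mean_sign_affinity n w01 (r := r); rewrite r0 r1 => /(_ isT).
rewrite r2 (_ : Num.sqrt (d / (1 - d)) = r / Num.sqrt (1 - d))//.
by rewrite sqrtrM// sqrtrV// subr_ge0 ltW.
Qed.

(** The n-th power of [(1 - d)^w <= 1 - w d], which holds for exponents [w] in [0, 1]. *)
Lemma powR_mul_le_expn (R : realType) (w d : R) n : 0 <= w <= 1 -> 0 <= d <= 1 ->
  (1 - d) `^ (n%:R * w) <= (1 - w * d) ^+ n.
Proof.
move=> /[dup] w01 /andP[w0 w1] /andP[d0 d1].
have d10 : 0 <= 1 - d by rewrite subr_ge0.
rewrite mulrC powRrM powR_mulrn ?powR_ge0//; apply: lerXn2r.
- by rewrite nnegrE powR_ge0.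
- by rewrite nnegrE subr_ge0 mulr_ile1.
by apply: le_trans (powR_le_affine d10 w01) _; rewrite opprB addrCA subrr addr0.
Qed.

Lemma normal_prob_tail (R : realType) (x : R) : 0 <= x ->
  normal_prob 0 1 [set t : R | (x%:E < `|t|%:E)%E] = (1 - gauss_mass x)%:E.
Proof.
move=> x0; pose P : probability _ R := normal_prob 0 1.
have -> : [set t : R | (x%:E < `|t|%:E)%E] = ~` `[- x, x]%classic.
  apply/seteqP; split => t /=; rewrite lte_fin in_itv/= -ler_norml.
    by move=> xt /(lt_le_trans xt); rewrite ltxx.
  by move=> /negP; rewrite -ltNge.
pose A : set R := `[- x, x]%classic.
have mA : measurable A by exact: measurable_itv.
transitivity (1 - P A)%E; first exact: probability_setC.
rewrite /gauss_mass EFinB fineK//; exact: (fin_num_measure P).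
Qed.

Lemma normal_prob_sqrt_tail (R : realType) (t d : R) : 0 <= t -> 0 <= d < 1 ->
  normal_prob 0 1
    [set x : R | (sqrte ((t * d)%:E / (1 - d)%:E) < `|x|%:E)%E] =
  (1 - gauss_mass (Num.sqrt (t * d / (1 - d))))%:E.
Proof.
move=> t0 /andP[d0 d1]; have d1' : 1 - d != 0 by rewrite gt_eqF// subr_gt0.
rewrite inver (negbTE d1') -EFinM.
by rewrite normal_prob_tail ?sqrtr_ge0.
Qed.

(** * The four lower bounds *)

Theorem theorem8p7 (R : realType) (dX dY : measure_display)
    (X : measurableType dX) (Y : measurableType dY)
    (ell : Y -> Y -> R) (m n : nat)
    (calP : set (probability (X * Y)%type R))
    (H : hypercube R X Y m)
    (ghat : n.-tuple (X * Y)%type -> {mfun X >-> Y})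
    (m_ge1 : (1 <= m)%N) (n_ge1 : (1 <= n)%N)
    (H_in_calP : forall s, calP (hc_P H s))
    (ell_measurable :
       measurable_fun [set: Y * Y] (fun u => ell u.1 u.2))
    (phi_defined : forall (y1 y2 : Y) (p : R), 0 <= p <= 1 ->
       has_lbound (range (two_point_risk ell y1 y2 p)))
    (phi_measurable :
       measurable_fun ([set p : R | 0 <= p <= 1] `*` [set: Y * Y])
         (fun u => phi ell u.2.1 u.2.2 u.1))
    (calP_well_posed : forall P, calP P -> well_posed ell P)
    (risk_measurable : forall P, calP P ->
       measurable_fun [set: n.-tuple (X * Y)%type]
         (fun z => risk ell P (ghat z)))
    (near_minimizers : has_measurable_near_minimizers ell H) :
  let w := edge_probability H in
  let dI := edge_discrepancy1 ell H in
  let dII := edge_discrepancy2 H in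
  let sup_excess := ereal_sup [set expected_excess_risk ell ghat P | P in calP] in
  let mwdI := ((m%:R * w)%:E * dI)%E in
  let nw := n%:R * w in
  let bound1 :=
    (mwdI * (1 - Num.sqrt (1 - (1 - dII) `^ nw))%:E)%E in
  let bound1' := (mwdI * (1 - Num.sqrt (nw * dII))%:E)%E in
  [/\ [/\ (bound1 <= sup_excess)%E,
          (bound1' <= sup_excess)%E
        & 1 <= nw -> (bound1' <= bound1)%E],
      constant_hypercube H -> symmetrical_hypercube H ->
      (mwdI * (normal_prob 0 1
                 [set t : R | sqrte ((nw * dII)%:E / (1 - dII)%:E)
                              < `|t|%:E]
               - (dII `^ (1 / 4))%:E)
       <= sup_excess)%E,
      (forall x, ~ hc_part H ord0 x ->
         hc_pp H x = 1 /\ 1 = 1 - hc_pm H x) ->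
      (mwdI * ((1 - w) ^+ n)%:E <= sup_excess)%E
    & forall zeta : R, 0 < zeta ->
      constant_hypercube H -> symmetrical_hypercube H ->
      differentiability_assumption ell H zeta ->
      ((m%:R * w * zeta * dII / 8)%:E
         * (1 + (1 / 2 * (1 - (1 - Num.sqrt (1 - dII)) * w) ^+ n)%:E
              - (1 / 2)%:E
                * (1 + ((1 + dII)%:E / (Num.sqrt (1 - dII))%:E - 1) * w%:E) ^+ n)
       <= sup_excess)%E].
Proof.
move=> w dI dII sup_excess mwdI nw bound1 bound1'.
have exM s : (expected_excess_risk ell ghat (hc_P H s) <= sup_excess)%E.
  by apply: ereal_sup_ubound; exists (hc_P H s).
have wpP s : well_posed ell (hc_P H s) by exact: calP_well_posed.
have rmP s : measurable_fun [set: n.-tuple (X * Y)%type]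
    (fun z => risk ell (hc_P H s) (ghat z)) by exact: risk_measurable.
pose j0 : 'I_m := Ordinal m_ge1.
have wE j : hc_mu H (hc_part H (lift ord0 j)) = w%:E := edge_probabilityE H m_ge1 j.
have w01 : 0 <= w <= 1 := edge_probability_itv H m_ge1.
have /andP[w0 w1] := w01.
have mq := measurable_hc_p0 H.
have q01 := hc_p0_itv H.
have qE := hc_p0_ae H.
have discE j := (integral_discrepancy_hc_p0 H m_ge1 j).1.
have d01 : 0 <= dII <= 1 := (integral_discrepancy_hc_p0 H m_ge1 j0).2.
have /andP[d0 d1] := d01.
have nw0 : 0 <= nw by rewrite mulr_ge0.
pose C := (\int[hc_mu H]_(x in hc_part H (lift ord0 j0))
  (psi ell (hc_pp H x) (hc_pm H x) (hc_h1 H x) (hc_h2 H x) (1 / 2))%:E)%E.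
have C0 : (0 <= C)%E.
  apply: integral_ge0 => x /hc_block_rest x0; have [p1 p2] := hc_p_itv x0.
  by rewrite lee_fin psi_ge0//; apply/andP; split; lra.
(* The factor [w] cancels the conditioning on X_1 in d_I, even when [C] is infinite. For [w = 0] the
   product [mwdI] is 0 whatever d_I. *)
have mwdIE : w != 0 -> mwdI = (m%:R%:E * C)%E.
  by move=> wn0; exact: edge_discrepancy1E.
have mwdI_w0 : w = 0 -> mwdI = 0%E.
  by move=> wz; rewrite /mwdI wz mulr0 mul0e.
have mwdI0 : (0 <= mwdI)%E.
  have [/mwdI_w0->//|/mwdIE ->] := eqVneq w 0.
  by rewrite mule_ge0// lee_fin.
have lower (q : bool -> X -> R) e : (forall t, measurable_fun setT (q t)) ->
    (forall t x, 0 <= q t x <= 1) ->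
    (forall t (j : 'I_m),
      {ae hc_mu H, forall x, hc_part H (lift ord0 j) x -> q t x = hc_p H t x}) ->
    (forall j s, (e%:E <= \int[iid (hc_base H) n]_u
     (Num.min (likelihood H q s u) (likelihood H q (flip j s) u))%:E)%E) ->
    (m%:R%:E * C * e%:E <= sup_excess)%E.
  move=> mq' q01' qE' he.
  exact: (sup_excess_ge_min mq' q01' qE' ell_measurable phi_defined phi_measurable
    wpP rmP near_minimizers j0 he exM).
(* The trivial choice [e = 0]; it settles the degenerate cases [w = 0] and [dII = 1]. *)
have sup0 : (0 <= sup_excess)%E.
  rewrite -[leLHS](mule0 (m%:R%:E * C)); apply: (lower _ _ mq q01 qE) => j s.
  by apply: integral_ge0 => u _; rewrite lee_fin le_min !(likelihood_ge0 H q01).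

have wd01 : 0 <= w * dII <= 1 by rewrite mulr_ge0//= mulr_ile1.
(* [1 - sqrt(1 - (1 - w dII)^n)] dominates both bounds of the first assertion, whatever [nw]. *)
have le1 : 1 - Num.sqrt (1 - (1 - dII) `^ nw) <=
    1 - Num.sqrt (1 - (1 - w * dII) ^+ n).
  by rewrite lerD2l lerN2 ler_wsqrtr// lerD2l lerN2 powR_mul_le_expn.
have le1' : 1 - Num.sqrt (nw * dII) <= 1 - Num.sqrt (1 - (1 - w * dII) ^+ n).
  rewrite lerD2l lerN2 ler_wsqrtr//; have := bernoulli_inequality n wd01.
  by rewrite mulrA -/nw; lra.
have hellinger_bound r : r <= 1 - Num.sqrt (1 - (1 - w * dII) ^+ n) ->
    (mwdI * r%:E <= sup_excess)%E.
  move=> hr; have [/mwdI_w0->|wn0] := eqVneq w 0; first by rewrite mul0e.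
  rewrite mwdIE//; apply: (lower _ _ mq q01 qE) => j s.
  apply: le_trans (min_likelihood_hellinger mq q01 qE wE n s (discE j)).
  by rewrite lee_fin.
split.
- split; [exact: hellinger_bound|exact: hellinger_bound|move=> nw1].
  (* Bernoulli's inequality with the real exponent [nw], which takes this direction from exponent 1
     on. *)
  apply: lee_wpmul2l => //; rewrite lee_fin lerD2l lerN2 ler_wsqrtr//.
  have d10 : 0 <= 1 - dII by rewrite subr_ge0.
  have := powR_ge_affine d10 nw1; lra.
- move=> constH symH; have [/mwdI_w0->|wn0] := eqVneq w 0; first by rewrite mul0e.
  have [c [c01 _ dE cE]] := constant_symmetrical_version m_ge1 wn0 constH symH.
  (* The threshold is then +oo, as [nw > 0] keeps the fraction from being [0 * +oo]; the Gaussian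
     tail is 0 and the bound is at most 0. *)
  have [d1'|dn1] := eqVneq dII 1.
    have w_gt0 : 0 < w by rewrite lt0r wn0.
    have nw_gt0 : 0 < nw by rewrite mulr_gt0// ltr0n.
    rewrite d1' subrr inver eqxx mulr1 gt0_muley ?lte_fin//=.
    have -> : [set t : R | (+oo < `|t|%:E)%E] = set0 by apply/seteqP; split.
    rewrite [normal_prob _ _ _]integral_set0 add0e.
    by apply: le_trans sup0; apply: mule_ge0_le0; rewrite ?lee_fin ?oppr_le0 ?powR_ge0.
  have d_lt1 : dII < 1 by rewrite lt_neqAle dn1.
  rewrite normal_prob_sqrt_tail ?d0// -EFinB mwdIE//.
  pose ct (t : bool) := if t then c else 1 - c.
  have c01' t : 0 <= ct t <= 1 by case: t => //=; lra.
  have c_sym t : ct (~~ t) = 1 - ct t by case: t => //=; lra.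
  have cd t : (2 * ct t - 1) ^+ 2 = dII by rewrite [dII]dE; case: t => //=; ring.
  apply: (lower (fun t _ => ct t)) => //.
  by move=> j s; exact: min_likelihood_gauss.
- move=> _; have [/mwdI_w0->|wn0] := eqVneq w 0; first by rewrite mul0e.
  rewrite mwdIE//; apply: (lower _ _ mq q01 qE) => j s.
  exact: min_likelihood_off_block.
move=> zeta zeta0 constH symH diffH.
have [wz|wn0] := eqVneq w 0; first by rewrite wz mulr0 !mul0r mul0e.
have [c [c01 cE dE qcE]] := constant_symmetrical_version m_ge1 wn0 constH symH.
have coef0 : 0 <= m%:R * w * zeta * dII / 8 by rewrite !mulr_ge0// ltW.
(* By [w > 0] and [n >= 1] the last power is then +oo, and the bound is a nonnegative coefficient
   times -oo. *)
have [d1'|dn1] := eqVneq dII 1.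
  have w_gt0 : 0 < w by rewrite lt0r wn0.
  apply: le_trans sup0; apply: mule_ge0_le0; first by rewrite lee_fin.
  rewrite d1' subrr sqrtr0 inver eqxx gt0_muley ?lte_fin//=.
  have yn : (+oo ^+ n = +oo :> \bar R)%E.
    by move: n_ge1; clear; elim: n => // -[|k] IH _; rewrite // expeS IH// mulyy.
  rewrite gt0_mulye ?lte_fin// addey// yn gt0_muley ?lte_fin ?divr_gt0// addeNy.
  exact: leNye.
have d_lt1 : dII < 1 by rewrite lt_neqAle dn1.
have s_neq0 : Num.sqrt (1 - dII) != 0 by rewrite gt_eqF// sqrtr_gt0 subr_gt0.
pose e := 1 + 1 / 2 * (1 - (1 - Num.sqrt (1 - dII)) * w) ^+ n -
  1 / 2 * (1 + ((1 + dII) / Num.sqrt (1 - dII) - 1) * w) ^+ n.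
(* Strong concavity gives [psi a >= zeta / 2 * (p_+ - p_-)^2 * a (1 - a)], where
   [p_+ - p_- = 2 c - 1] has square [dII]. With the 1/4 of [sup_excess_ge_harmonic] this is the
   coefficient [zeta dII / 8]. *)
suff h : ((m%:R * w * (zeta / 2 * dII) / 4 * e)%:E <= sup_excess)%E.
  rewrite inver (negbTE s_neq0).
  rewrite -(EFin_expe (1 + ((1 + dII) / Num.sqrt (1 - dII) - 1) * w)).
  apply: le_trans h; rewrite le_eqVlt; apply/orP; left; apply/eqP.
  by congr EFin; rewrite -/e; field.
pose ct (t : bool) := if t then c else 1 - c.
have c01' t : 0 <= ct t <= 1 by case: t => //=; lra.
have c_sym t : ct (~~ t) = 1 - ct t by case: t => //=; lra.
have cd t : (2 * ct t - 1) ^+ 2 = dII by rewrite [dII]dE; case: t => //=; ring.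
(* A zero probability would force [dII = 1]. *)
have ct0 t : 0 < ct t.
  have /andP[t0 t1] := c01' t; rewrite lt0r t0 andbT; apply/eqP => tz.
  by move/eqP: dn1; apply; rewrite -(cd t) tz; ring.
have mct (t : bool) : measurable_fun [set: X] (fun _ : X => ct t) by exact: measurable_cst.
have ct01 (t : bool) (x : X) : 0 <= ct t <= 1 by exact: c01'.
have k0 : 0 <= zeta / 2 * dII by rewrite mulr_ge0// divr_ge0// ltW.
apply: (sup_excess_ge_harmonic mct ct01 qcE ell_measurable phi_defined phi_measurable
  wpP rmP near_minimizers k0 (wE j0) _ _ exM).
  move=> x a xj a01; have x1 : first_block H x by rewrite (first_blockE H m_ge1).
  have [cp cm] := cE x x1; have [f' [f'' [df df' zf]]] := diffH x x1.
  have c01m : 0 <= 1 - c <= 1 by lra.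
  rewrite cp cm minC maxC in zf *.
  have conc u v b := @phi_concave _ _ _ ell (hc_h1 H x) (hc_h2 H x) u v b
    (phi_defined _ _).
  have := strong_concavity conc df df' zf c01 c01m a01.
  rewrite [dII]dE /psi; congr (_ <= _); ring.
move=> j s.
exact: integral_harmonic_likelihood.
Qed.
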